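(* Let $R\subset V$, $r\ge1$, and let $(a_i,b_i)\in R\times R$, $1\le i\le r$, satisfy $\mathcal G_R(a_i,b_i)>0$. Let $\omega_i:a_i\to b_i$, $1\le i\le r$, be independent normalized random walks in $R$, let $(P_1,\dots,P_r)$ be the output records of the entangled multipath loop-erasure of $(\omega_1,\dots,\omega_r)$, and let $\gamma_i$ be the directed path corresponding to $P_i$, so that $(\gamma_1,\dots,\gamma_r)$ is the entangled multipath LERW, with range $C_r$. Independently sample an unrooted random-walk loop soup in $R$ with intensity $1$. Assign each loop that intersects $C_r$ to the smallest $i$ for which it intersects $\gamma_i$, and then to the earliest path time $s$ on $\gamma_i$ at which such an intersection occurs. If the loop visits $\gamma_i(s)$ more than once, choose uniformly one of those visits as its starting time. For each time on the entangled multipath LERW, order its assigned random-walk loops by an independent uniform permutation and insert them in that order. Then, conditioned on $(P_1,\dots,P_r)$, the resulting tuple of paths has the same law as the conditional law of $(\omega_1,\dots,\omega_r)$ given $(P_1,\dots,P_r)$.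
   Context: $V$ is a finite set and $Q=(Q_{xy})_{x,y\in V}$ a nonnegative substochastic matrix with spectral radius $<1$. For $R\subset V$, $Q_R$ is the principal submatrix and $\mathcal G_R=(I-Q_R)^{-1}$. For a finite directed path or loop $\xi$, $q(\xi)$ is the product of its edge weights $Q_{xy}$ and $\mathrm{supp}(\xi)$ its vertex set. For $a,b\in R$ with $\mathcal G_R(a,b)>0$, a normalized random walk $\omega:a\to b$ in $R$ is a random finite directed path in $R$ from $a$ to $b$ (possibly of length zero) with $\mathbb P[\omega]=q(\omega)/\mathcal G_R(a,b)$. The intensity-$1$ unrooted random-walk loop soup in $R$ is the Poisson point process on directed loops modulo cyclic shift with intensity the image of the rooted measure giving weight $\frac1n\prod_{i<n}Q_{x_ix_{i+1}}$ to $(x_0,\dots,x_n=x_0)$ in $R$, $n\ge1$. Inserting loops rooted at $\gamma_i(s)$ at time $s$ means replacing the visit of $\gamma_i$ to $\gamma_i(s)$ at time $s$ by the concatenation of these loops. Records. Chronological loop erasure of a directed path $\omega$ from $a$ to $b$ gives $P(\omega)=(\eta;\ell_1,\dots,\ell_m)$, where $\eta$ is the (self-avoiding) loop erasure and $\ell_1,\dots,\ell_m$ are the erased simple directed loops (including loops of length one) in erasure order; directed loops are identified under cyclic shifts but not reversal, and repeated copies are distinguished. In general a record is a tuple of this form modulo adjacent exchanges of simple loops with disjoint supports. Its entangled order $\prec$ is the transitive closure of: $\ell_i\prec\ell_j$ if $i<j$ and $\mathrm{supp}(\ell_i)\cap\mathrm{supp}(\ell_j)\neq\varnothing$; $\ell_i\prec\eta$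 if $\mathrm{supp}(\ell_i)\cap\mathrm{supp}(\eta)\ne\varnothing$. A record is legal if every $\ell_i\prec\eta$. The map $\omega\mapsto P(\omega)$ is a weight-preserving bijection between directed paths and legal records. Write $\mathrm{supp}(P)=\mathrm{supp}(\eta)\cup\bigcup_j\mathrm{supp}(\ell_j)$. For $A\subset R$ and a legal record $P=(\eta;\ell_1,\dots,\ell_m)$, extend $\prec$ by $A\prec\ell_k$ whenever $A\cap\mathrm{supp}(\ell_k)\neq\varnothing$ and take the transitive closure. $\Phi_A(P)$ is the (legal) record that retains $\eta$ and precisely those loops $\ell$ with $A\prec\ell$. (Equivalently: inspect loops in order, starting from $A_0=A$, retaining $\ell_k$ and setting $A_k=A_{k-1}\cup\mathrm{supp}(\ell_k)$ if $\mathrm{supp}(\ell_k)\cap A_{k-1}\ne\varnothing$, otherwise discarding it with $A_k=A_{k-1}$.) Entangled multipath loop-erasure. For directed paths $\omega_i:a_i\to b_i$, put $H_i=P(\omega_i)$, $C_0=\varnothing$, $P_i=\Phi_{C_{i-1}}(H_i)$, $C_i=C_{i-1}\cup\mathrm{supp}(P_i)$, and let $\gamma_i$ be the directed path corresponding to $P_i$. Then $(\gamma_1,\dots,\gamma_r)$ is the entangled multipath loop-erasure of $(\omega_1,\dots,\omega_r)$, with range $C_r$; for independent normalized random walks it is called the entangled multipath LERW. *)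

(* Defs.v *)
From HB Require Import structures.
From Stdlib Require Import Relations.
From mathcomp Require Import all_boot all_order all_algebra perm.
From mathcomp Require Import finmap generic_quotient complex.
From mathcomp Require Import all_classical all_reals all_analysis.

Set Implicit Arguments.
Unset Strict Implicit.
Unset Printing Implicit Defensive.

Import Order.TTheory GRing.Theory Num.Theory.
Import numFieldNormedType.Exports.

Local Open Scope ring_scope.
Local Open Scope quotient_scope.

Section Weights.
Local Open Scope classical_set_scope.
Context {R : realType} {V : finType}.
Implicit Types (Q : V -> V -> R) (D : {set V}).

Definition submatrix Q D : 'M[R]_#|D| :=
  \matrix_(i, j) Q (enum_val i) (enum_val j).

(* The norm of [R[i]] takes its values in [R[i]], hence [Re]. The supremum of a
   finite set of reals is its maximum (and is 0 for the empty set). *)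
Definition spectral_radius n (A : 'M[R]_n) : R :=
  sup [set complex.Re `|z| | z in
        [set z : R[i] | eigenvalue (map_mx (real_complex R) A) z]].

Definition substochastic Q : Prop :=
  (forall x y, 0 <= Q x y) /\ (forall x, \sum_y Q x y <= 1).

(* The membership proofs only serve to index the matrix. *)
Definition green Q D (a b : V) (aD : a \in D) (bD : b \in D) : R :=
  invmx (1%:M - submatrix Q D) (enum_rank_in aD a) (enum_rank_in bD b).

Fixpoint chain_weight Q (x : V) (s : seq V) : R :=
  if s is y :: s' then Q x y * chain_weight Q y s' else 1.

(* A directed path is the nonempty sequence of the vertices it visits. *)
Definition path_weight Q (w : seq V) : R :=
  if w is x :: s then chain_weight Q x s else 1.

Definition path_in D (a b : V) (w : seq V) : bool :=
  [&& ohead w == Some a, last a w == b & all (mem D) w].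

End Weights.

Section Loops.
Local Open Scope set_scope.
Context {V : finType}.

(* [(x, [:: s_1; ..; s_k])] is the rooted loop x -> s_1 -> .. -> s_k -> x, of
   length [k + 1]: the final return to the root is not stored. *)
Definition rloop : Type := (V * seq V)%type.
HB.instance Definition _ := Choice.on rloop.

Definition rloop_seq (l : rloop) : seq V := l.1 :: l.2.

Definition rloop_weight {R : realType} (Q : V -> V -> R) (l : rloop) : R :=
  path_weight Q (rcons (rloop_seq l) l.1).

Definition cyc_equiv (l1 l2 : rloop) : bool :=
  `[< exists i, rot i (rloop_seq l1) = rloop_seq l2 >].

Lemma cyc_equiv_refl : reflexive cyc_equiv.
Proof. by move=> l; apply/asboolP; exists 0%N; rewrite rot0. Qed.

Lemma cyc_equiv_sym : symmetric cyc_equiv.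
Proof.
suff H l1 l2 : cyc_equiv l1 l2 -> cyc_equiv l2 l1.
  by move=> l1 l2; apply/idP/idP => /H.
move=> /asboolP[i Hi]; apply/asboolP.
by exists (size (rloop_seq l2) - i)%N; rewrite -/(rotr i _) -Hi rotK.
Qed.

Lemma cyc_equiv_trans : transitive cyc_equiv.
Proof.
move=> l2 l1 l3 /asboolP[i Hi] /asboolP[j Hj]; apply/asboolP.
by rewrite -Hj -Hi rot_rot_add; eexists; reflexivity.
Qed.

Canonical cyc_equiv_rel :=
  EquivRel cyc_equiv cyc_equiv_refl cyc_equiv_sym cyc_equiv_trans.

Definition uloop : Type := {eq_quot cyc_equiv_rel}.
HB.instance Definition _ := EqQuotient.on uloop.
HB.instance Definition _ := Choice.on uloop.

Definition unroot (l : rloop) : uloop := \pi_uloop l.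

Definition useq (l : uloop) : seq V := rloop_seq (repr l).

Definition lsupp (l : uloop) : {set V} := [set x in useq l].

(* The visits of [l] to [x], as positions in the representative [useq l]. *)
Definition visits (l : uloop) (x : V) : seq nat :=
  [seq j <- iota 0 (size (useq l)) | nth x (useq l) j == x].

End Loops.
Arguments rloop : clear implicits.
Arguments uloop : clear implicits.

Section Records.
Local Open Scope set_scope.
Context {V : finType}.

Definition pre_record : Type := (seq V * seq (uloop V))%type.
HB.instance Definition _ := Choice.on pre_record.

Definition exchange (s1 s2 : seq (uloop V)) : Prop :=
  exists u v l l', [/\ [disjoint lsupp l & lsupp l'],
    s1 = u ++ [:: l, l' & v] & s2 = u ++ [:: l', l & v]].

Definition rec_equiv (p1 p2 : pre_record) : bool :=
  `[< p1.1 = p2.1 /\ clos_refl_sym_trans _ exchange p1.2 p2.2 >].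

Lemma rec_equiv_refl : reflexive rec_equiv.
Proof. by move=> p; apply/asboolP; split=> //; apply: rst_refl. Qed.

Lemma rec_equiv_sym : symmetric rec_equiv.
Proof.
suff H p1 p2 : rec_equiv p1 p2 -> rec_equiv p2 p1.
  by move=> p1 p2; apply/idP/idP => /H.
move=> /asboolP[eq1 eq2]; apply/asboolP; split=> //.
exact: rst_sym.
Qed.

Lemma rec_equiv_trans : transitive rec_equiv.
Proof.
move=> p2 p1 p3 /asboolP[e1 H] /asboolP[e2 H']; apply/asboolP.
by split; [exact: etrans e1 e2|exact: rst_trans H H'].
Qed.

Canonical rec_equiv_rel :=
  EquivRel rec_equiv rec_equiv_refl rec_equiv_sym rec_equiv_trans.

Definition record : Type := {eq_quot rec_equiv_rel}.
HB.instance Definition _ := EqQuotient.on record.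
HB.instance Definition _ := Choice.on record.

Definition rsupp (p : record) : {set V} :=
  [set x in (repr p).1] :|: \bigcup_(l <- (repr p).2) lsupp l.

(* One step of the walk: when the new vertex [x] already lies on the current
   erasure [eta], the piece of [eta] from [x] on is closed into a simple loop
   and erased. *)
Definition erase_step (p : pre_record) (x : V) : pre_record :=
  let: (eta, ls) := p in
  if x \in eta then
    (take (index x eta).+1 eta,
     rcons ls (unroot (x, drop (index x eta).+1 eta)))
  else (rcons eta x, ls).

Definition record_of (w : seq V) : record :=
  \pi_record (foldl erase_step ([::], [::]) w).

(* Nodes of the entangled order: the set [A], the loop at a given position,
   and the loop erasure. *)
Inductive node := NSet | NLoop of nat | NErasure.

Definition prec_step (A : {set V}) (p : pre_record) (u v : node) : Prop :=
  let: (eta, ls) := p in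
  let supp i := nth finset.set0 [seq lsupp l | l <- ls] i in
  match u, v with
  | NSet, NLoop k => ~~ [disjoint A & supp k]
  | NLoop i, NLoop j => (i < j)%N /\ ~~ [disjoint supp i & supp j]
  | NLoop i, NErasure => ~~ [disjoint supp i & [set x in eta]]
  | _, _ => False
  end.

(* For [A = set0] this is the order of the record itself. *)
Definition entangled (A : {set V}) (p : pre_record) : node -> node -> Prop :=
  clos_trans _ (prec_step A p).

Definition legal (p : record) : Prop :=
  forall i, (i < size (repr p).2)%N ->
    entangled finset.set0 (repr p) (NLoop i) NErasure.

(* Exchanging adjacent loops with disjoint supports does not affect which
   loops are retained, so any representative may be used. *)
Definition Phi (A : {set V}) (p : record) : record :=
  let: (eta, ls) := repr p in
  let keep := [seq `[< entangled A (eta, ls) NSet (NLoop i) >]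
              | i <- iota 0 (size ls)] in
  \pi_record (eta, mask keep ls).

(* [entangle set0 [:: H_1; ..; H_r] = [:: P_1; ..; P_r]]. *)
Fixpoint entangle (C : {set V}) (hs : seq record) : seq record :=
  if hs is h :: hs' then
    let p := Phi C h in p :: entangle (C :|: rsupp p) hs'
  else [::].

Definition out_records (ws : seq (seq V)) : seq record :=
  entangle finset.set0 [seq record_of w | w <- ws].

(* Inverse of [record_of], which is a bijection from paths to legal
   records. *)
Definition path_of (p : record) : seq V :=
  xget [::] [set w | record_of w = p]%classic.

Definition multipath_lerw (ws : seq (seq V)) : seq (seq V) :=
  [seq path_of p | p <- out_records ws].

End Records.
Arguments record : clear implicits.

Section Insertion.
Local Open Scope classical_set_scope.
Context {V : finType}.
Implicit Types (gs : seq (seq V)).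

Definition meets (l : uloop V) (g : seq V) : bool := has (mem (lsupp l)) g.

Definition assigned gs (l : uloop V) (i s : nat) : bool :=
  [&& has (meets l) gs, find (meets l) gs == i &
      find (mem (lsupp l)) (nth [::] gs i) == s].

Definition permute (X : Type) (s : seq X) (sigma : 'S_(size s)) : seq X :=
  [seq tnth (in_tuple s) (sigma j) | j : 'I_(size s)].

(* [N l] is the number of copies of [l] in the soup, and the copies of [l] are
   labelled by [c < N l]. [start l c x] is the position at which the copy [c]
   of [l] is rooted if it is inserted at [x], and [sigma i s k] is used to
   order the loops assigned to time [s] of the [i]-th path if there are [k] of
   them. [fset_set] lists a finite set in an arbitrary order (and gives the
   empty list for an infinite set, which the soup almost surely excludes). *)
Definition inserted gs (N : uloop V -> nat) (start : uloop V -> nat -> V -> nat)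
    (sigma : nat -> nat -> forall k, 'S_k) (i s : nat) (x : V) : seq V :=
  let copies : {fset uloop V * nat} :=
    fset_set [set lc | (lc.2 < N lc.1)%N /\ assigned gs lc.1 i s] in
  let rooted := [seq rot (start lc.1 lc.2 x) (useq lc.1)
                | lc <- enum_fset copies] in
  flatten (permute (sigma i s (size rooted))).

Definition insert_loops gs (N : uloop V -> nat)
    (start : uloop V -> nat -> V -> nat)
    (sigma : nat -> nat -> forall k, 'S_k) : seq (seq V) :=
  [seq let g := nth [::] gs i in
       flatten [seq let x := tnth (in_tuple g) s in
                    rcons (inserted gs N start sigma i s x) x
               | s : 'I_(size g)]
  | i <- iota 0 (size gs)].

End Insertion.

Section Probability.
Local Open Scope classical_set_scope.
Local Open Scope ereal_scope.
Context {R : realType} {V : finType} {d : measure_display}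
  {T : measurableType d}.
Implicit Types (P : probability T R) (Q : V -> V -> R) (D : {set V}).

(* To be used with sigma-algebras [F i]. *)
Definition mutually_independent P (I : Type) (F : I -> set (set T)) : Prop :=
  forall n (j : 'I_n -> I) (E : 'I_n -> set T), injective j ->
    (forall k, F (j k) (E k)) ->
    P (\bigcap_(k in setT) E k) = \prod_(k < n) P (E k).

(* The sigma-algebra generated by a variable with countably many values. *)
Definition discrete_events (X : Type) (f : T -> X) : set (set T) :=
  [set f @^-1` B | B in setT].

Definition discrete_law P (X : Type) (f : T -> X) (law : X -> R) : Prop :=
  (forall x, measurable (f @^-1` [set x])) /\
  (forall x, P (f @^-1` [set x]) = (law x)%:E).

Definition normalized_walk P Q D a b (aD : a \in D) (bD : b \in D)
    (omega : T -> seq V) : Prop :=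
  discrete_law P omega (fun w =>
    if path_in D a b w then path_weight Q w / green Q aD bD else 0)%R.

Definition loop_measure Q D (A : set (uloop V)) : \bar R :=
  \esum_(l in [set l : rloop V | all (mem D) (rloop_seq l) /\ A (unroot l)])
    (rloop_weight Q l / (size (rloop_seq l))%:R)%:E.

Definition soup_count (N : uloop V -> T -> nat) (A : set (uloop V)) (t : T)
  : \bar R := \esum_(l in A) (N l t)%:R%:E.

(* Poisson point processes on the countable set of unrooted loops. The second
   argument of the library's [poisson_prob] is a dummy. *)
Definition poisson_point_process P (mu : set (uloop V) -> \bar R)
    (N : uloop V -> T -> nat) : Prop :=
  [/\ forall l n, measurable (N l @^-1` [set n]),
      forall (A : set (uloop V)) n, mu A < +oo ->
        P [set t | soup_count N A t = n%:R%:E] =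
          poisson_prob (fine (mu A)) 0 [set n]
    & forall m (A : 'I_m -> set (uloop V)), trivIset setT A ->
        mutually_independent P (fun k => discrete_events (soup_count N (A k)))].

Definition loop_soup P Q D (N : uloop V -> T -> nat) : Prop :=
  poisson_point_process P (loop_measure Q D) N.

Definition soup_events (N : uloop V -> T -> nat) : set (set T) :=
  <<s \bigcup_(l in setT) discrete_events (N l) >>.

Definition uniform_visit P (l : uloop V) (x : V) (j : T -> nat) : Prop :=
  discrete_law P j (fun n =>
    if n \in visits l x then ((size (visits l x))%:R)^-1 else 0)%R.

Definition uniform_perm P k (sigma : T -> 'S_k) : Prop :=
  discrete_law P sigma (fun=> ((k`!)%:R)^-1)%R.

Inductive source (r : nat) :=
  | Walk of 'I_r
  | Soup
  | Start of uloop V & nat & V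
  | Shuffle of nat & nat & nat.

Definition source_events r (omega : 'I_r -> T -> seq V)
    (N : uloop V -> T -> nat) (start : uloop V -> nat -> V -> T -> nat)
    (sigma : nat -> nat -> forall k, T -> 'S_k) (z : source r)
  : set (set T) :=
  match z with
  | Walk i => discrete_events (omega i)
  | Soup => soup_events N
  | Start l c x => discrete_events (start l c x)
  | Shuffle i s k => discrete_events (sigma i s k)
  end.

Definition cond_law P (X : Type) (E : set T) (f : T -> X) (B : set X) : R :=
  (fine (P (f @^-1` B `&` E)) / fine (P E))%R.

End Probability.

(* Main.v *)
From Stdlib Require Import Relations.
Require Import Defs.
From mathcomp Require Import all_boot all_order all_algebra perm.
From mathcomp Require Import finmap complex.
From mathcomp Require Import all_classical all_reals all_analysis.

Set Implicit Arguments.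
Unset Strict Implicit.
Unset Printing Implicit Defensive.

Import Order.TTheory GRing.Theory Num.Theory.

(** A path is determined by its starting point and the ordered list of
    departures from each vertex.  The departures from [x] follow the erased
    loops through [x] in order, and then the loop erasure; exchanging disjoint
    loops changes none of these lists, so a record determines its path.

    [Phi C] discards exactly what can be written as a closed word inserted just
    before a visit and avoiding both [C] and the earlier part of the path.
    Hence a tuple of walks has the given output records if and only if it is
    obtained, in a unique way, by inserting at each time [s] of each [gamma_i] a
    word that is empty or starts at [gamma_i(s)], and that avoids
    [gamma_1, ..., gamma_(i-1)] and the past of [gamma_i].  The conditional law
    of the walks is therefore a product over these sites, an inserted word [u]
    having weight [q(u)].

    At a site, the assigned Poisson loops, rooted at a uniform visit and
    uniformly permuted, form the sequence [v_1, ..., v_m] with probability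
    [exp(- mass) / m! * \prod_i q(v_i) / k_i], where [k_i] counts the visits of
    [v_i] to its root.  Their concatenation is [u] with probability
    [exp(- mass) * q(u)], because the sum of [1 / (m! k_1 ... k_m)] over all
    compositions [k_1 + ... + k_m] of an integer is [1].  Sites are independent,
    so both conditional laws are proportional to the same product, hence equal. *)

(** * Records and departures *)

(** The inserted words are built from the soup, a random number of starting positions and a
    permutation of random degree, whereas independence is given only for these sources one by one.
    Every event at a site is therefore cut into countably many rectangles, on which the loops, the
    permutation and the starting positions are prescribed separately. Distinct sites then involve
    distinct starting positions, because a loop is assigned to a single site, and the product
    formula passes from rectangles to their countable disjoint unions.

    The insertion is carried out on the fixed paths attached to the conditioning value of the
    records, which makes it independent of the walks. The constant between the two laws is found by
    evaluating both on the whole space, so that no identity between Green functions and loop masses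
    is computed.

    The soup is finite only almost surely; on the exceptional null set the insertion takes a default
    value, which still has to be measurable. *)

Section Exits.
Context {V : eqType}.
Implicit Types (w : seq V) (x y : V).

Definition exits w x : seq V :=
  [seq e.2 | e <- zip w (behead w) & e.1 == x].

Lemma exits_cons x y w z :
  exits (x :: y :: w) z = (if x == z then [:: y] else [::]) ++ exits (y :: w) z.
Proof. by rewrite /exits /=; case: eqP. Qed.

Lemma exits_cat w1 y w2 x :
  exits (w1 ++ y :: w2) x = exits (rcons w1 y) x ++ exits (y :: w2) x.
Proof.
elim: w1 => [|a [|b w1] IH] //=; first by rewrite !exits_cons -catA.
by rewrite !exits_cons -catA -IH.
Qed.

Lemma exits_rcons w x y z :
  exits (rcons (rcons w x) y) z =
  exits (rcons w x) z ++ (if x == z then [:: y] else [::]).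
Proof.
by rewrite -[rcons w x]cats1 -!cat_rcons cats0 -cats1 cat_rcons exits_cat exits_cons
           /exits /= cats0.
Qed.

Lemma exits_nin w x y : x \notin w -> exits (rcons w y) x = [::].
Proof.
elim: w => [|a [|b w] IH] //; first by rewrite inE exits_cons eq_sym => /negPf->.
by rewrite inE negb_or [rcons _ _]/= exits_cons eq_sym => /andP[/negPf-> /IH].
Qed.

(** The closing vertex [y0] is kept apart from the head [y] so that the induction can remove the
    head; a simple loop is the case [y0 = y]. *)
Lemma exits_cycle y p y0 x : uniq (y :: p) -> x \in y :: p ->
  exits (rcons (y :: p) y0) x = [:: next_at x y0 y p].
Proof.
elim: p y => [|z p IH] y; first by rewrite inE exits_cons => _ /eqP->; rewrite /exits /= eqxx.
rewrite cons_uniq => /andP[yzp Uzp]; rewrite !rcons_cons exits_cons -rcons_cons inE eq_sym.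
case: eqP => [<- _|/eqP ne /= xzp]; last by rewrite IH // eq_sym (negPf ne).
by rewrite exits_nin //= ?eqxx.
Qed.

(** The lists act as queues: the first departure from the current vertex gives the next vertex and
    is then deleted, and the path stops when the queue of its current vertex is empty. *)
Lemma exits_inj w w' : ohead w = ohead w' -> exits w =1 exits w' -> w = w'.
Proof.
elim: w w' => [|x w IH] [|x' w'] //= [<-].
case: w IH => [|y w] IH; case: w' => [|y' w'] // H.
- by move: (H x); rewrite exits_cons eqxx /exits.
- by move: (H x); rewrite exits_cons eqxx /exits.
have := H x; rewrite !exits_cons eqxx => -[yy' _]; rewrite -yy' in H *.
congr (_ :: _); apply: IH => //= z; have := H z; rewrite !exits_cons.
by case: eqP => // _ [].
Qed.

End Exits.

Section RecordInj.
Context {V : finType}.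
Implicit Types (w : seq V) (x : V) (l : uloop V) (ls : seq (uloop V)).

Lemma useq_unroot (l : rloop V) : exists i, useq (unroot l) = rot i (rloop_seq l).
Proof.
have : (repr (unroot l) == l %[mod uloop V])%qT by rewrite reprK.
by rewrite eqmodE /= Defs.cyc_equiv_sym /useq => /asboolP[i <-]; exists i.
Qed.

Lemma mem_useq_unroot (l : rloop V) : useq (unroot l) =i rloop_seq l.
Proof. by have [i ->] := useq_unroot l; exact: mem_rot. Qed.

Lemma mem_lsupp_unroot (l : rloop V) x : (x \in lsupp (unroot l)) = (x \in rloop_seq l).
Proof. by rewrite inE mem_useq_unroot. Qed.

Definition supps ls : {set V} := (\bigcup_(l <- ls) lsupp l)%SET.

Lemma supps_cons l ls : supps (l :: ls) = lsupp l :|: supps ls.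
Proof. by rewrite /supps big_cons. Qed.

Lemma supps_cat ls ls' : supps (ls ++ ls') = supps ls :|: supps ls'.
Proof. by rewrite /supps big_cat. Qed.

Lemma supps_rcons ls l : supps (rcons ls l) = supps ls :|: lsupp l.
Proof. by rewrite -cats1 supps_cat supps_cons /supps big_nil finset.setU0. Qed.

Lemma in_supps ls x : (x \in supps ls) = has (fun l => x \in lsupp l) ls.
Proof.
elim: ls => [|l ls IH]; first by rewrite /supps big_nil inE.
by rewrite supps_cons finset.in_setU IH.
Qed.

Lemma rec_equivP (p1 p2 : pre_record) :
  reflect (p1.1 = p2.1 /\ clos_refl_sym_trans _ exchange p1.2 p2.2)
          (p1 == p2 %[mod (record V)])%qT.
Proof. by rewrite eqmodE; exact: asboolP. Qed.

Lemma exchange_invariant (X : Type) (f : seq (uloop V) -> X) :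
  (forall u v l l', [disjoint lsupp l & lsupp l'] ->
     f (u ++ [:: l, l' & v]) = f (u ++ [:: l', l & v])) ->
  forall s1 s2, clos_refl_sym_trans _ exchange s1 s2 -> f s1 = f s2.
Proof.
move=> H s1 s2; elim=> [_ _ [u [v [l [l' [dl -> ->]]]]]||x y _ ->|x y z _ -> _ ->] //.
exact: H.
Qed.

(** Two loops through [x] are not disjoint, so no exchange ever swaps them. *)
Lemma exchange_filter x s1 s2 : clos_refl_sym_trans _ exchange s1 s2 ->
  [seq l <- s1 | x \in lsupp l] = [seq l <- s2 | x \in lsupp l].
Proof.
apply: exchange_invariant => u v l l' dl; rewrite !filter_cat; congr (_ ++ _) => /=.
case xl : (x \in lsupp l) => //; case xl' : (x \in lsupp l') => //.
by move/disjoint_setI0/setP/(_ x): dl; rewrite !inE in xl xl' *; rewrite xl xl'.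
Qed.

Lemma exchange_supps s1 s2 : clos_refl_sym_trans _ exchange s1 s2 ->
  supps s1 = supps s2.
Proof.
apply: exchange_invariant => u v l l' _.
by rewrite !supps_cat !supps_cons !(finset.setUA (lsupp _)) (finset.setUC (lsupp l)).
Qed.

Lemma rsupp_pi eta ls :
  rsupp (\pi_(record V)%qT (eta, ls)) = [set x in eta]%SET :|: supps ls.
Proof.
have /rec_equivP[/= e /exchange_supps] :
  (repr (\pi_(record V)%qT (eta, ls)) == (eta, ls) %[mod (record V)])%qT by rewrite reprK.
by rewrite /rsupp -/(supps _) e => ->.
Qed.

Definition erased w := foldl erase_step ([::], [::]) w.

Lemma erased_rcons w x : erased (rcons w x) = erase_step (erased w) x.
Proof. by rewrite /erased -cats1 foldl_cat. Qed.

Lemma erased_uniq w : uniq (erased w).1.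
Proof.
elim/last_ind: w => //= w x; rewrite erased_rcons; case: (erased w) => eta ls /= Ueta.
case: ifP => /= [_|xeta]; first exact: take_uniq.
by rewrite rcons_uniq xeta.
Qed.

Lemma erased_head w : ohead (erased w).1 = ohead w.
Proof.
elim/last_ind: w => // w x; rewrite erased_rcons.
case: w => [|y w] //; case: (erased (y :: w)) => eta ls /=.
by case: eta => [|z eta] //= [<-]; case: ifP.
Qed.

Lemma erased_last w x : exists e, (erased (rcons w x)).1 = rcons e x.
Proof.
rewrite erased_rcons; case: (erased w) => eta ls /=.
case: ifP => xeta /=; last by exists eta.
by exists (take (index x eta) eta); rewrite (take_nth x) ?index_mem // nth_index.
Qed.

Lemma erased_supp w : [set x in w]%SET = [set x in (erased w).1]%SET :|: supps (erased w).2.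
Proof.
elim/last_ind: w => [|w x IH]; first by apply/setP => y; rewrite !inE in_supps.
rewrite erased_rcons; case: (erased w) IH => eta ls /= IH.
have {}IH y : (y \in w) = (y \in eta) || (y \in supps ls).
  by move/setP/(_ y): IH; rewrite !inE.
apply/setP => y; rewrite !inE mem_rcons inE IH.
case: ifP => xeta /=; last by rewrite mem_rcons inE orbA.
rewrite supps_rcons inE mem_lsupp_unroot /rloop_seq /= inE.
rewrite -[in y \in eta](cat_take_drop (index x eta).+1 eta) mem_cat.
case: eqP => [->|_] /=; first by rewrite !orbT.
by rewrite -!orbA; congr (_ || _); rewrite orbC.
Qed.

(** A simple loop leaves each of its vertices once, and [next] is invariant under rotation, hence
    does not depend on the root chosen by [repr]. *)
Definition loop_exits ls x := [seq next (useq l) x | l <- ls & x \in lsupp l].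

(* The [j]-th departure from [x] follows the [j]-th erased loop through [x], or
   the loop erasure once these loops are exhausted. *)
Lemma exits_erased w x :
  exits w x = loop_exits (erased w).2 x ++ exits (erased w).1 x.
Proof.
elim/last_ind: w => [|w y IH]; first by rewrite /exits.
case/lastP: w IH => [|w z] IH; first by rewrite /exits.
rewrite exits_rcons IH (erased_rcons (rcons w z)).
have Ueta := erased_uniq (rcons w z).
have [e He] := erased_last w z.
case: (erased (rcons w z)) He Ueta {IH} => eta ls /= -> {eta} Ueta.
case yeta : (y \in rcons e z) => /=; last by rewrite exits_rcons catA.
set eta := rcons e z in yeta Ueta *.
set d := drop _ eta; set t := take _ eta.
have tE : t = rcons (take (index y eta) eta) y.
  by rewrite /t (take_nth y) ?index_mem // nth_index.
have etaE : eta = take (index y eta) eta ++ y :: d.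
  by rewrite -cat_rcons -tE cat_take_drop.
set p := take _ eta in tE etaE.
rewrite -catA /loop_exits filter_rcons mem_lsupp_unroot /rloop_seq /=.
(* Here [eta = p ++ y :: d] ends in [z]: its departures and the new one from [z] to [y] are those of
   [t], followed by those of the loop [y :: d] closed up. *)
have -> : exits eta x ++ (if z == x then [:: y] else [::]) =
          exits t x ++ exits (rcons (y :: d) y) x.
  rewrite etaE exits_cat -tE -catA; congr (_ ++ _).
  have [d' dE] : exists d', y :: d = rcons d' z.
    case/lastP: d etaE => [|d' z'] etaE.
      by exists [::]; move: etaE; rewrite cats1 /eta => /rcons_inj[_ ->].
    by exists (y :: d'); move: etaE; rewrite /eta -rcons_cons -rcons_cat => /rcons_inj[_ ->].
  by rewrite dE exits_rcons.
move: (Ueta); rewrite etaE cat_uniq => /and3P[_ Hd Ud].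
(* If [x] lies on the closed loop, it does not lie on [p]; then [exits t x] is empty, and the
   departure along the new loop can be listed before it. *)
case: ifPn => xd; last by rewrite exits_nin // cats0.
have xp : x \notin p by apply: contra Hd => xp; apply/hasP; exists x.
rewrite tE exits_nin // map_rcons cat0s cats0 exits_cycle // cats1; congr rcons.
have [i E] := useq_unroot (y, d).
by rewrite -[RHS]/(next (useq (unroot (y, d))) x) E next_rot.
Qed.

Lemma record_of_inj : injective (@record_of V).
Proof.
move=> w w' /eqP/rec_equivP; rewrite -/(erased w) -/(erased w') => -[He Hls].
apply: exits_inj; first by rewrite -(erased_head w) -(erased_head w') He.
by move=> x; rewrite (exits_erased w) (exits_erased w') He /loop_exits (exchange_filter x Hls).
Qed.

Lemma path_of_record w : path_of (record_of w) = w.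
Proof.
rewrite /path_of; case: xgetP => [w' _ /record_of_inj //|/(_ w)].
by case.
Qed.

Lemma rsupp_record_of w : rsupp (record_of w) = [set x in w]%SET.
Proof.
by rewrite /record_of -/(erased w) [erased w]surjective_pairing rsupp_pi -erased_supp.
Qed.

End RecordInj.

Lemma nth_map_ord (X : Type) (x0 : X) n (F : 'I_n -> X) (i : 'I_n) :
  nth x0 [seq F j | j : 'I_n] i = F i.
Proof. by rewrite (nth_map i) ?size_enum_ord // nth_ord_enum. Qed.

(** * Discarding loops and inserting words *)

Section Discarding.
Context {V : finType}.
Implicit Types (w g u : seq V) (x : V) (A C : {set V}) (l : uloop V).
Implicit Types (ls : seq (uloop V)).

Lemma disjoint_setUr (A B C : {set V}) :
  [disjoint A & B :|: C] = [disjoint A & B] && [disjoint A & C].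
Proof. by rewrite -!setI_eq0 finset.setIUr finset.setU_eq0. Qed.

(** The inspection of the loops in order with a growing set, an equivalent form of the selection
    made by [Phi] (see [mask_entangled]) on which induction is possible. *)
Fixpoint linked A ls : seq (uloop V) :=
  if ls is l :: ls' then
    if [disjoint A & lsupp l] then linked A ls' else l :: linked (A :|: lsupp l) ls'
  else [::].

Lemma linked_cat A ls1 ls2 :
  linked A (ls1 ++ ls2) = linked A ls1 ++ linked (A :|: supps (linked A ls1)) ls2.
Proof.
elim: ls1 A => [|l ls1 IH] A /=; first by rewrite /supps big_nil finset.setU0.
by case: ifP => _; rewrite IH //= supps_cons finset.setUA.
Qed.

Lemma supps_linked A ls : supps (linked A ls) \subset supps ls.
Proof.
elim: ls A => [|l ls IH] A /=; first by [].
rewrite supps_cons; case: ifP => _; first by rewrite (fintype.subset_trans (IH _)) ?finset.subsetUr.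
by rewrite supps_cons finset.setUS.
Qed.

Lemma linked_nil A ls : [disjoint A & supps ls] -> linked A ls = [::].
Proof.
elim: ls => //= l ls IH; rewrite supps_cons => dA.
by rewrite !(disjointWr _ dA) ?finset.subsetUl ?finset.subsetUr // IH // (disjointWr _ dA) ?finset.subsetUr.
Qed.

(** Retaining a loop enlarges the set by its support, which does not affect the test of a
    neighbouring loop disjoint from it. *)
Lemma linked_exchange A ls ls' : clos_refl_sym_trans _ exchange ls ls' ->
  clos_refl_sym_trans _ exchange (linked A ls) (linked A ls').
Proof.
elim=> [_ _ [u [v [l [l' [dl -> ->]]]]]|?|x y _ H|x y z _ H _ H'].
- rewrite !linked_cat; set B := _ :|: supps _; set t := linked A u.
  have dl' := dl; rewrite disjoint_sym in dl' => /=.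
  have E (D D' : {set V}) : [disjoint D & D'] -> [disjoint B :|: D & D'] = [disjoint B & D'].
    by move=> dD; rewrite -!setI_eq0 finset.setIUl (disjoint_setI0 dD) finset.setU0.
  case lB : [disjoint B & lsupp l]; case lB' : [disjoint B & lsupp l'] => /=;
    rewrite ?E // ?lB ?lB'; try exact: rst_refl.
  apply: rst_step; exists t, (linked (B :|: lsupp l :|: lsupp l') v), l, l'; split=> //.
  by rewrite finset.setUAC.
- exact: rst_refl.
- exact: rst_sym.
- exact: rst_trans H H'.
Qed.

Definition supp_at ls k : {set V} := nth finset.set0 [seq lsupp l | l <- ls] k.

(** The chains of [entangled] from [NSet] to a loop, extended at their last step. Between its ends
    such a chain meets loops only, as nothing precedes [NSet] and nothing follows [NErasure]. *)
Inductive reach A ls : nat -> Prop :=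
| reach_set k : ~~ [disjoint A & supp_at ls k] -> reach A ls k
| reach_loop i k : (i < k)%N -> reach A ls i ->
    ~~ [disjoint supp_at ls i & supp_at ls k] -> reach A ls k.

Lemma entangled_reach A eta ls k :
  entangled A (eta, ls) NSet (NLoop k) <-> reach A ls k.
Proof.
split.
  suff H v : clos_trans_n1 _ (prec_step A (eta, ls)) NSet v ->
      forall k, v = NLoop k -> reach A ls k.
    by move=> /clos_trans_tn1_iff/H; apply.
  elim=> {v} [v H k' E|v z]; first by subst v; exact: reach_set.
  move=> + _ IH k' E; subst z; case: v IH => [|i|] IH //=; first exact: reach_set.
  move=> -[ik dik].
  by apply: (@reach_loop A ls i k') => //; exact: IH.
elim=> {k} [k H|i k ik _ IH H]; first exact: t_step.
by apply: t_trans IH _; apply: t_step.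
Qed.

(** No loop precedes the first one, so it is linked only if it meets [A] itself. It is then absorbed
    into the set; otherwise no chain uses it. *)
Lemma reach_cons A l ls k : reach A (l :: ls) k.+1 <->
  reach (if [disjoint A & lsupp l] then A else A :|: lsupp l) ls k.
Proof.
set A' := if _ then _ else _.
have sA : A \subset A' by rewrite /A'; case: ifP => _ //; exact: finset.subsetUl.
split.
  move: {-2}k.+1 (erefl k.+1) => m E H.
  elim: H k E => {m} [m dm|i m im Hi IH dm] k E; subst m.
    by apply: reach_set; apply: contra dm; exact: disjointWl.
  case: i im Hi IH dm => [|i] im Hi IH dm; last by apply: (@reach_loop _ _ i k) => //; exact: IH.
  case: {-1}_ / Hi (erefl 0%N) => [[|//] d0 _|? []//].
  rewrite /supp_at /= in d0 dm.
  apply: reach_set; apply: contra dm; apply: disjointWl.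
  by rewrite /A' (negPf d0) finset.subsetUr.
elim=> {k} [k dk|i k ik _ IH dk]; last exact: (@reach_loop _ _ i.+1).
case dA : [disjoint A & lsupp l]; rewrite /A' dA in dk; first exact: reach_set.
have [dAk|dAk] := boolP [disjoint A & supp_at ls k]; last exact: reach_set.
apply: (@reach_loop _ _ 0) => //; first by apply: reach_set; rewrite /supp_at /= dA.
apply: contra dk; rewrite -!setI_eq0 finset.setIUl (disjoint_setI0 dAk) finset.set0U.
by [].
Qed.

Lemma mask_entangled A eta ls :
  mask [seq `[< entangled A (eta, ls) NSet (NLoop i) >] | i <- iota 0 (size ls)] ls =
  linked A ls.
Proof.
under eq_map => i do rewrite (propext (entangled_reach A eta ls i)).
elim: ls A => [|l ls IH] A //=.
have -> : `[< reach A (l :: ls) 0 >] = ~~ [disjoint A & lsupp l].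
  apply/asboolP/idP => [H|H]; last by apply: reach_set; exact: H.
  by case: {-1}_ / H (erefl 0%N) => [[|//] + _|? []//].
rewrite -[1%N]addn0 iotaDl -map_comp.
under eq_map => i do rewrite /= add1n (propext (reach_cons A l ls i)).
by case: [disjoint A & lsupp l] => /=; rewrite IH.
Qed.

Lemma Phi_pi A eta ls :
  Phi A (\pi_(record V)%qT (eta, ls)) = \pi_(record V)%qT (eta, linked A ls).
Proof.
have /rec_equivP[/=] :
  (repr (\pi_(record V)%qT (eta, ls)) == (eta, ls) %[mod (record V)])%qT by rewrite reprK.
rewrite /Phi; case: (repr _) => e s /= -> H; rewrite mask_entangled.
by apply/eqP/rec_equivP; split=> //; exact: linked_exchange.
Qed.

Lemma foldl_erase_cat eta ls w :
  foldl erase_step (eta, ls) w =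
  let: (e, s) := foldl erase_step (eta, [::]) w in (e, ls ++ s).
Proof.
elim/last_ind: w => [|w x IH]; first by rewrite /= cats0.
rewrite -cats1 !foldl_cat IH; case: (foldl _ (eta, [::]) w) => e s /=.
by case: ifP => // _; rewrite rcons_cat.
Qed.

Lemma foldl_erase_fresh eta ls w : ~~ has (mem eta) w ->
  foldl erase_step (eta, ls) w =
  let: (e, s) := erased w in (eta ++ e, ls ++ s).
Proof.
elim/last_ind: w => [|w x IH]; first by rewrite /= !cats0.
rewrite erased_rcons has_rcons negb_or => /andP[/= xeta /IH {}IH].
rewrite -cats1 foldl_cat IH; case: (erased w) => e s /=.
rewrite mem_cat (negPf xeta) /= index_cat (negPf xeta) -addnS take_cat drop_cat.
rewrite ltnNge leq_addr /= addnC addnK.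
by case: ifP => _; rewrite rcons_cat.
Qed.

(** The erasure is self-avoiding and both starts and ends at [x], so it is reduced to [x]. *)
Lemma erased_loop x u : exists s,
  erased (x :: rcons u x) = ([:: x], s) /\ supps s \subset [set y in x :: u]%SET.
Proof.
have Us := erased_uniq (rcons (x :: u) x); have Hd := erased_head (rcons (x :: u) x).
have Hs := erased_supp (rcons (x :: u) x).
have [e He] := erased_last (x :: u) x; rewrite rcons_cons in Us Hd Hs He.
case: (erased _) He Us Hd Hs => eta s /= -> {eta} Us Hd Hs; exists s; split.
  clear Hs; by case: e Us Hd => [|y e] //= + [E]; rewrite E mem_rcons inE eqxx.
apply/fintype.subsetP => y ys; move/setP/(_ y): Hs.
by rewrite !inE (_ : y \in supps s) // orbT mem_rcons !inE orbA orbb.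
Qed.

(** The loops closed along [x :: u] have their supports inside it, away from [C] and from all
    earlier vertices. None of them is linked, so the set against which the later loops are tested is
    unchanged. *)
Lemma Phi_remove_loop C al x u be : [disjoint [set y in x :: u]%SET & C :|: [set y in al]%SET] ->
  Phi C (record_of (al ++ x :: u ++ x :: be)) = Phi C (record_of (al ++ x :: be)).
Proof.
move=> dxu; rewrite /record_of.
have -> : al ++ x :: u ++ x :: be = al ++ (x :: rcons u x) ++ be by rewrite /= cat_rcons.
rewrite -[al ++ x :: be]cat_rcons -(cats1 al) !foldl_cat -/(erased al).
have := erased_supp al; case: (erased al) => eta ls alE; rewrite /= in alE.
have dx y : y \in x :: u -> y \notin eta.
  move=> yxu; apply/negP => yeta; move/pred0P/(_ y): dxu.
  by rewrite /= alE !inE -in_cons yxu yeta orbT.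
rewrite (@foldl_erase_fresh eta ls (x :: rcons u x)); last first.
  apply/hasPn => y; rewrite -rcons_cons mem_rcons inE => /predU1P[->|]; last exact: dx.
  by apply: dx; rewrite inE eqxx.
have [s [-> sxu]] := erased_loop x u.
rewrite /= (negPf (dx x (mem_head _ _))) foldl_erase_cat [in RHS]foldl_erase_cat -cats1.
case: (foldl _ (_, [::]) be) => e ls'; rewrite !Phi_pi -catA !linked_cat.
congr (\pi_(record V)%qT (e, _)); congr (_ ++ _).
set A := _ :|: supps _; have -> : linked A s = [::].
  apply: linked_nil; rewrite disjoint_sym; apply: disjointWl sxu _.
  apply: disjointWr dxu; rewrite alE; apply: finset.setUS.
  by rewrite (fintype.subset_trans (supps_linked _ _)) ?finset.subsetUr.
by rewrite /supps big_nil finset.setU0.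
Qed.

(** No factor of [g] can be removed by [Phi_remove_loop]. *)
Definition reduced C g := forall al x u be, g = al ++ x :: u ++ x :: be ->
  ~~ [disjoint [set y in x :: u]%SET & C :|: [set y in al]%SET].

(** Any return to a vertex of [e2] would have closed a loop through it. It serves to recover, from a
    loop being discarded, an actual factor of the path. *)
Lemma erased_fresh_suffix w e1 e2 : (erased w).1 = e1 ++ e2 ->
  [disjoint [set x in e2]%SET & supps (erased w).2] ->
  exists2 al, w = al ++ e2 & ~~ has (mem al) e2.
Proof.
elim/last_ind: w e1 e2 => [|w x IH] e1 e2.
  by case: e1 => //= <- _; exists [::].
have [->|e2N] := eqVneq e2 [::]; first by exists (rcons w x); rewrite ?cats0.
case/lastP: e2 e2N => // e2 y _; rewrite erased_rcons.
have := erased_supp w; case: (erased w) IH => eta ls /= IH wE.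
case xeta : (x \in eta) => /= etaE.
  have {etaE} -> : y = x.
    move: etaE; rewrite (take_nth x) ?index_mem // nth_index // -rcons_cat.
    by move=> /rcons_inj[].
  move=> /pred0P/(_ x); rewrite /= !inE mem_rcons inE eqxx supps_rcons inE.
  by rewrite mem_lsupp_unroot /rloop_seq /= inE eqxx orbT.
move: etaE; rewrite -rcons_cat => /rcons_inj[etaE <-] d.
have [al wal alN] : exists2 al, w = al ++ e2 & ~~ has (mem al) e2.
  apply: IH etaE _; apply: disjointWl d; apply/fintype.subsetP => z.
  by rewrite !inE mem_rcons inE => ->; rewrite orbT.
exists al; first by rewrite wal rcons_cat.
rewrite has_rcons negb_or alN andbT; apply/negP => /= xal.
have : x \in [set x in w]%SET by rewrite inE wal mem_cat xal.
rewrite wE !inE xeta /= => xls; move/pred0P/(_ x): d.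
by rewrite /= !inE mem_rcons inE eqxx xls.
Qed.

(** A loop discarded when it closes avoids [C] and the earlier loops, all of which are retained. By
    [erased_fresh_suffix] it is then a factor of the path that meets nothing before it, which
    contradicts [reduced]. *)
Lemma linked_reduced C g : reduced C g -> linked C (erased g).2 = (erased g).2.
Proof.
elim/last_ind: g => // g x IH red.
have {}IH : linked C (erased g).2 = (erased g).2.
  apply: IH => al y u be E; apply: (red _ y _ (rcons be x)).
  by rewrite E rcons_cat rcons_cons rcons_cat.
have sE := erased_supp g; have fresh := @erased_fresh_suffix g.
rewrite erased_rcons; case: (erased g) IH sE fresh => eta ls /= IH sE fresh.
case xeta : (x \in eta) => //=; rewrite -cats1 linked_cat IH /=.
case: ifP => // d; set t := drop _ eta in d *.
have etaE : eta = take (index x eta) eta ++ x :: t.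
  by rewrite -[x in x :: t](nth_index x xeta) -drop_nth ?index_mem // cat_take_drop.
have sl : lsupp (unroot (x, t)) = [set y in x :: t]%SET.
  by apply/setP => y; rewrite mem_lsupp_unroot inE.
rewrite sl disjoint_sym in d.
have [al gE alN] : exists2 al, g = al ++ x :: t & ~~ has (mem al) (x :: t).
  by apply: fresh etaE _; apply: disjointWr d; exact: finset.subsetUr.
have /negP[] : ~~ [disjoint [set y in x :: t]%SET & C :|: [set y in al]%SET].
  by apply: (red al x t [::]); rewrite gE rcons_cat cats1.
rewrite disjoint_setUr; apply/andP; split; first by apply: disjointWr d; exact: finset.subsetUl.
apply/pred0P => y; rewrite /= !inE; apply/negP => /andP[yt yal].
by move/hasPn/(_ y): alN; rewrite inE yt /= yal => /(_ isT).
Qed.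

End Discarding.

(** * Unique decomposition of a path into a reduced path and inserted words *)

Section Weaving.
Context {V : finType}.
Implicit Types (w g u : seq V) (us : seq (seq V)) (x : V) (C D : {set V}).

(** The word is an excursion from [x] back to [x]; its final return is not stored, being the visit
    of [x] that follows it in [weave]. *)
Definition insertable C x u : bool :=
  if u is y :: _ then (y == x) && [disjoint [set z in u]%SET & C] else true.

Fixpoint insertables C g us : bool :=
  match g, us with
  | x :: g', u :: us' => insertable C x u && insertables (x |: C) g' us'
  | [::], [::] => true
  | _, _ => false
  end.

Fixpoint weave g us : seq V :=
  match g, us with
  | x :: g', u :: us' => u ++ x :: weave g' us'
  | _, _ => [::]
  end.

Lemma insertable_notin C x u y : insertable C x u -> y \in C -> y \notin u.
Proof.
case: u => // z u /andP[_ d] yC; apply/negP => yu.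
by move/pred0P/(_ y): d; rewrite /= !finset.inE -in_cons yu yC.
Qed.

Lemma count_weave C g us x : insertables C g us -> x \in C ->
  count_mem x (weave g us) = count_mem x g.
Proof.
elim: g C us => [|y g IH] C [|u us] //= /andP[Hu Hus] xC.
rewrite count_cat (count_memPn (insertable_notin Hu xC)) /=.
by rewrite (IH _ _ Hus) // finset.inE xC orbT.
Qed.

(** After the visit of [x] at the head of the path, the later words avoid [x], so that only the
    entries of [g] itself contribute occurrences of [x]. Counting them excludes two different
    lengths for the first word. *)
Lemma weave_inj C g us us' : insertables C g us -> insertables C g us' ->
  weave g us = weave g us' -> us = us'.
Proof.
elim: g C us us' => [|x g IH] C [|u us] [|u' us'] //= /andP[Hu Hus] /andP[Hu' Hus'] E.
suff uu' : u = u'.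
  by move: E; rewrite uu' => /(congr1 (drop (size u'))); rewrite !drop_size_cat // => -[/(IH _ _ _ Hus Hus')->].
have xC : x \in (x |: C)%SET by rewrite finset.inE finset.in_set1 eqxx.
have H v v' vs vs' : insertables (x |: C)%SET g vs -> insertables (x |: C)%SET g vs' ->
    v ++ x :: weave g vs = v' ++ x :: weave g vs' -> (size v <= size v')%N.
  move=> Hvs Hvs' /(congr1 (drop (size v'))); rewrite leqNgt (@drop_size_cat _ _ v' _ erefl).
  rewrite drop_cat; case: ltnP => // lt_v'v.
  case: (drop _ _) (size_drop (size v') v) => [/esym/eqP|y s _ /=].
    by rewrite subn_eq0 leqNgt lt_v'v.
  move=> -[_ /(congr1 (count_mem x))].
  rewrite count_cat /= eqxx (count_weave Hvs) // (count_weave Hvs') // => /eqP.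
  by rewrite addnA -[X in _ == X]add0n eqn_add2r addn1.
have : size u = size u'.
  by apply/eqP; rewrite eqn_leq (H _ _ us us') // (H _ _ us' us).
by move/eqP: E => /[swap] /eqseq_cat-> /andP[/eqP].
Qed.

Lemma setU_in_nil C : C :|: [set y in [::]]%SET = C.
Proof. by apply/setP => z; rewrite !inE orbF. Qed.

Lemma setU_in_cons C x g :
  C :|: [set y in x :: g]%SET = (x |: C)%SET :|: [set y in g]%SET.
Proof. by apply/setP => z; rewrite !inE; case: (z == x); rewrite ?orbT. Qed.

Lemma setU_in_rcons C x g :
  C :|: [set y in rcons g x]%SET = (x |: (C :|: [set y in g]))%SET.
Proof.
by apply/setP => z; rewrite !inE mem_rcons inE; case: (z == x); rewrite ?orbT.
Qed.

Lemma disjoint_weave C D g us : D \subset C -> insertables C g us ->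
  ~~ has (mem D) g -> ~~ has (mem D) (weave g us).
Proof.
move=> sDC Hus; elim: g C us sDC Hus => [|x g IH] C [|u us] //= sDC /andP[Hu Hus].
rewrite has_cat /= !negb_or => /andP[xD gD]; apply/and3P; split=> //.
  apply/hasPn => y yu; apply/negP => /= yD.
  by move/fintype.subsetP/(_ y yD): sDC => /(insertable_notin Hu)/negP; apply.
by apply: IH Hus gD; rewrite (fintype.subset_trans sDC) ?finset.subsetUr.
Qed.

Lemma insertables_cat C g1 g2 us : insertables C (g1 ++ g2) us ->
  exists us1 us2, [/\ us = us1 ++ us2, insertables C g1 us1,
    insertables (C :|: [set x in g1]%SET) g2 us2 &
    weave (g1 ++ g2) us = weave g1 us1 ++ weave g2 us2].
Proof.
elim: g1 C us => [|x g1 IH] C us /=.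
  move=> H; exists [::], us; split=> //.
  by rewrite setU_in_nil.
case: us => // u us /andP[Hu /IH[us1 [us2 [-> H1 H2 ->]]]].
exists (u :: us1), us2; split=> //=; rewrite ?Hu ?H1 //; last by rewrite -catA.
by rewrite setU_in_cons.
Qed.

Lemma reduced_cons C x g : reduced (x |: C)%SET g ->
  (forall u be, g = u ++ x :: be -> ~~ [disjoint [set y in x :: u]%SET & C]) ->
  reduced C (x :: g).
Proof.
move=> red Hx [|y al] z u be /= [].
  move=> <- /Hx; apply: contra; apply: disjointWr; exact: finset.subsetUl.
by move=> <- /red; rewrite setU_in_cons.
Qed.

(** If [w] returns to its first vertex [x] after an excursion that avoids [C], the excursion is
    moved into the first word and the rest is shorter. Otherwise [x] gets the empty word and the
    induction goes on with [x |: C]. *)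
Lemma reduced_weave C w : exists g us,
  [/\ reduced C g, insertables C g us & weave g us = w].
Proof.
have [n] := ubnP (size w); elim: n => // n IH in C w *.
case: w => [_|x w]; first by exists [::], [::]; split=> // -[].
rewrite ltnS => le_n.
have [[u [be [wE d]]]|noloop] := pselect (exists u be, w = u ++ x :: be /\ [disjoint [set y in x :: u]%SET & C]).
  have := IH C (x :: be); rewrite {IH}; move: le_n; rewrite wE /= size_cat /= => le_n.
  case; first by rewrite (leq_ltn_trans _ le_n) // leq_addl.
  move=> [|y g] [[|v us] [red Hus E]] //; move: Hus E => /= /andP[Hv Hus] E.
  have yx : y = x by case: v Hv E => [_ []//|z v /andP[/eqP-> _] []].
  subst y; exists (x :: g), ((x :: u ++ v) :: us); split=> //=.
    rewrite Hus eqxx !andbT /=; move: d; rewrite -!setI_eq0 => /eqP d; apply/eqP.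
    apply/setP => z; move/setP/(_ z): d; rewrite !inE mem_cat.
    case zC : (z \in C); rewrite ?andbF // !andbT => /negbT; rewrite negb_or => /andP[/negPf-> /negPf->] /=.
    by apply: contraTF zC => /(contraL (insertable_notin Hv)).
  by rewrite -catA E.
have [g [us [red Hus E]]] := IH (x |: C)%SET w le_n.
exists (x :: g), ([::] :: us); split=> /=; [|by []|by rewrite E].
apply: reduced_cons red _ => u be gE; apply/negP => d; apply: noloop.
move: Hus E; rewrite gE => /insertables_cat[us1 [[|v us2] [-> H1 /= H2 ->]]] //.
case/andP: H2 => Hv H2 E; exists (weave u us1 ++ v), (weave be us2).
split; first by rewrite -E catA.
(* A nonempty [v] would start at [x], which it must avoid. Hence a removable factor at the head of
   [x :: g] comes from one of [x :: w], excluded by [noloop]. *)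
have {}Hv : v = [::].
  case: v Hv {E} => // z v /andP[/eqP-> /pred0P/(_ x)].
  by rewrite /= !inE eqxx.
subst v; rewrite cats0; apply/pred0P => z; rewrite /= !inE; apply/negP => /andP[+ zC].
have zxu : z \notin x :: u.
  by apply/negP => zxu; move/pred0P/(_ z): d; rewrite /= finset.inE zxu zC.
move: zxu; rewrite inE negb_or => /andP[/negPf-> zu] /= zw.
have := @disjoint_weave _ [set z]%SET _ _ _ H1.
rewrite finset.sub1set !inE zC orbT => /(_ isT).
have -> : ~~ has (mem [set z]%SET) u.
  by apply/hasPn => y yu; rewrite /= inE; apply: contraNneq zu => <-.
by move=> /(_ isT)/hasPn/(_ z zw); rewrite /= inE eqxx.
Qed.

(** The words are removed from left to right: a word avoids the earlier vertices of [g], but it may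
    meet words inserted earlier, which must be gone before [Phi_remove_loop] applies. *)
Lemma Phi_weave C g us : insertables C g us ->
  Phi C (record_of (weave g us)) = Phi C (record_of g).
Proof.
have H (al : seq V) : insertables (C :|: [set x in al]%SET) g us ->
    Phi C (record_of (al ++ weave g us)) = Phi C (record_of (al ++ g)).
  elim: g us al => [|x g IH] [|u us] al //= /andP[Hu Hus].
  rewrite -[in RHS]cat_rcons -(IH us); last by rewrite setU_in_rcons.
  rewrite cat_rcons; case: u Hu => // y u /andP[/eqP->] d.
  by rewrite Phi_remove_loop.
by move=> Hus; apply: (H [::]); rewrite setU_in_nil.
Qed.

Lemma Phi_reduced C g : reduced C g -> Phi C (record_of g) = record_of g.
Proof.
move/linked_reduced; rewrite /record_of -/(erased g).
by case: (erased g) => eta ls /= E; rewrite Phi_pi E.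
Qed.

(** Any [w] is woven from some reduced [g'], and its image under [Phi C] is the record of [g'];
    injectivity of [record_of] then identifies [g'] with [g]. *)
Lemma Phi_record_weave C g w : reduced C g ->
  (Phi C (record_of w) = record_of g <->
   exists2 us, insertables C g us & weave g us = w).
Proof.
move=> red; split=> [E|[us Hus <-]]; last by rewrite Phi_weave // Phi_reduced.
have [g' [us [red' Hus wE]]] := reduced_weave C w.
suff <- : g' = g by exists us.
by apply: record_of_inj; rewrite -E -wE Phi_weave // Phi_reduced.
Qed.

Fixpoint insertabless C (gs : seq (seq V)) (uss : seq (seq (seq V))) : bool :=
  match gs, uss with
  | g :: gs', us :: uss' => insertables C g us && insertabless (C :|: [set x in g]%SET) gs' uss'
  | [::], [::] => true
  | _, _ => false
  end.

Definition weaves (gs : seq (seq V)) (uss : seq (seq (seq V))) :=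
  [seq weave p.1 p.2 | p <- zip gs uss].

(** The witness [ws0] ensures that the entries of [p] are records of reduced paths, which [path_of]
    gives back. *)
Lemma entangle_weave C ws0 ws :
  let p := entangle C [seq record_of w | w <- ws0] in
  let gs := [seq path_of q | q <- p] in
  entangle C [seq record_of w | w <- ws] = p <->
  exists2 uss, insertabless C gs uss & weaves gs uss = ws.
Proof.
elim: ws0 C ws => [|w0 ws0 IH] C ws /=.
  by case: ws => [|w ws]; split=> //; [exists [::]|case=> -[]].
have [g [us0 [red Hus0 w0E]]] := reduced_weave C w0.
rewrite -w0E Phi_weave // Phi_reduced // path_of_record rsupp_record_of.
case: ws => [|w ws] /=; first by split=> // -[[|us uss] //].
split.
  case=> E; rewrite E rsupp_record_of => /IH[uss Huss <-].
  have [us Hus <-] := (Phi_record_weave w red).1 E.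
  by exists (us :: uss) => //=; rewrite Hus.
case=> -[|us uss] //= /andP[Hus Huss] [wE wsE].
have E : Phi C (record_of w) = record_of g by apply/(Phi_record_weave w red); exists us.
by rewrite E rsupp_record_of; congr (_ :: _); apply/IH; exists uss.
Qed.

Lemma weaves_inj C gs uss uss' : insertabless C gs uss -> insertabless C gs uss' ->
  weaves gs uss = weaves gs uss' -> uss = uss'.
Proof.
elim: gs C uss uss' => [|g gs IH] C [|us uss] [|us' uss'] //=.
move=> /andP[Hus Huss] /andP[Hus' Huss'] [/(weave_inj Hus Hus')-> E].
by rewrite (IH _ _ _ Huss Huss' E).
Qed.

End Weaving.

(** * Counting lemmas for the insertion at one site *)

Section Copies.
Context {V : finType}.
Implicit Types (c : seq (uloop V)).

(** A finite configuration of loops is a list [c] in which only the multiplicities matter; its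
    copies are labelled as in [inserted]. *)
Definition config_fset c : {fset uloop V * nat} :=
  [fset lc in [seq (l, k) | l <- undup c, k <- iota 0 (count_mem l c)]]%fset.

(** Enumerated by [enum_fset] as in [inserted], so that both lists are equal and not merely
    permutations of each other. *)
Definition copies c : seq (uloop V * nat) := enum_fset (config_fset c).

Lemma mem_config_fset c lc : (lc \in config_fset c) = (lc.2 < count_mem lc.1 c)%N.
Proof.
rewrite inE; apply/allpairsPdep/idP => [[l [k [_ + ->]]]|].
  by rewrite mem_iota add0n.
case: lc => l k /= kl; exists l, k; rewrite mem_undup mem_iota add0n; split=> //.
by rewrite -has_pred1 has_count (leq_ltn_trans _ kl).
Qed.

Lemma mem_copies c lc : (lc \in copies c) = (lc.2 < count_mem lc.1 c)%N.
Proof. exact: mem_config_fset. Qed.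

Lemma copies_uniq c : uniq (copies c).
Proof. exact: fset_uniq. Qed.

Lemma copies_mem c lc : lc \in copies c -> lc.1 \in c.
Proof. by rewrite mem_copies -has_pred1 has_count; apply: leq_ltn_trans. Qed.

Lemma perm_copies c : perm_eq [seq lc.1 | lc <- copies c] c.
Proof.
apply: perm_trans (perm_count_undup c).
have -> : flatten [seq nseq (count_mem l c) l | l <- undup c] =
    [seq lc.1 | lc <- [seq (l, k) | l <- undup c, k <- iota 0 (count_mem l c)]].
  rewrite map_flatten -map_comp; congr flatten; apply: eq_map => l /=.
  rewrite -map_comp /=; have : size (iota 0 (count_mem l c)) = count_mem l c by rewrite size_iota.
  by move: (iota 0 _) => s <-; elim: s => //= k s ->.
apply: perm_map; apply: uniq_perm; first exact: copies_uniq.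
  apply: allpairs_uniq_dep => [|l _|]; rewrite ?undup_uniq ?iota_uniq //.
  by move=> [l k] [l' k'] _ _ /= [-> ->].
by move=> lc; rewrite /copies inE.
Qed.

Lemma size_copies c : size (copies c) = size c.
Proof. by rewrite -(size_map fst) (perm_size (perm_copies c)). Qed.

End Copies.

Section FactorLists.
Context {V : choiceType}.
Implicit Types (u v : seq V) (s : seq (seq V)).

Fixpoint factorizations m u : seq (seq (seq V)) :=
  if m is m'.+1 then
    [seq take i u :: s | i <- iota 1 (size u), s <- factorizations m' (drop i u)]
  else if u == [::] then [:: [::]] else [::].

Lemma mem_factorizations m u s : (s \in factorizations m u) =
  [&& size s == m, [::] \notin s & flatten s == u].
Proof.
elim: m u s => [|m IH] u s /=.
  by case: s => [|v s]; case: eqP => [->|/eqP uN] //=; rewrite inE // eq_sym (negPf uN).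
apply/allpairsPdep/idP => [[i [s' [+ + ->]]]|].
  rewrite mem_iota IH => /andP[i0 iu] /and3P[/eqP sm sN /eqP sE].
  rewrite /= sm eqxx inE negb_or sN sE cat_take_drop eqxx !andbT /=.
  rewrite eq_sym -size_eq0 size_take; case: ifP => _; first by rewrite -lt0n.
  by rewrite -lt0n (leq_trans i0) // -ltnS.
case: s => // v s; rewrite inE negb_or eqSS => /and3P[sm /andP[vN sN] /eqP uE].
exists (size v), s; rewrite mem_iota IH -uE /= take_size_cat // drop_size_cat // sm sN eqxx size_cat.
by split=> //; rewrite lt0n size_eq0 eq_sym vN /= add1n ltnS leq_addr.
Qed.

Lemma factorizations_uniq m u : uniq (factorizations m u).
Proof.
elim: m u => [|m IH] u /=; first by case: ifP.
apply: allpairs_uniq_dep => [|i _|]; rewrite ?iota_uniq //.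
move=> _ _ /allpairsPdep[i [s [+ _ ->]]] /allpairsPdep[i' [s' [+ _ ->]]] /=.
rewrite !mem_iota !add1n !ltnS => /andP[_ iu] /andP[_ iu'] [/(congr1 size) + ->].
by rewrite !size_takel // => ->.
Qed.

End FactorLists.

Local Open Scope ring_scope.

(** * Permutations that match two lists *)

Section Matchings.
Context {X : eqType}.
Implicit Types (s : seq X) (a : X).

(** The product of the factorials of the multiplicities ([multiplicities_undup]), in the form
    produced by matching the entries one after the other. *)
Fixpoint multiplicities s : nat :=
  if s is a :: s' then ((count_mem a s').+1 * multiplicities s')%N else 1%N.

Lemma multiplicities_undup s :
  multiplicities s = (\prod_(a <- undup s) (count_mem a s)`!)%N.
Proof.
elim: s => [|a s IH] /=; first by rewrite big_nil.
rewrite IH; case: ifPn => [as_|as_]; last first.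
  rewrite big_cons eqxx (count_memPn as_) mul1n /= mul1n.
  apply: eq_big_seq => b; rewrite mem_undup => bs.
  by case: eqP as_ => [->|]; rewrite ?bs.
have as' : a \in undup s by rewrite mem_undup.
rewrite !(bigD1_seq a) ?undup_uniq //= eqxx add1n factS -mulnA; congr (_ * (_ * _))%N.
by apply: eq_bigr => b; rewrite eq_sym => /negPf->.
Qed.

Lemma multiplicities_perm s s' : perm_eq s s' -> multiplicities s = multiplicities s'.
Proof.
move=> ss'; rewrite !multiplicities_undup (perm_big _ (perm_undup (perm_mem ss'))) /=.
by apply: eq_bigr => a _; rewrite (seq.permP ss').
Qed.

Lemma lift_perm_onto n (i0 j0 : 'I_n.+1) (s : 'S_n.+1) : s i0 = j0 ->
  exists t : 'S_n, s = lift_perm i0 j0 t.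
Proof.
move=> si0; pose g k := odflt k (unlift j0 (s (lift i0 k))).
have gE k : lift j0 (g k) = s (lift i0 k).
  rewrite /g; case: unliftP => [k' ->|] //=; rewrite -si0 => /perm_inj/eqP.
  by rewrite eq_sym (negPf (neq_lift _ _)).
have g_inj : injective g.
  by move=> k k' /(congr1 (lift j0)); rewrite !gE => /perm_inj/lift_inj.
exists (perm g_inj); apply/permP => k; case: (unliftP i0 k) => [k'|] ->.
  by rewrite lift_perm_lift permE gE.
by rewrite lift_perm_id.
Qed.

Lemma lift_perm_inj n (i0 j0 : 'I_n.+1) : injective (@lift_perm n i0 j0).
Proof.
move=> s t st; apply/permP => k; apply: (@lift_inj _ j0).
by rewrite -!(lift_perm_lift i0) st.
Qed.

Lemma map_lift_perm n (f : 'I_n.+1 -> X) (i : 'I_n.+1) :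
  perm_eq [seq f j | j <- enum 'I_n.+1] (f i :: [seq f (lift i j) | j <- enum 'I_n]).
Proof.
rewrite (map_comp f (lift i)) -[f i :: _]/(map f (i :: _)); apply: perm_map.
apply: uniq_perm; rewrite ?enum_uniq //=.
  rewrite map_inj_uniq ?enum_uniq ?andbT; last exact: lift_inj.
  by apply/mapP => -[j _ /eqP]; rewrite (negPf (neq_lift _ _)).
move=> j; rewrite mem_enum [RHS]inE; case: (unliftP i j) => [k ->|->]; last by rewrite eqxx.
by rewrite map_f ?orbT // mem_enum.
Qed.

(** The image of [ord0] can be any index at which [e] takes the value [f ord0]. Each choice leaves a
    matching problem of size [n], and the number of choices is the leading factor of
    [multiplicities]. *)
Lemma card_matchings n (e f : 'I_n -> X) :
  #|[set s : 'S_n | [forall j, e (s j) == f j]]| =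
  if perm_eq [seq e j | j <- enum 'I_n] [seq f j | j <- enum 'I_n]
  then multiplicities [seq f j | j <- enum 'I_n] else 0%N.
Proof.
elim: n => [|n IH] in e f *.
  have E (h : 'I_0 -> X) : [seq h j | j <- enum 'I_0] = [::].
    by apply/nilP; rewrite /nilp size_map size_enum_ord.
  rewrite !E /= (_ : [set _ | _] = [set: 'S_0])%SET ?cardsT ?card_Sn //.
  by apply/setP => s; rewrite !inE; apply/forallP => -[].
rewrite (permPr (map_lift_perm f ord0)) (multiplicities_perm (map_lift_perm f ord0)).
set s' := [seq f (lift ord0 j) | j <- _].
have -> : #|[set s : 'S_n.+1 | [forall j, e (s j) == f j]]|%SET =
    (\sum_(i | e i == f ord0)
      #|[set s : 'S_n | [forall j, e (lift i (s j)) == f (lift ord0 j)]]|)%N.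
  rewrite -sum1_card (partition_big (fun s : 'S_n.+1 => s ord0) (fun i => e i == f ord0)) /=; last first.
    by move=> s; rewrite inE => /forallP.
  apply: eq_bigr => i ei; rewrite -sum1_card.
  rewrite (reindex_omap (lift_perm ord0 i) (fun s : 'S_n.+1 => [pick t | s == lift_perm ord0 i t])) /=; last first.
    move=> s /andP[_ /eqP si]; case: pickP => [t /eqP->//|].
    by have [t ->] := lift_perm_onto si => /(_ t); rewrite eqxx.
  apply: eq_bigl => s; rewrite !inE lift_perm_id eqxx andbT.
  case: pickP => [t /eqP/lift_perm_inj->|/(_ s)]; rewrite eqxx // andbT.
  apply/forallP/forallP => H j; first by have := H (lift ord0 j); rewrite lift_perm_lift.
  by case: (unliftP ord0 j) => [k|] ->; rewrite ?lift_perm_lift ?lift_perm_id.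
have perm_lift i : e i = f ord0 ->
    perm_eq [seq e (lift i j) | j <- enum 'I_n] s' =
    perm_eq [seq e j | j <- enum 'I_n.+1] (f ord0 :: s').
  by move=> ei; rewrite (permPl (map_lift_perm e i)) ei perm_cons.
transitivity (\sum_(i | e i == f ord0)
  if perm_eq [seq e j | j <- enum 'I_n.+1] (f ord0 :: s') then multiplicities s' else 0)%N.
  apply: eq_bigr => i /eqP ei; rewrite -(perm_lift i ei).
  exact: (IH (fun j => e (lift i j)) (fun j => f (lift ord0 j))).
case: ifP => [pe|_]; last by rewrite big1.
rewrite sum_nat_const /=; congr (_ * _)%N.
have /seq.permP/(_ (pred1 (f ord0))) := pe; rewrite /= eqxx add1n => <-.
by rewrite count_map -sum1_count big_enum_cond /= sum1_card.
Qed.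

End Matchings.

(** * Sums over compositions and over factorisations of a word *)

Section Compositions.
Context {R : realType}.

(* The sum of [1 / (k_1 * ... * k_m)] over the compositions
   [n = k_1 + ... + k_m] into [m] positive parts. *)
Fixpoint comp_sum (m n : nat) : R :=
  if m is m'.+1 then \sum_(k < n) k.+1%:R^-1 * comp_sum m' (n - k.+1)%N
  else (n == 0%N)%:R.

(* Differentiating the powers of the polynomial truncation of [- ln (1 - X)]. *)
Lemma comp_sum_rec m n :
  n.+1%:R * comp_sum m.+1 n.+1 = m.+1%:R * \sum_(k < n.+1) comp_sum m k.
Proof.
(* The constant coefficient is [0%:R^-1 = 0], and the truncation leaves the coefficients of degree
   at most [n.+1] of the powers unchanged. *)
pose L : {poly R} := \poly_(i < n.+2) (i%:R^-1).
have LE p k : (k < n.+2)%N -> comp_sum p k = (L ^+ p)`_k.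
  elim: p k => [|p IH] k kn; first by rewrite expr0 coef1.
  rewrite exprS coefM big_ord_recl coef_poly /= invr0 mul0r add0r.
  apply: eq_bigr => i _; rewrite /= coef_poly /bump /= add1n.
  rewrite (leq_ltn_trans (ltn_ord i)) // IH // (leq_ltn_trans _ kn) // leq_subr.
by [].
have := congr1 (fun p : {poly R} => p`_n) (deriv_exp L m.+1).
rewrite coef_deriv -LE // mulr_natl => ->; rewrite coefMn coefM -[LHS]mulr_natl; congr (_ * _).
rewrite [RHS](reindex_inj rev_ord_inj); apply: eq_bigr => i _ /=.
rewrite coef_deriv coef_poly ltnS ltn_ord /= -[_^-1 *+ _]mulr_natl mulfV ?pnatr_eq0 // mul1r subSS LE //.
by rewrite ltnS (leq_trans (leq_subr _ _)).
Qed.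

(** In generating functions, exp(- ln (1 - X)) = 1 / (1 - X) has all coefficients 1. The terms with
    [m > n] vanish, and a free bound [M] lets the induction hypothesis be applied to smaller [n]
    under the bound at hand. *)
Lemma sum_comp_sum M n : (n < M)%N ->
  \sum_(m < M) comp_sum m n / m`!%:R = 1.
Proof.
elim/ltn_ind: n M => -[|n] IH [|M] //; rewrite ltnS big_ord_recl /= => nM.
  by rewrite divr1 big1 ?addr0 // => m _; rewrite big_ord0 mul0r.
rewrite mul0r add0r.
have n0 : n.+1%:R != 0 :> R by rewrite pnatr_eq0.
apply: (mulfI n0); rewrite mulr1 mulr_sumr.
transitivity (\sum_(m < M) \sum_(k < n.+1) comp_sum m k / m`!%:R).
  apply: eq_bigr => m _; rewrite mulrA comp_sum_rec factS natrM invfM !mulrA.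
  by rewrite [_ * m.+1%:R^-1]mulrC mulKf ?pnatr_eq0 // mulr_suml.
rewrite exchange_big /= (eq_bigr (fun=> 1)) => [|k _]; first by rewrite sumr_const card_ord.
by rewrite IH // (leq_trans (ltn_ord k)).
Qed.

End Compositions.

Section LoopFactorizations.
Context {R : realType} {V : eqType}.
Implicit Types (u v : seq V) (x : V).

Fixpoint factor_sum (h : seq V -> R) m u : R :=
  if m is m'.+1 then
    \sum_(i <- iota 1 (size u)) h (take i u) * factor_sum h m' (drop i u)
  else (u == [::])%:R.

Definition based x (G : pred V) u : bool := (u == [::]) || (ohead u == Some x) && all G u.

(** As [i] runs through the occurrences of [x], the number of earlier occurrences takes each value
    below [count_mem x u] once. *)
Lemma sum_splits x u (f : nat -> R) :
  \sum_(i < size u | nth x u i == x) f (count_mem x (take i u)) =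
  \sum_(k < count_mem x u) f k.
Proof.
elim/last_ind: u => [|u y IH]; first by rewrite !big_ord0.
rewrite size_rcons -cats1 count_cat /= addn0.
rewrite [LHS]big_mkcond big_ord_recr /= nth_cat ltnn subnn /= take_size_cat //.
have -> : \sum_(i < size u) (if nth x (u ++ [:: y]) i == x
    then f (count_mem x (take i (u ++ [:: y]))) else 0) =
  \sum_(k < count_mem x u) f k.
  rewrite -IH [RHS]big_mkcond; apply: eq_bigr => i _.
  by rewrite nth_cat ltn_ord takel_cat // ltnW.
by case: eqP => _; rewrite ?addn1 ?addn0 ?big_ord_recr ?addr0.
Qed.

Variables (x : V) (G : pred V) (w : seq V -> R).
Hypothesis w_nil : w [::] = 1.
Hypothesis w_cat : forall u v, based x G u -> based x G v -> w (u ++ v) = w u * w v.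

Definition loop_density v : R :=
  if (v != [::]) && based x G v then w v / (count_mem x v)%:R else 0.

Lemma factor_sum_based m u : ~~ based x G u -> factor_sum loop_density m u = 0.
Proof.
elim: m u => [|m IH] u bu /=.
  by case: u bu => // ? ?; rewrite /based eqxx.
rewrite big1_seq // => i; rewrite mem_iota /= => /andP[i0 _].
have [bd|/IH->] := boolP (based x G (drop i u)); last by rewrite mulr0.
rewrite /loop_density; case: ifP => [/andP[_ bt]|]; last by rewrite mul0r.
case/negP: bu; move: bd bt; rewrite /based.
case: u => // y u; case: i i0 => // i _ /=.
move=> bd /andP[-> /andP[-> tG]] /=; rewrite -(cat_take_drop i u) all_cat tG /=.
by case/orP: bd => [/eqP->|/andP[]].
Qed.

(** A nonzero term cuts [u] at visits to [x] only. The weight is multiplicative, so a factorisation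
    matters only through the numbers of visits in its factors, and these form a composition of
    [count_mem x u]. *)
Lemma factor_sumE m u : based x G u ->
  factor_sum loop_density m u = w u * comp_sum m (count_mem x u).
Proof.
elim: m u => [|m IH] u bu.
  case: u bu => [|y u] bu /=; first by rewrite w_nil mul1r.
  move: bu; rewrite /based /= => /andP[/eqP[->] _]; rewrite eqxx /=.
  by rewrite mulr0.
have [->|uN] := eqVneq u [::]; first by rewrite /= big_nil big_ord0 mulr0.
have [u' uE] : exists u', u = x :: u'.
  by move: bu uN; rewrite /based; case: u => // y u /= /andP[/eqP[->]]; exists u.
have Gu : all G u by move: bu uN; rewrite /based; case: eqP => //= _ /andP[].
pose K := count_mem x u; pose f k := w u * (k%:R^-1 * comp_sum m (K - k)%N).
have termE i : (0 < i <= size u)%N ->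
    loop_density (take i u) * factor_sum loop_density m (drop i u) =
    if (i == size u) || (nth x u i == x) then f (count_mem x (take i u)) else 0.
  move=> /andP[i0 iu]; have bt : based x G (take i u).
    rewrite /based.
    have -> : all G (take i u) = true.
      by move: Gu; rewrite -{1}(cat_take_drop i u) all_cat => /andP[].
    by rewrite andbT uE; case: (i) i0 => // j _; rewrite /= eqxx.
  have tN : take i u != [::] by rewrite -size_eq0 size_takel // -lt0n.
  have bdE : based x G (drop i u) = (i == size u) || (nth x u i == x).
    rewrite /based -size_eq0 size_drop subn_eq0 [i == _]eqn_leq iu /=.
    case: leqP => //= lt_iu; rewrite (drop_nth x) //=.
    rewrite (_ : G _ && all G _ = true) ?andbT //.
    by move: Gu; rewrite -{1}(cat_take_drop i u) all_cat (drop_nth x) // => /andP[_ /= ->].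
  case: ifPn; rewrite -bdE => bd; last by rewrite (factor_sum_based _ bd) mulr0.
  have wE : w u = w (take i u) * w (drop i u) by rewrite -w_cat // cat_take_drop.
  rewrite IH // /loop_density tN bt /= /f wE.
  have -> : count_mem x (drop i u) = (K - count_mem x (take i u))%N.
    by rewrite /K -{2}(cat_take_drop i u) count_cat addKn.
  by rewrite mulrACA mulrA.
have [n nE] : exists n, size u = n.+1 by exists (size u'); rewrite uE.
transitivity (\sum_(i < n.+1) if (i.+1 == n.+1) || (nth x u i.+1 == x)
    then f (count_mem x (take i.+1 u)) else 0).
  rewrite /= nE -[iota 1 n.+1]/(iota (1 + 0) n.+1) iotaDl big_map -/(index_iota 0 n.+1) big_mkord.
  by apply: eq_bigr => i _; rewrite add1n termE nE //= ltnS; case: i.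
rewrite big_ord_recr /= eqxx -nE take_size -/K.
(* [sum_splits] counts the empty prefix and not the whole word, while the sum at hand counts the
   whole word and not the empty prefix; hence the index shift. *)
have := sum_splits x u f; rewrite big_mkcond -/K nE big_ord_recl /= {1}uE /= eqxx take0 /=.
rewrite /bump /= => E; rewrite mulr_sumr.
have [k kE] : exists k, K = k.+1 by exists (count_mem x u'); rewrite /K uE /= eqxx add1n.
rewrite kE big_ord_recl /= in E; move/addrI: E => E.
transitivity (\sum_(i < K) f i.+1); last by apply: eq_bigr.
have SE (F : nat -> R) : \sum_(i < K) F i = \sum_(i < k) F i + F k.
  by rewrite kE big_ord_recr.
rewrite (SE (fun i => f i.+1)) -kE; congr (_ + _).
by under eq_bigr => i _ do rewrite eqSS ltn_eqF //=; rewrite E.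
Qed.

Lemma sum_factorizations u :
  \sum_(m < (size u).+1) factor_sum loop_density m u / m`!%:R =
  if based x G u then w u else 0.
Proof.
case: ifPn => bu; last by rewrite big1 // => m _; rewrite factor_sum_based // mul0r.
transitivity (w u * \sum_(m < (size u).+1) comp_sum m (count_mem x u) / m`!%:R).
  by rewrite mulr_sumr; apply: eq_bigr => m _; rewrite factor_sumE // mulrA.
by rewrite sum_comp_sum ?mulr1 // ltnS count_size.
Qed.

End LoopFactorizations.

Lemma factor_sum_factorizations (R : realType) (V : choiceType) (h : seq V -> R) m u :
  factor_sum h m u = \sum_(s <- factorizations m u) \prod_(v <- s) h v.
Proof.
elim: m u => [|m IH] u /=.
  by case: ifP => _; rewrite ?big_nil // big_seq1 big_nil.
rewrite big_allpairs_dep /=; apply: eq_bigr => i _; rewrite IH mulr_sumr.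
by apply: eq_bigr => s _; rewrite big_cons.
Qed.

(** * Cyclic shifts and the measure of one unrooted loop *)

Section Rotations.
Context {X : eqType}.
Implicit Types s : seq X.

Definition rotations s : seq (seq X) := [seq rot i s | i <- iota 0 (size s)].

Lemma rotations_rot1 s : rotations (rot 1 s) = rot 1 (rotations s).
Proof.
case: s => // x s; set t := x :: s; rewrite /rotations size_rot.
transitivity (rcons [seq rot i t | i <- iota 1 (size s)] t); last by rewrite /= rot0 rot1_cons.
rewrite -[size t]/(1 + size s)%N addnC iotaD map_cat cats1 add0n /=; congr rcons.
  rewrite -[1%N in RHS]addn0 iotaDl -map_comp; apply/eq_in_map => i; rewrite mem_iota => /andP[_ /= is_].
  by rewrite /= addnC rotD // addn1 leqW.
by rewrite -rotD ?addn1 // -[X in rot X t]/(size t) rot_size.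
Qed.

Lemma perm_rotations j s : perm_eq (rotations (rot j s)) (rotations s).
Proof.
elim: j => [|j IH]; first by rewrite rot0.
have [js|sj] := ltnP j (size s); last by rewrite rot_oversize // ltnW.
by rewrite rotS // rotations_rot1 perm_rot.
Qed.

(** Rotating [s] permutes its list of rotations, so all rotations are equally frequent in it. *)
Lemma count_rotations s v : v \in rotations s ->
  count_mem v (rotations s) = count_mem s (rotations s).
Proof.
case/mapP => j _ ->.
rewrite -(seq.permP (perm_rotations j s)) /rotations size_rot.
under eq_map do rewrite rot_rot.
by rewrite map_comp count_map; apply: eq_count => t /=; rewrite (inj_eq rot_inj).
Qed.

Lemma sum_count_undup (s : seq X) : (\sum_(x <- undup s) count_mem x s)%N = size s.
Proof.
rewrite -sum1_size.
transitivity (\sum_(x <- undup s) iterop (count_mem x s) addn 1 0)%N;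
  last by rewrite big_undup_iterop_count.
by apply: eq_bigr => x _; elim: (count_mem x s) => // -[|n] //= <-; rewrite add1n.
Qed.

End Rotations.

Section SizeRotations.
Context {X : eqType}.
Implicit Types s : seq X.

(** The orbit-stabiliser relation for cyclic shifts. *)
Lemma size_rotations s v : v \in rotations s ->
  (size (undup (rotations s)) * count_mem v (rotations s))%N = size s.
Proof.
move=> vs; rewrite (count_rotations vs) -[RHS](size_iota 0) -[RHS](size_map (rot^~ s)).
rewrite -/(rotations s) -[RHS]sum_count_undup -sum1_size big_distrl /=.
apply: eq_big_seq => t; rewrite mem_undup => /count_rotations->.
by rewrite mul1n.
Qed.

End SizeRotations.

Section LoopMeasure.
Context {R : realType} {V : finType}.
Variables (Q : V -> V -> R) (D : {set V}).
Hypothesis Q_sub : substochastic Q.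
Implicit Types (l : uloop V) (x : V) (u v : seq V).

Lemma chain_weight_ge0 x s : 0 <= chain_weight Q x s.
Proof. by elim: s x => //= y s IH x; rewrite mulr_ge0 // Q_sub.1. Qed.

Lemma path_weight_ge0 w : 0 <= path_weight Q w.
Proof. by case: w => // x s; exact: chain_weight_ge0. Qed.

Lemma chain_weight_cat x s t :
  chain_weight Q x (s ++ t) = chain_weight Q x s * chain_weight Q (last x s) t.
Proof. by elim: s x => [|y s IH] x /=; rewrite ?mul1r // IH mulrA. Qed.

Lemma path_weight_cat u x v :
  path_weight Q (u ++ x :: v) = path_weight Q (rcons u x) * path_weight Q (x :: v).
Proof.
case: u => [|y u] /=; first by rewrite mul1r.
by rewrite -cat_rcons chain_weight_cat last_rcons.
Qed.

Definition loop_at x v : uloop V := unroot (head x v, behead v).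

Lemma loop_at_rot l x i : loop_at x (rot i (useq l)) = l.
Proof.
have [y [s E]] : exists y s, rot i (useq l) = y :: s.
  case: (rot i _) (size_rot i (useq l)) => [|y s] // _; by exists y, s.
rewrite /loop_at E /= -[RHS]reprK; apply/eqP; rewrite eqmodE /= Defs.cyc_equiv_sym.
by apply/asboolP; exists i.
Qed.

Lemma useq_loop_at x v : v != [::] -> exists i, v = rot i (useq (loop_at x v)).
Proof.
case: v => // y s _; have [i E] := useq_unroot (y, s).
by exists (size (y :: s) - i)%N; rewrite E -(size_rot i) -/(rotr i _) rotK.
Qed.

Lemma perm_useq_loop_at x v : v != [::] -> perm_eq v (useq (loop_at x v)).
Proof. by move=> /(useq_loop_at x)[i {1}->]; rewrite perm_rot. Qed.

Definition cyclic_weight v : R := if v is x :: _ then path_weight Q (rcons v x) else 0.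

Lemma cyclic_weight_rot i v : cyclic_weight (rot i v) = cyclic_weight v.
Proof.
elim: i => [|i IH]; first by rewrite rot0.
have [iv|vi] := ltnP i (size v); last by rewrite rot_oversize // ltnW.
rewrite rotS // -[RHS]IH; case: (rot i v) => // x [|y s] //.
by rewrite rot1_cons /= -cats1 chain_weight_cat last_rcons /= mulr1 mulrC.
Qed.

Local Open Scope ereal_scope.

(** The rooted loops above an unrooted one are its distinct rotations, all of the same weight and
    length. *)
Lemma loop_measure_at x v : v != [::] -> all (mem D) v ->
  loop_measure Q D [set loop_at x v]%classic =
  ((size (undup (rotations v)))%:R * (cyclic_weight v / (size v)%:R))%:E.
Proof.
move=> vN vD; pose root (t : seq V) : rloop V := (head x t, behead t).
have rootE t : t \in undup (rotations v) -> rloop_seq (root t) = t.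
  rewrite mem_undup => /mapP[i _ tE]; case: t tE => // /(congr1 size).
  by rewrite size_rot => /eqP; rewrite eq_sym size_eq0 (negPf vN).
set s := [seq root t | t <- undup (rotations v)].
have s_uniq : uniq s.
  rewrite map_inj_in_uniq ?undup_uniq // => t t' /rootE tE /rootE t'E tt'.
  by rewrite -tE -t'E tt'.
rewrite /loop_measure (_ : [set _ | _] = [set` s])%classic; last first.
  apply/seteqP; split => l /=.
    move=> [_ /eqP]; rewrite /loop_at eqmodE /= Defs.cyc_equiv_sym => /asboolP[i E].
    apply/mapP; exists (rloop_seq l); last by rewrite /root; case: l E.
    rewrite mem_undup -E; have vE : head x v :: behead v = v by case: (v) vN.
    rewrite /rloop_seq /= vE; have [iv|vi] := ltnP i (size v).
      by apply: map_f; rewrite mem_iota.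
    rewrite rot_oversize //; apply/mapP; exists 0%N; rewrite ?rot0 // mem_iota /=.
    by rewrite lt0n size_eq0.
  case/mapP => t ts ->.
  suff: all (mem D) t /\ loop_at x t = loop_at x v by rewrite -{1}(rootE t ts).
  move: ts; rewrite mem_undup => /mapP[i _ ->]; split.
    by apply/allP => y; rewrite mem_rot => /(allP vD).
  by have [j ->] := useq_loop_at x vN; rewrite rot_rot_add !loop_at_rot.
rewrite esum_fset; [|exact: finite_seq|by move=> l _; rewrite lee_fin divr_ge0 // path_weight_ge0].
rewrite -fsbig_seq // big_map (eq_big_seq (fun=> (cyclic_weight v / (size v)%:R)%:E)).
  by rewrite sumEFin big_const_seq count_predT iter_addr_0 mulr_natl.
move=> t ts; rewrite -[rloop_weight Q _]/(cyclic_weight (rloop_seq (root t))) rootE //.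
by move: ts; rewrite mem_undup => /mapP[i _ ->]; rewrite cyclic_weight_rot size_rot.
Qed.

Lemma loop_measure_notin x v : v != [::] -> ~~ all (mem D) v ->
  loop_measure Q D [set loop_at x v]%classic = 0.
Proof.
move=> vN vD; rewrite /loop_measure (_ : [set _ | _] = set0)%classic ?esum_set0 //.
rewrite -subset0 => l [lD lE]; case/negP: vD.
have [i ->] := useq_loop_at x vN; rewrite -lE.
by apply/allP => y; rewrite mem_rot mem_useq_unroot => /(allP lD).
Qed.

Lemma size_visits l x : size (visits l x) = count_mem x (useq l).
Proof.
rewrite /visits size_filter -[in RHS](mkseq_nth x (useq l)) count_map.
by apply: eq_count => i.
Qed.

(** A periodic loop has fewer distinct rootings, but each arises from correspondingly more visits.
    By [size_rotations] the two numbers multiply to the length, which cancels the [1 / n] of the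
    loop measure and leaves the number of visits to the root. *)
Lemma loop_measure_visit x v : v != [::] -> ohead v = Some x ->
  let l := loop_at x v in
  (fine (loop_measure Q D [set l]%classic) *
   ((count (fun n => rot n (useq l) == v) (visits l x))%:R / (size (visits l x))%:R))%R =
  (if all (mem D) v then path_weight Q (rcons v x) / (count_mem x v)%:R else 0)%R.
Proof.
move=> vN vx l; case: ifP => vD; last by rewrite loop_measure_notin ?vD // mul0r.
rewrite loop_measure_at //= size_visits -(seq.permP (perm_useq_loop_at x vN)).
have [i vE] := useq_loop_at x vN; rewrite -/l in vE.
have vrot : v \in rotations (useq l).
  have [il|li] := ltnP i (size (useq l)).
    by apply/mapP; exists i; rewrite ?mem_iota.
  by apply/mapP; exists 0%N; rewrite ?mem_iota // rot0 vE rot_oversize.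
have -> : count (fun n => rot n (useq l) == v) (visits l x) = count_mem v (rotations (useq l)).
  rewrite /visits count_filter /rotations count_map; apply: eq_in_count => n.
  rewrite mem_iota /= => nl; case: eqP => //= nE.
  move: vx; rewrite -nE /rot (drop_nth x) //= => -[->]; exact: eqxx.
have -> : size v = size (useq l) by rewrite vE size_rot.
have -> : cyclic_weight v = path_weight Q (rcons v x).
  by case: (v) vx => // ? ? [->].
have -> : size (undup (rotations v)) = size (undup (rotations (useq l))).
  by apply: perm_size; apply: perm_undup; apply: perm_mem; rewrite vE perm_rotations.
have sz : ((size (undup (rotations (useq l))))%:R *
   (count_mem v (rotations (useq l)))%:R = (size (useq l))%:R :> R)%R.
  by rewrite -natrM size_rotations.
have s0 : ((size (useq l))%:R != 0 :> R)%R by rewrite pnatr_eq0.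
by rewrite mulrA mulrACA (mulrAC (size _)%:R) sz mulrACA mulfV // mul1r.
Qed.

End LoopMeasure.

(** * The insertion read site by site *)

Section NthForms.
Context {V : finType}.
Implicit Types (g u : seq V) (us : seq (seq V)) (x : V) (C : {set V}).
Implicit Types (gs : seq (seq V)) (uss : seq (seq (seq V))).

Lemma insertablesP x0 C g us : insertables C g us <->
  size us = size g /\ forall s, (s < size g)%N ->
    insertable (C :|: [set y in take s g]%SET) (nth x0 g s) (nth [::] us s).
Proof.
elim: g C us => [|x g IH] C [|u us] /=; try by split=> // -[].
split=> [/andP[Hu /IH[-> H]]|[[sz] H]].
  split=> // -[|s] /=; first by rewrite setU_in_nil.
  by rewrite ltnS setU_in_cons => /H.
apply/andP; split; first by have := H 0%N isT; rewrite /= setU_in_nil.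
by apply/IH; split=> // s sg; have := H s.+1 sg; rewrite /= setU_in_cons.
Qed.

Lemma insertablessP C gs uss : insertabless C gs uss <->
  size uss = size gs /\ forall i, (i < size gs)%N ->
    insertables (C :|: [set y in flatten (take i gs)]%SET) (nth [::] gs i) (nth [::] uss i).
Proof.
elim: gs C uss => [|g gs IH] C [|us uss] /=; try by split=> // -[].
have E i : C :|: [set y in g ++ flatten (take i gs)]%SET =
    C :|: [set y in g]%SET :|: [set y in flatten (take i gs)]%SET.
  by apply/setP => y; rewrite !inE mem_cat orbA.
split=> [/andP[Hu /IH[-> H]]|[[sz] H]].
  split=> // -[|i] /=; first by rewrite setU_in_nil.
  by rewrite ltnS E => /H.
apply/andP; split; first by have := H 0%N isT; rewrite /= setU_in_nil.
by apply/IH; split=> // i ig; have := H i.+1 ig; rewrite /= E.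
Qed.

Lemma find_eqP (T : Type) (a : pred T) (x0 : T) (s : seq T) i : (i < size s)%N ->
  (has a s && (find a s == i)) = a (nth x0 s i) && ~~ has a (take i s).
Proof.
move=> is_; apply/andP/andP => [[has_s /eqP fi]|[ai nai]].
  by rewrite -fi nth_find // has_take // ltnn.
have has_s : has a s by apply/(has_nthP x0); exists i.
split=> //; move: nai; rewrite has_take // -leqNgt eqn_leq => ->; rewrite andbT leqNgt.
by apply/negP => /(before_find x0); rewrite ai.
Qed.

Lemma mem_lsupp_loop_at x v y : v != [::] -> (y \in lsupp (loop_at x v)) = (y \in v).
Proof. by case: v => // z v _; rewrite /loop_at mem_lsupp_unroot. Qed.

(** Brings the assignment rule to the form of the constraint on inserted words: meet the vertex,
    avoid its past. *)
Lemma assignedE x0 gs (l : uloop V) i s : (i < size gs)%N -> (s < size (nth [::] gs i))%N ->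
  assigned gs l i s = (nth x0 (nth [::] gs i) s \in lsupp l) &&
    ~~ has (mem (lsupp l)) (flatten (take i gs) ++ take s (nth [::] gs i)).
Proof.
move=> igs sg; rewrite /assigned andbA (find_eqP _ [::] igs) has_cat negb_or.
have -> : has (mem (lsupp l)) (flatten (take i gs)) = has (Defs.meets l) (take i gs).
  by elim: (take i gs) => //= g gs' IH; rewrite has_cat IH.
rewrite -andbA andbCA [in RHS]andbCA; congr (_ && _).
by rewrite -(find_eqP _ x0 sg) /Defs.meets.
Qed.

Lemma weave_flatten g (h : 'I_(size g) -> seq V) :
  flatten [seq rcons (h s) (tnth (in_tuple g) s) | s : 'I_(size g)] =
  weave g [seq h s | s : 'I_(size g)].
Proof.
have weaveE g' us : size us = size g' ->
    weave g' us = flatten [seq rcons q.2 q.1 | q <- zip g' us].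
  elim: g' us => [|x g' IH] [|u us] //= [/IH->].
  by rewrite -cat_rcons.
rewrite weaveE; last by rewrite size_map size_enum_ord.
have E : [seq tnth (in_tuple g) s | s <- enum 'I_(size g)] = g by exact: map_tnth_enum (in_tuple g).
by rewrite -[X in zip X _]E zip_map -map_comp.
Qed.

End NthForms.

Section Weights.
Context {R : realType} {V : finType}.
Variable Q : V -> V -> R.
Implicit Types (g u : seq V) (us : seq (seq V)) (x : V) (C D : {set V}).

Lemma path_weight_weave C g us : insertables C g us ->
  path_weight Q (weave g us) =
  path_weight Q g * \prod_(s < size g) path_weight Q
    (rcons (nth [::] us s) (tnth (in_tuple g) s)).
Proof.
elim: g C us => [|x g IH] C [|u us] //=; first by rewrite big_ord0 mulr1.
move=> /andP[_ Hus]; rewrite path_weight_cat big_ord_recl /= [RHS]mulrCA; congr (_ * _).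
have -> : \prod_(i < size g) path_weight Q
      (rcons (nth [::] us i) (tnth (in_tuple (x :: g)) (lift ord0 i))) =
    \prod_(i < size g) path_weight Q (rcons (nth [::] us i) (tnth (in_tuple g) i)).
  by apply: eq_bigr => i _; rewrite !(tnth_nth x).
case: g us Hus IH => [|y g] [|u' us] // Hus IH; first by rewrite /= big_ord0 mulr1.
have := IH _ _ Hus; case/andP: Hus => Hu' _.
have E w : (chain_weight Q x (u' ++ y :: w) = Q x y * path_weight Q (u' ++ y :: w)).
  by case: u' Hu' => [|z u'] //= /andP[/eqP->].
by rewrite /= E => ->; rewrite mulrA.
Qed.

Lemma path_in_weave D a b g us C : insertables C g us ->
  path_in D a b (weave g us) = path_in D a b g && all (all (mem D)) us.
Proof.
move=> Hus; rewrite /path_in.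
have -> : ohead (weave g us) = ohead g.
  case: g us Hus => [|x g] [|[|y u] us] //= /andP[/andP[/eqP->]] //.
have -> : last a (weave g us) = last a g.
  elim: g us C a Hus => [|x g IH] [|u us] C a' //= /andP[_ Hus].
  by rewrite last_cat /= (IH _ _ _ Hus).
have -> : all (mem D) (weave g us) = all (mem D) g && all (all (mem D)) us.
  elim: g us C Hus => [|x g IH] [|u us] C //= /andP[_ Hus].
  rewrite all_cat /= (IH _ _ Hus).
  by rewrite andbCA -!andbA; congr (_ && _); rewrite andbCA.
by rewrite !andbA.
Qed.

End Weights.

(** * Finiteness of the loop measure *)

Section LoopMass.
Local Open Scope complex_scope.
Context {R : realType} {V : finType}.
Variables (Q : V -> V -> R).
Hypothesis Q_sub : substochastic Q.
Hypothesis Q_radius : spectral_radius (submatrix Q [set: V]%SET) < 1.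

(** Otherwise 1 would be a complex eigenvalue, and the spectral radius at least 1. *)
Lemma unitmx_sub_submatrix : 1%:M - submatrix Q [set: V]%SET \in unitmx.
Proof.
set A := submatrix Q _; set Ac := map_mx (real_complex R) A.
apply: contraTT Q_radius => nU; rewrite -leNgt.
have eig1 : eigenvalue Ac 1.
  rewrite eigenvalue_root_char /root /char_poly -[X in X.[_]]/(\det (char_poly_mx Ac)).
  have -> : (\det (char_poly_mx Ac)).[1] = \det (1%:M - Ac).
    rewrite -horner_evalE -det_map_mx; congr (\det _); apply/matrixP => i j.
    by rewrite !mxE /= /horner_eval hornerD hornerN hornerMn hornerX hornerC.
  have -> : 1%:M - Ac = map_mx (real_complex R) (1%:M - A).
    by rewrite map_mxB map_mx1.
  by rewrite det_map_mx fmorph_eq0; move: nU; rewrite unitmxE unitfE negbK.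
pose S := [set complex.Re `|z| | z in [set z : R[i] | eigenvalue Ac z]]%classic.
rewrite /spectral_radius -/Ac -/S.
have S1 : S 1 by exists 1 => //; rewrite normr1.
apply: sup_upper_bound => //; split; first by exists 1.
(* [sup] bounds a set only if the set is bounded above; the eigenvalues are among the finitely many
   roots [rs], whose moduli are bounded by their sum. *)
have [rs rsE] := closed_field_poly_normal (char_poly Ac).
exists (\sum_(z <- rs) complex.Re `|z|) => _ [z /= zeig <-].
move: zeig; rewrite eigenvalue_root_char rsE.
rewrite (monicP (char_poly_monic _)) scale1r root_prod_XsubC => zrs.
rewrite (big_rem z) //= lerDl sumr_ge0 // => t _.
by have := normr_ge0 t; rewrite lecE => /andP[].
Qed.

Fixpoint walk_mass n x : R :=
  if n is n'.+1 then \sum_y Q x y * walk_mass n' y else 1.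

Lemma walk_mass_bounds n x : 0 <= walk_mass n x <= 1.
Proof.
elim: n x => [|n IH] x /=; first by rewrite ler01 lexx.
apply/andP; split; first by apply: sumr_ge0 => y _; rewrite mulr_ge0 ?Q_sub.1 //; case/andP: (IH y).
apply: le_trans (Q_sub.2 x); apply: ler_sum => y _.
by rewrite ler_piMr ?Q_sub.1 //; case/andP: (IH y).
Qed.

Lemma walk_massE n x :
  walk_mass n x = \sum_(s : n.-tuple V) chain_weight Q x s.
Proof.
elim: n x => [|n IH] x.
  rewrite (eq_bigr (fun=> 1)) => [|s _]; first by rewrite sumr_const card_tuple expn0.
  by rewrite tuple0.
rewrite /= (reindex (fun p : V * n.-tuple V => [tuple of p.1 :: p.2])) /=; last first.
  exists (fun s => (thead s, [tuple of behead s])) => [[y s]|s] _ /=.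
    by congr (_, _); apply: val_inj.
  by rewrite [s in RHS]tuple_eta.
rewrite -(pair_bigA _ (fun y (s : n.-tuple V) => Q x y * chain_weight Q y s)) /=.
by apply: eq_bigr => y _; rewrite IH mulr_sumr.
Qed.

(** The sum telescopes after multiplication by [I - Q], leaving a vector with entries in [0, 1]; the
    inverse matrix then gives a bound that does not depend on [n]. *)
Lemma walk_mass_sum_bounded : exists C, forall n x, \sum_(k < n) walk_mass k x <= C.
Proof.
set A := submatrix Q [set: V]%SET; set B := invmx (1%:M - A).
exists (\sum_i \sum_j `|B i j|) => n x.
pose v k : 'cV[R]_#|[set: V]%SET| := \col_i walk_mass k (enum_val i).
have vS k : v k.+1 = A *m v k.
  apply/matrixP => i j; rewrite !mxE /= [LHS](reindex_onto enum_val (enum_rank_in (finset.in_setT x))) /=; last first.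
    by move=> y _; rewrite enum_rankK_in ?finset.in_setT.
  apply: eq_big => [k'|k' _]; last by rewrite !mxE.
  by rewrite enum_valK_in eqxx.
have vsum : (1%:M - A) *m (\sum_(k < n) v k) = v 0%N - v n.
  elim: n => [|n IH]; first by rewrite big_ord0 mulmx0 subrr.
  by rewrite big_ord_recr /= mulmxDr IH mulmxBl mul1mx -vS addrA subrK.
have vE : \sum_(k < n) v k = B *m (v 0%N - v n).
  by rewrite -vsum mulKmx // unitmx_sub_submatrix.
pose i := enum_rank_in (finset.in_setT x) x.
have -> : \sum_(k < n) walk_mass k x = (\sum_(k < n) v k) i 0.
  by rewrite summxE; apply: eq_bigr => k _; rewrite mxE enum_rankK_in ?finset.in_setT.
rewrite vE mxE; apply: (@le_trans _ _ (\sum_j `|B i j|)); last first.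
  by rewrite [leRHS](bigD1 i) //= lerDl sumr_ge0 // => j _; rewrite sumr_ge0.
apply: ler_sum => j _; apply: le_trans (ler_norm _) _; rewrite normrM ler_piMr //.
rewrite !mxE /= ger0_norm ?subr_ge0 ?lerBlDr ?lerDl; by case/andP: (walk_mass_bounds n (enum_val j)).
Qed.

Variable D : {set V}.

Lemma rloop_weight_le n x :
  \sum_(s : n.-tuple V) rloop_weight Q (x, tval s) <= walk_mass n.+1 x.
Proof.
rewrite walk_massE (reindex (fun p : n.-tuple V * V => [tuple of rcons p.1 p.2])) /=; last first.
  exists (fun s => ([tuple of belast (thead s) (behead s)], last (thead s) (behead s))).
    move=> [[s sn] y] _ /=; congr (_, _); last first.
      by rewrite /thead (tnth_nth y) /=; case: (s) => //= ? ?; rewrite last_rcons.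
    apply: val_inj => /=; rewrite /thead (tnth_nth y) /=.
    by case: (s) => //= ? ?; rewrite belast_rcons.
  move=> s _; apply: val_inj; case/tupleP: s => z s /=; rewrite theadE.
  by rewrite -lastI.
rewrite -(pair_bigA _ (fun (s : n.-tuple V) y => chain_weight Q x (rcons s y))) /=.
apply: ler_sum => s _; rewrite (bigD1 x) //= lerDl sumr_ge0 // => y _.
exact: chain_weight_ge0.
Qed.

(** A finite set of rooted loops has bounded length. Dropping the restrictions and the factor
    [1 / n], its mass is at most that of all walks up to this length. *)
Lemma loop_measure_lty (A : set (uloop V)) : (loop_measure Q D A < +oo)%E.
Proof.
have [C CP] := walk_mass_sum_bounded.
apply: (@le_lt_trans _ _ (\sum_x C)%:E); last exact: ltry.
apply: ge_ereal_sup => _ [F [finF _] <-]; rewrite fsbig_finite //= sumEFin lee_fin.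
pose N := (\max_(l <- fset_set F) size l.2).+1.
pose s := [seq (p.1, tval (tagged p.2)) | p : V * {n : 'I_N & n.-tuple V}].
have s_uniq : uniq s.
  rewrite map_inj_uniq ?enum_uniq // => -[x [n t]] [y [n' t']] /= [-> tt'].
  congr (_, _); have nn' : n = n'.
    by apply: val_inj; rewrite /= -(size_tuple t) tt' size_tuple.
  by subst n'; congr (existT _ _ _); apply: val_inj.
have Fs : {subset fset_set F <= s}.
  move=> [x t] lF; have tN : (size t < N)%N.
    by rewrite ltnS (big_rem (x, t)) //= leq_maxl.
  apply/mapP; exists (x, existT _ (Ordinal tN) (in_tuple t)) => //.
  by rewrite mem_enum.
apply: (@le_trans _ _ (\sum_(l <- s) rloop_weight Q l)).
  apply: (@le_trans _ _ (\sum_(l <- fset_set F) rloop_weight Q l)).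
    apply: ler_sum => l _; rewrite ler_pdivrMr ?ltr0n // ler_peMr ?ler1n //.
    exact: path_weight_ge0.
  rewrite [leRHS](bigID (mem (fset_set F))) /= -[leLHS]addr0 lerD ?sumr_ge0 //; last first.
    by move=> l _; exact: path_weight_ge0.
  rewrite -[leRHS]big_filter le_eqVlt; apply/orP; left; apply/eqP/perm_big.
  apply: uniq_perm; rewrite ?fset_uniq ?filter_uniq // => l.
  by rewrite mem_filter /=; case: (boolP (l \in fset_set F)) => // /Fs->.
rewrite big_map big_enum /= -(pair_bigA _ (fun x (p : {n : 'I_N & n.-tuple V}) => rloop_weight Q (x, tval (tagged p)))) /=.
apply: ler_sum => x _; apply: le_trans (CP N.+1 x).
rewrite big_ord_recl /= ler_wpDl //.
rewrite -(sig_big_dep xpredT (fun (n : 'I_N) (t : n.-tuple V) => true) (fun n t => rloop_weight Q (x, tval t))) /=.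
by apply: ler_sum => n _; rewrite (le_trans (rloop_weight_le _ _)).
Qed.

End LoopMass.

Local Open Scope classical_set_scope.
Local Open Scope ereal_scope.

(** * Independence and the law of the soup *)

Section Independence.
Context {R : realType} {d : measure_display} {T : measurableType d}.
Variable P : probability T R.

Lemma mutually_independent_finType (J : Type) (F : J -> set (set T)) (I : finType)
    (j : I -> J) (E : I -> set T) : mutually_independent P F -> injective j ->
  (forall i, F (j i) (E i)) ->
  P (\bigcap_(i in [set: I]) E i) = \prod_i P (E i).
Proof.
move=> indep j_inj FE.
have -> : \bigcap_(i in [set: I]) E i = \bigcap_(k in [set: 'I_#|I|]) E (enum_val k).
  apply/seteqP; split=> t H i _; first exact: H.
  by rewrite -(enum_rankK i); exact: H.
rewrite (indep _ (fun k => j (enum_val k))).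
- by rewrite -(big_enum_val (fun i => P (E i))).
- by move=> k k' /j_inj/enum_val_inj.
- by move=> k; exact: FE.
Qed.

Definition product_rule (I : finType) (C : I -> set (set T)) :=
  forall E, (forall i, C i (E i)) ->
    P (\bigcap_(i in [set: I]) E i) = \prod_i P (E i).

(** The alternative [set0] pads the sequence, so that finite unions and unions over countable types
    are included. *)
Definition disjoint_unions (C : set (set T)) : set (set T) :=
  [set A | exists F : nat -> set T,
    [/\ trivIset setT F, A = \bigcup_k F k & forall k, C (F k) \/ F k = set0]].

Lemma disjoint_unions_measurable (C : set (set T)) : C `<=` measurable ->
  disjoint_unions C `<=` measurable.
Proof.
move=> CM _ [F [_ -> CF]]; apply: bigcupT_measurable => k.
by case: (CF k) => [/CM//|->].
Qed.

(** Countable additivity is applied in one coordinate after another: [C' s] has passed to unions in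
    the coordinates listed in [s]. The other coordinates admit [set0] besides the members of [C i],
    because pieces of a union may be empty. *)
Lemma product_rule_disjoint_unions (I : finType) (C : I -> set (set T)) :
  (forall i, C i `<=` measurable) -> product_rule C ->
  product_rule (fun i => disjoint_unions (C i)).
Proof.
move=> CM Crule.
pose C' (s : seq I) i := if i \in s then disjoint_unions (C i) else
  C i `|` [set set0].
have C'M s i : C' s i `<=` measurable.
  rewrite /C'; case: ifP => _; first exact: disjoint_unions_measurable (CM i).
  by move=> A [/CM//|->].
suff H s : uniq s -> product_rule (C' s).
  move=> E CE; apply: (H (enum I)); first exact: enum_uniq.
  by move=> i; rewrite /C' mem_enum; exact: CE.
elim: s => [|i0 s IH].
  move=> _ E CE; have [[i Ei]|E0] := pselect (exists i, E i = set0).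
    rewrite (bigD1 i) //= Ei measure0 mul0e.
    rewrite (_ : \bigcap_(j in _) _ = set0) ?measure0 // -subset0 => t /(_ i Logic.I).
    by rewrite Ei.
  by apply: Crule => i; case: (CE i) => // Ei; case: E0; exists i.
rewrite cons_uniq => /andP[i0s /IH {}IH] E CE.
have := CE i0; rewrite /C' mem_head => -[F [tF EF CF]].
pose G k i := if i == i0 then F k else E i.
have GE k : P (\bigcap_(i in [set: I]) G k i) = P (F k) * \prod_(i | i != i0) P (E i).
  rewrite IH => [|i]; last first.
    rewrite /G /C'; case: eqP => [->|/eqP ne]; first by rewrite (negPf i0s); exact: CF.
    by have := CE i; rewrite /C' inE (negPf ne).
  rewrite (bigD1 i0) //= /G eqxx; congr (_ * _).
  by apply: eq_bigr => i /negPf->.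
have FM k : measurable (F k) by case: (CF k) => [/CM//|->].
have GM k : measurable (\bigcap_(i in [set: I]) G k i).
  apply: fin_bigcap_measurable => // i _; rewrite /G; case: ifP => // _.
  exact: C'M (CE i).
have -> : \bigcap_(i in [set: I]) E i = \bigcup_k \bigcap_(i in [set: I]) G k i.
  apply/seteqP; split=> t.
    move=> H; have := H i0 Logic.I; rewrite EF => -[k _ Fkt].
    by exists k => // i _; rewrite /G; case: eqP => // _; exact: H.
  move=> [k _ H] i _; have := H i Logic.I; rewrite /G; case: eqP => // -> Fkt.
  by rewrite EF; exists k.
rewrite (bigD1 i0) //= EF !measure_bigcup //; last first.
  move=> k k' _ _ [t [H H']]; apply: tF => //; exists t; split.
    by have := H i0 Logic.I; rewrite /G eqxx.
  by have := H' i0 Logic.I; rewrite /G eqxx.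
have [r rE] : exists r, \prod_(i | i != i0) P (E i) = r%:E.
  exists (\prod_(i | i != i0) fine (P (E i)))%R; rewrite -prodEFin.
  apply: eq_bigr => i _; rewrite fineK // fin_num_measure //; exact: C'M (CE i).
rewrite rE muleC -nneseriesZl //; apply: eq_eseriesr => k _.
by apply: etrans (GE k) _; rewrite rE muleC.
Qed.

Section Countable.
Context {Y : countType}.
Implicit Types (S : set Y) (X : Y -> set T).

Definition countable_family S X (n : nat) : set T :=
  if pickle_inv n is Some y then if `[< S y >] then X y else set0 else set0.

Lemma bigcup_countable_family S X :
  \bigcup_(y in S) X y = \bigcup_n countable_family S X n.
Proof.
apply/seteqP; split=> t.
  move=> [y Sy Xyt]; exists (choice.pickle y) => //.
  by rewrite /countable_family pickleK_inv; case: asboolP.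
move=> [n _]; rewrite /countable_family; case: pickle_inv => // y.
by case: asboolP => // Sy Xyt; exists y.
Qed.

Lemma trivIset_countable_family S X : trivIset S X ->
  trivIset setT (countable_family S X).
Proof.
move=> tX n m _ _ [t []]; rewrite /countable_family.
case En : (pickle_inv n) => [y|//]; case: asboolP => // Sy Xy.
case Em : (pickle_inv m) => [z|//]; case: asboolP => // Sz Xz.
have yz : y = z by apply: tX => //; exists t.
have := @pickle_invK Y n; have := @pickle_invK Y m; rewrite En Em /= yz => <- <-.
by [].
Qed.

Lemma measurable_countable_family S X n : (forall y, S y -> measurable (X y)) ->
  measurable (countable_family S X n).
Proof.
by move=> XM; rewrite /countable_family; case: pickle_inv => // y; case: asboolP => // /XM.
Qed.

Lemma bigcup_countType_measurable S X : (forall y, S y -> measurable (X y)) ->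
  measurable (\bigcup_(y in S) X y).
Proof.
move=> XM; rewrite bigcup_countable_family; apply: bigcupT_measurable => n.
exact: measurable_countable_family.
Qed.

Lemma disjoint_unions_bigcup (C : set (set T)) S X : trivIset S X ->
  (forall y, S y -> C (X y)) -> disjoint_unions C (\bigcup_(y in S) X y).
Proof.
move=> tX CX; exists (countable_family S X); split.
- exact: trivIset_countable_family.
- exact: bigcup_countable_family.
- move=> n; rewrite /countable_family; case: pickle_inv => [y|]; last by right.
  by case: asboolP => [/CX|]; [left|right].
Qed.

(** Besides the comparison of the two laws, the case [c = 0] shows that countable disjoint unions of
    null events are null. *)
Lemma measure_bigcup_proportional (c : R) S X X' : trivIset S X -> trivIset S X' ->
  (forall y, S y -> measurable (X y)) -> (forall y, S y -> measurable (X' y)) ->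
  (forall y, S y -> P (X y) = c%:E * P (X' y)) ->
  P (\bigcup_(y in S) X y) = c%:E * P (\bigcup_(y in S) X' y).
Proof.
move=> tX tX' XM X'M PX; rewrite !bigcup_countable_family !measure_bigcup;
  try first [exact: trivIset_countable_family|by move=> n _; exact: measurable_countable_family].
rewrite -nneseriesZl //; apply: eq_eseriesr => n _; rewrite /countable_family.
case: pickle_inv => [y|]; last by rewrite measure0 mule0.
by case: asboolP => [/PX//|]; rewrite measure0 mule0.
Qed.

Lemma preimage_countType_measurable (f : T -> Y) (B : set Y) :
  (forall y, measurable (f @^-1` [set y])) -> measurable (f @^-1` B).
Proof.
move=> fM; rewrite (_ : f @^-1` B = \bigcup_(y in B) f @^-1` [set y]).
  exact: bigcup_countType_measurable.
by apply/seteqP; split=> t; [move=> Bft; exists (f t)|move=> [y By /= ->]].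
Qed.

End Countable.

Lemma discrete_law_finite (X : countType) (f : T -> X) (law : X -> R) (s : seq X) (B : set X) :
  discrete_law P f law -> uniq s -> (forall x, x \notin s -> law x = 0%R) ->
  P (f @^-1` B) = (\sum_(x <- s | x \in B) law x)%:E.
Proof.
move=> [fM fP] s_uniq law0.
have -> : f @^-1` B = (\bigcup_(x in [set` s] `&` B) f @^-1` [set x]) `|`
    (\bigcup_(x in ~` [set` s] `&` B) f @^-1` [set x]).
  apply/seteqP; split=> t.
    move=> Bft; have [fs|fs] := boolP (f t \in s); [left|right]; exists (f t) => //.
    by split=> //=; apply/negP.
  by move=> [] [x [_ Bx] /= ->].
have M S : measurable (\bigcup_(x in S) f @^-1` [set x]).
  exact: bigcup_countType_measurable.
have tf S : trivIset S (fun x => f @^-1` [set x]).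
  by move=> x y _ _ [t [/= <- <-]].
rewrite measureU //; last first.
  by rewrite -subset0 => t [[x [xs _] /= fx] [y [ys _] /= fy]]; apply: ys; rewrite -fy fx.
rewrite [X in _ + X](_ : _ = 0) ?adde0; last first.
  have := @measure_bigcup_proportional _ 0 (~` [set` s] `&` B) _ _ (tf _) (tf _) (fun y _ => fM y) (fun y _ => fM y).
  rewrite mul0e; apply => y [/= /negP ys _].
  by rewrite mul0e; apply: etrans (fP y) _; rewrite law0.
rewrite measure_fin_bigcup //; last by apply: finite_setIl; exact: finite_seq.
rewrite (eq_fsbigr (fun x => (law x)%:E)) => [|x _]; last exact: fP.
rewrite (_ : [set` s] `&` B = [set` [seq x <- s | x \in B]]).
  by rewrite -fsbig_seq ?filter_uniq // big_filter sumEFin.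
by apply/seteqP; split=> x /=; rewrite mem_filter;
  [move=> [-> /mem_set->]|move=> /andP[/set_mem]].
Qed.

End Independence.

Lemma poisson_prob_set1 (R : realType) (m : R) n : (0 <= m)%R ->
  poisson_prob m 0 [set n] = (m ^+ n / n`!%:R * expR (- m))%:E.
Proof.
rewrite le_eqVlt => /predU1P[<-|m0]; rewrite /poisson_prob.
  (* At rate 0 [poisson_prob] is a Dirac mass at 0, in agreement with the formula since
     [0 ^+ 0 = 1]. *)
  rewrite ltxx diracE oppr0 expR0 mulr1; case: n => [|n].
    by rewrite mem_set // expr0 divr1.
  by rewrite memNset // expr0n mul0r.
by rewrite m0 esum_set1 ?lee_fin ?poisson_pmf_ge0 // /poisson_pmf m0.
Qed.

(** * Poisson probabilities of loop configurations *)

Section Soup.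
Context {R : realType} {V : finType} {d : measure_display} {T : measurableType d}.
Variables (P : probability T R) (Q : V -> V -> R) (D : {set V}).
Hypothesis Q_sub : substochastic Q.
Hypothesis Q_radius : (spectral_radius (submatrix Q [set: V]%SET) < 1)%R.
Variable soup : uloop V -> T -> nat.
Hypothesis soup_law : loop_soup P Q D soup.
Implicit Types (L : set (uloop V)) (c : seq (uloop V)).

Definition mass L : R := fine (loop_measure Q D L).

Lemma loop_measure_ge0 L : 0 <= loop_measure Q D L.
Proof.
by apply: esum_ge0 => l _; rewrite lee_fin divr_ge0 //; exact: path_weight_ge0.
Qed.

Lemma massE L : (mass L)%:E = loop_measure Q D L.
Proof.
rewrite /mass fineK // ge0_fin_numE ?loop_measure_ge0 //.
exact: loop_measure_lty.
Qed.

Lemma mass_ge0 L : (0 <= mass L)%R.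
Proof. by rewrite -lee_fin massE loop_measure_ge0. Qed.

Lemma massID L L' : mass L = (mass (L `&` L') + mass (L `\` L'))%R.
Proof.
apply: EFin_inj; rewrite EFinD !massE /loop_measure.
rewrite (esumID (unroot @^-1` L')); last first.
  by move=> l _; rewrite lee_fin divr_ge0 //; exact: path_weight_ge0.
by congr (_ + _); congr (esum _ _); apply/seteqP; split=> l /=; tauto.
Qed.

Lemma mass_seq L c : uniq c -> [set` c] `<=` L ->
  mass L = (\sum_(l <- c) mass [set l] + mass (L `\` [set` c]))%R.
Proof.
elim: c L => [|l c IH] L /=; first by move=> _ _; rewrite big_nil add0r set_nil setD0.
move=> /andP[lc c_uniq] cL; rewrite (massID L [set l]) big_cons -addrA; congr (_ + _)%R.
  by congr mass; apply/seteqP; split=> [k []//|k ->]; split=> //; apply: cL; exact: mem_head.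
rewrite IH //; last first.
  move=> k kc; split; first by apply: cL; rewrite /= inE kc orbT.
  by move=> kl; move: lc; rewrite -[l]kl kc.
congr (_ + mass _)%R; apply/seteqP; split=> k /=; rewrite inE.
  by move=> [[Lk kl] kc]; split=> //; case: eqP.
by move=> [Lk /negP]; rewrite negb_or => /andP[/eqP ? /negP].
Qed.

Definition config L c : set T := [set t | forall l, L l -> soup l t = count_mem l c].

(** A product of Poisson probabilities in which the loops of [L] outside [c] contribute to the
    exponential alone. *)
Definition config_pmf L c : R :=
  (expR (- mass L) *
   \prod_(l <- undup c) (mass [set l] ^+ count_mem l c / (count_mem l c)`!%:R))%R.

Local Notation cnt := (soup_count (R := R) soup).

Lemma soup_count_set1 l t : cnt [set l] t = (soup l t)%:R%:E.
Proof. by rewrite /soup_count esum_set1 // lee_fin. Qed.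

Lemma soup_count_le L L' t : finite_set L' -> L' `<=` L ->
  \sum_(l \in L') ((soup l t)%:R : R)%:E <= cnt L t.
Proof. by move=> fL' L'L; apply: esum_ge; exists L'. Qed.

Lemma soup_count_eq0 L t :
  (cnt L t = 0%:R%:E :> \bar R) <-> (forall l, L l -> soup l t = 0%N).
Proof.
split=> [E l Ll|H]; last by rewrite /soup_count esum1 // => l /H->.
have := @soup_count_le L [set l] t (finite_set1 _); rewrite fsbig_set1 E lee_fin => H.
have {}H : ((soup l t)%:R <= 0%:R :> R)%R by apply: H => _ ->.
by move: H; rewrite ler_nat leqn0 => /eqP.
Qed.

(** Each [L j] is cut into the singletons of the loops of [c j] and one remainder, on which the
    count is 0. This gives finitely many disjoint sets even if [L j] is infinite, so the
    independence of Poisson counts applies; the exponentials recombine into the mass of [L j]. *)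
Lemma config_joint (J : finType) (L : J -> set (uloop V)) (c : J -> seq (uloop V)) :
  trivIset setT L -> (forall j, [set` c j] `<=` L j) ->
  P (\bigcap_(j in [set: J]) config (L j) (c j)) = (\prod_j config_pmf (L j) (c j))%:E.
Proof.
move=> tL cL.
pose I : finType := (J + {j : J & 'I_(size (undup (c j)))})%type.
pose loop_of (p : {j : J & 'I_(size (undup (c j)))}) := tnth (in_tuple (undup (c (tag p)))) (tagged p).
have loop_ofP p : loop_of p \in c (tag p) by rewrite -mem_undup; exact: mem_tnth.
pose A (i : I) := match i with
  | inl j => L j `\` [set` c j]
  | inr p => [set loop_of p] end.
pose n (i : I) := match i with
  | inl _ => 0%N
  | inr p => count_mem (loop_of p) (c (tag p)) end.
have tA : trivIset setT A.
  move=> [j|p] [j'|p'] _ _ [l []] /=.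
  - by move=> [Ll _] [Ll' _]; congr inl; apply: tL => //; exists l.
  - move=> [Ll lc] lE; move: (loop_ofP p'); rewrite -lE => lc'.
    have jj' : j = tag p' by apply: tL => //; exists l; split=> //; exact: cL.
    by case: lc; rewrite jj'.
  - move=> lE [Ll lc]; move: (loop_ofP p); rewrite -lE => lc'.
    have jj' : j' = tag p by apply: tL => //; exists l; split=> //; exact: cL.
    by case: lc; rewrite jj'.
  - move=> -> E; have jj' : tag p = tag p'.
      apply: tL => //; exists (loop_of p); split; first exact: cL (loop_ofP p).
      by rewrite E; exact: cL (loop_ofP p').
    congr inr; case: p p' jj' E => j k [j' k'] /= jj'; subst j'.
    by rewrite /loop_of /= => /(elimT (tuple_uniqP (in_tuple _)) (undup_uniq (c j)))->.
have [_ soupP soupI] := soup_law.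
have AE i : [set t | cnt (A i) t = (n i)%:R%:E] =
    [set t | forall l, A i l -> soup l t = n i].
  apply/seteqP; split=> t /=; case: i => [j|p] /=; try by move/soup_count_eq0.
    by rewrite soup_count_set1 => -[/eqP]; rewrite eqr_nat => /eqP lE l ->.
  by rewrite soup_count_set1 => ->.
have -> : \bigcap_(j in [set: J]) config (L j) (c j) =
    \bigcap_(i in [set: I]) [set t | cnt (A i) t = (n i)%:R%:E].
  apply/seteqP; split=> t H.
    move=> i _; rewrite AE => l; case: i => [j|p] /=.
      by move=> [Ll /negP lc]; rewrite (H j) //; apply/count_memPn.
    by move=> ->; apply: (H (tag p)) => //; exact: cL (loop_ofP p).
  move=> j _ l Ll; have [lc|lc] := boolP (l \in c j).
    have lu : (index l (undup (c j)) < size (undup (c j)))%N by rewrite index_mem mem_undup.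
    have lE : l = loop_of (existT _ j (Ordinal lu)).
      by rewrite /loop_of (tnth_nth l) /= nth_index ?mem_undup.
    have := H (inr (existT _ j (Ordinal lu))) Logic.I; rewrite AE /= -lE; exact.
  have := H (inl j) Logic.I; rewrite AE /= => -> //; last by split=> //; exact/negP.
  by rewrite (count_memPn lc).
rewrite (@mutually_independent_finType _ _ _ P _ _ I (fun i => enum_rank i) _
  (soupI #|I| (fun k => A (enum_val k)) _)); first last.
- by move=> i; rewrite enum_rankK; exists [set (n i)%:R%:E].
- exact: enum_rank_inj.
- by move=> k k' _ _ /tA; move=> /(_ Logic.I Logic.I)/enum_val_inj.
have PE i : P [set t | cnt (A i) t = (n i)%:R%:E] =
    (mass (A i) ^+ n i / (n i)`!%:R * expR (- mass (A i)))%:E.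
  by rewrite soupP ?loop_measure_lty // poisson_prob_set1 // mass_ge0.
rewrite (eq_bigr _ (fun i _ => PE i)) prodEFin; congr EFin.
rewrite big_sumType /= -(sig_big_dep xpredT (fun j (k : 'I_(size (undup (c j)))) => true)
  (fun j k => let l := tnth (in_tuple (undup (c j))) k in
     mass [set l] ^+ count_mem l (c j) / (count_mem l (c j))`!%:R * expR (- mass [set l]))%R) /=.
rewrite -big_split /=; apply: eq_bigr => j _.
rewrite big_split /= -(big_tnth _ _ _ xpredT (fun l => expR (- mass [set l])))%R.
rewrite -(big_tnth _ _ _ xpredT (fun l => mass [set l] ^+ count_mem l (c j) / (count_mem l (c j))`!%:R))%R.
rewrite expr0 divr1 mul1r mulrC -mulrA -expR_sum -expRD mulrC /config_pmf; congr (expR _ * _)%R.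
rewrite sumrN -opprD (@mass_seq (L j) _ (undup_uniq (c j))); last by move=> l /=; rewrite mem_undup => /cL.
have -> : [set` undup (c j)] = [set` c j].
  by apply/seteqP; split=> l /=; rewrite mem_undup.
by rewrite addrC.
Qed.

End Soup.

Section SoupEvents.
Context {R : realType} {V : finType} {d : measure_display} {T : measurableType d}.
Variables (P : probability T R) (Q : V -> V -> R) (D : {set V}).
Hypothesis Q_sub : substochastic Q.
Hypothesis Q_radius : (spectral_radius (submatrix Q [set: V]%SET) < 1)%R.
Variable soup : uloop V -> T -> nat.
Hypothesis soup_law : loop_soup P Q D soup.
Implicit Types (L : set (uloop V)) (c : seq (uloop V)) (r : seq (V * seq V)).

(** [uloop] carries only a choice structure; rooted loops serve as a countable index for the
    constraints. *)
Lemma constraints_sigma_algebra (A : set (set T)) (C : uloop V -> nat -> Prop) :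
  sigma_algebra setT A -> (forall l n, A (soup l @^-1` [set n])) ->
  A [set t | forall l n, C l n -> soup l t = n].
Proof.
move=> [Aset0 Acompl Abigcup] AN.
have -> : [set t | forall l n, C l n -> soup l t = n] =
    setT `\` \bigcup_(p in [set p : V * seq V * nat | C (unroot p.1) p.2])
      (setT `\` soup (unroot p.1) @^-1` [set p.2]).
  apply/seteqP; split=> t.
    by move=> H; split=> // -[p /H E []].
  move=> [_ H] l n Cln; apply: contrapT => nE; apply: H.
  have lE : unroot (repr l) = l by exact: reprK.
  by exists (repr l, n); rewrite /= ?lE.
apply: (Acompl); rewrite bigcup_countable_family; apply: Abigcup => n.
rewrite /countable_family; case: pickle_inv => // p; case: asboolP => // _.
by apply: Acompl; exact: AN.
Qed.

Lemma config_measurable L c : measurable (config soup L c).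
Proof.
have [soupM _ _] := soup_law.
have -> : config soup L c = [set t | forall l n, L l /\ n = count_mem l c -> soup l t = n].
  apply/seteqP; split=> t H l; first by move=> n [/H Hl ->].
  by move=> Ll; apply: H.
by apply: constraints_sigma_algebra => //; exact: sigma_algebra_measurable.
Qed.

Lemma config_soup_events (J : Type) (L : J -> set (uloop V)) (c : J -> seq (uloop V)) :
  soup_events soup (\bigcap_(j in [set: J]) config soup (L j) (c j)).
Proof.
have -> : \bigcap_(j in [set: J]) config soup (L j) (c j) =
    [set t | forall l n, (exists j, L j l /\ n = count_mem l (c j)) -> soup l t = n].
  apply/seteqP; split=> t H l.
    by move=> n [j [Ll ->]]; apply: (H j).
  by move=> _ k Ll; apply: H; exists l.
apply: constraints_sigma_algebra; first exact: smallest_sigma_algebra.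
by move=> l n; apply: sub_sigma_algebra; exists l => //; exists [set n].
Qed.

Local Notation cnt := (soup_count (R := R) soup).

Lemma soup_count_config L c t : [set` c] `<=` L -> config soup L c t ->
  cnt L t = (size c)%:R%:E.
Proof.
move=> cL cfg; rewrite /soup_count (esumID [set` c]); last by move=> l _; rewrite lee_fin.
rewrite [X in _ + X]esum1 ?adde0; last first.
  by move=> l [Ll /negP lc]; rewrite cfg // (count_memPn lc).
have -> : L `&` [set` c] = [set` undup c].
  by apply/seteqP; split=> l /=; rewrite mem_undup; [case|move=> lc; split=> //; exact: cL].
rewrite esum_fset; [|exact: finite_seq|by move=> l _; rewrite lee_fin].
rewrite -fsbig_seq ?undup_uniq // sumEFin -(sum_count_undup c) natr_sum; congr EFin.
by apply: eq_big_seq => l; rewrite mem_undup => /cL/cfg->.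
Qed.

(** Phrased with lists so as to be a countable union of [config] events. *)
Definition finite_soup L : set T :=
  [set t | exists c, [set` c] `<=` L /\ config soup L c t].

Lemma finite_soup_support L t : finite_set [set l | L l /\ (0 < soup l t)%N] ->
  finite_soup L t.
Proof.
move=> fA; set A := [set l | _] in fA.
pose c := flatten [seq nseq (soup l t) l | l <- fset_set A].
have cP l : count_mem l c = if l \in fset_set A then soup l t else 0%N.
  rewrite /c -[l \in fset_set A]/(l \in enum_fset (fset_set A)).
  elim: (enum_fset _) (fset_uniq (fset_set A)) => //= k s IH /andP[ks /IH {}IH].
  rewrite count_cat IH inE count_nseq /=; case: (eqVneq k l) => [<-|kl].
    by rewrite mul1n (negPf ks) addn0.
  by rewrite mul0n.
exists c; split=> [l /=|l Ll].
  by rewrite -has_pred1 has_count cP; case: ifP => //; rewrite in_fset_set // => /set_mem[].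
rewrite cP in_fset_set //; case: (boolP (l \in A)) => // /negP lA.
by apply/eqP; rewrite -leqn0 leqNgt; apply/negP => l0; apply: lA; apply/mem_set.
Qed.

Lemma finite_soup_count L t n : cnt L t = n%:R%:E -> finite_soup L t.
Proof.
move=> cntE; apply: finite_soup_support; apply: contrapT => infA.
have [B BA Bn] := infinite_set_fset n.+1 infA.
have := @soup_count_le R V _ _ soup L [set` B] t (finite_fset _).
rewrite cntE fsbig_finite ?finite_fset //= set_fsetK sumEFin lee_fin => H.
have {}H : (\sum_(l <- B) (soup l t)%:R <= n%:R :> R)%R by apply: H => l /BA[].
move: H; rewrite -natr_sum ler_nat leqNgt => /negP; apply.
apply: leq_trans Bn _; rewrite -sum1_size big_seq [leqRHS]big_seq; apply: leq_sum => l lB.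
by have [] := BA l lB.
Qed.

Lemma config_codes L (S : set (seq (uloop V))) :
  [set t | exists c, S c /\ config soup L c t] =
  \bigcup_(r in [set r | S (map unroot r)]) config soup L (map unroot r).
Proof.
apply/seteqP; split=> t.
  move=> [c [Sc cfg]]; exists (map repr c); rewrite /= -map_comp map_id_in // => l _; exact: reprK.
by move=> [r Sr cfg]; exists (map unroot r).
Qed.

Lemma config_union_measurable L S :
  measurable [set t | exists c, S c /\ config soup L c t].
Proof.
rewrite config_codes; apply: bigcup_countType_measurable => r _.
exact: config_measurable.
Qed.

Lemma finite_soup_measurable L : measurable (finite_soup L).
Proof. exact: config_union_measurable. Qed.

(** The count is Poisson with finite mean, so its integer values carry the whole probability. *)
Lemma finite_soup_as L : P (finite_soup L) = 1.
Proof.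
(* The count is a sum over a possibly infinite set of loops; its level sets are measurable as
   countable unions of configurations. *)
have cntM n : measurable [set t | cnt L t = n%:R%:E].
  have -> : [set t | cnt L t = n%:R%:E] =
      [set t | exists c, ([set` c] `<=` L /\ size c = n) /\ config soup L c t].
    apply/seteqP; split=> t /=.
      move=> E; have [c [cL cfg]] := finite_soup_count E; exists c; split=> //; split=> //.
      by move: E; rewrite (soup_count_config cL cfg) => -[/eqP]; rewrite eqr_nat => /eqP.
    by move=> [c [[cL <-] cfg]]; exact: soup_count_config.
  exact: config_union_measurable.
have finM := finite_soup_measurable L.
apply/eqP; rewrite eq_le probability_le1 //=.
have [_ soupP _] := soup_law.
have -> : 1 = P (\bigcup_n [set t | cnt L t = n%:R%:E]).
  transitivity (poisson_prob (mass Q D L) 0 (\bigcup_n [set n])).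
    have -> : \bigcup_n [set n] = [set: nat] by apply/seteqP; split=> n //= _; exists n.
    by rewrite probability_setT.
  rewrite !measure_bigcup //; first by apply: eq_eseriesr => n _; apply/esym; exact: soupP (loop_measure_lty _ _ _ _).
    by move=> n m _ _ [t [/= -> []]] /eqP; rewrite eqr_nat => /eqP.
  by move=> n m _ _ [k [/= -> ->]].
apply: le_measure; rewrite ?inE; [exact: bigcupT_measurable|exact: finM|].
by move=> t [n _ /finite_soup_count].
Qed.

End SoupEvents.

(** * Joint independence of the walks and the sites *)

Section Rectangles.
Context {R : realType} {V : finType} {d : measure_display} {T : measurableType d}.
Variables (P : probability T R) (Q : V -> V -> R) (D : {set V}).
Hypothesis Q_sub : substochastic Q.
Hypothesis Q_radius : (spectral_radius (submatrix Q [set: V]%SET) < 1)%R.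
Variable soup : uloop V -> T -> nat.
Hypothesis soup_law : loop_soup P Q D soup.
Variables (r : nat) (omega : 'I_r -> T -> seq V).
Variable start : uloop V -> nat -> V -> T -> nat.
Variable sigma : nat -> nat -> forall k : nat, T -> 'S_k.
Hypothesis indep : mutually_independent P (source_events omega soup start sigma).

(** The loops at a site, the permutation together with its degree, and a set of allowed starting
    positions for every copy. *)
Definition site_data : Type :=
  (seq (uloop V) * {k : nat & 'S_k} * (uloop V * nat -> set nat))%type.

Definition rectangle (L : set (uloop V)) (p : nat * nat) (x : V) (z : site_data) : set T :=
  [set t | [/\ config soup L z.1.1 t, sigma p.1 p.2 (tag z.1.2) t = tagged z.1.2 &
    forall lc, lc \in copies z.1.1 -> z.2 lc (start lc.1 lc.2 x t)]].

(** Distinct sites draw on distinct sources: the sets [L j] are disjoint, so the starting positions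
    concern different loops, and [p] is injective, so the permutations differ. The soup is a single
    source shared by all sites, and it is split by [config_joint]. *)
Lemma rectangle_joint (J : finType) (L : J -> set (uloop V)) (p : J -> nat * nat)
    (x : J -> V) (z : J -> site_data) (B : 'I_r -> set (seq V)) :
  trivIset setT L -> injective p -> (forall j, [set` (z j).1.1] `<=` L j) ->
  P ((\bigcap_(i in [set: 'I_r]) omega i @^-1` B i) `&`
     \bigcap_(j in [set: J]) rectangle (L j) (p j) (x j) (z j)) =
  (\prod_i P (omega i @^-1` B i)) *
  \prod_j ((config_pmf Q D (L j) (z j).1.1)%:E *
    P (sigma (p j).1 (p j).2 (tag (z j).1.2) @^-1` [set tagged (z j).1.2]) *
    \prod_(lc <- copies (z j).1.1) P (start lc.1 lc.2 (x j) @^-1` (z j).2 lc)).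
Proof.
move=> tL p_inj zL; pose c j := (z j).1.1.
pose K := {j : J & 'I_(size (copies (c j)))}.
pose copy (q : K) := tnth (in_tuple (copies (c (tag q)))) (tagged q).
pose I : finType := ('I_r + (unit + (J + K)))%type.
pose src (i : I) : @source V r := match i with
  | inl i => @Walk V r i
  | inr (inl _) => @Soup V r
  | inr (inr (inl j)) => @Shuffle V r (p j).1 (p j).2 (tag (z j).1.2)
  | inr (inr (inr q)) => @Start V r (copy q).1 (copy q).2 (x (tag q)) end.
pose E (i : I) : set T := match i with
  | inl i => omega i @^-1` B i
  | inr (inl _) => \bigcap_(j in [set: J]) config soup (L j) (c j)
  | inr (inr (inl j)) => sigma (p j).1 (p j).2 (tag (z j).1.2) @^-1` [set tagged (z j).1.2]
  | inr (inr (inr q)) => start (copy q).1 (copy q).2 (x (tag q)) @^-1` (z (tag q)).2 (copy q) end.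
have src_inj : injective src.
  move=> [i|[[]|[j|q]]] [i'|[[]|[j'|q']]] //=; first by move=> [->].
    move=> [p1 p2 _]; congr (inr (inr (inl _))); apply: p_inj.
    by rewrite [p j]surjective_pairing p1 p2 -surjective_pairing.
  move=> [q1 q2 _]; congr (inr (inr (inr _))).
  have qq' : copy q = copy q' by rewrite [copy q]surjective_pairing q1 q2 -surjective_pairing.
  have qL q0 : L (tag q0) (copy q0).1 by apply/zL/copies_mem/mem_tnth.
  have jj' : tag q = tag q'.
    by apply: tL => //; exists (copy q).1; split; [exact: qL|rewrite qq'; exact: qL].
  case: q q' {q1 q2 qL} qq' jj' => j k [j' k'] /= + jj'; subst j'; rewrite /copy /=.
  by move=> /(elimT (tuple_uniqP (in_tuple _)) (copies_uniq (c j)))->.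
have -> : (\bigcap_(i in [set: 'I_r]) omega i @^-1` B i) `&`
     \bigcap_(j in [set: J]) rectangle (L j) (p j) (x j) (z j) =
     \bigcap_(i in [set: I]) E i.
  apply/seteqP; split=> t.
    move=> [Hw Hr] [i|[[]|[j|q]]] _ /=; first exact: Hw.
    - by move=> j _; case: (Hr j Logic.I).
    - by case: (Hr j Logic.I).
    - by case: (Hr (tag q) Logic.I) => _ _; apply; exact: mem_tnth.
  move=> H; split=> [i _|j _]; first exact: (H (inl i)).
  split; [exact: (H (inr (inl tt)) _ j)|exact: (H (inr (inr (inl j))))|].
  move=> lc lcc; have lci : (index lc (copies (c j)) < size (copies (c j)))%N by rewrite index_mem.
  have := H (inr (inr (inr (existT _ j (Ordinal lci))))) Logic.I.
  by rewrite /= /copy /= (tnth_nth lc) /= nth_index.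
rewrite (mutually_independent_finType (E := E) indep src_inj); last first.
  move=> [i|[[]|[j|q]]] /=; try by eexists.
  exact: config_soup_events.
rewrite !big_sumType /=; congr (_ * _).
rewrite (big_pred1 tt) => [|[]//]; rewrite (config_joint Q_sub Q_radius soup_law) // -prodEFin.
rewrite [in RHS]big_split /= [in RHS]big_split /= -muleA; congr (_ * (_ * _)).
rewrite -(sig_big_dep xpredT (fun j (k : 'I_(size (copies (c j)))) => true)
  (fun j k => let lc := tnth (in_tuple (copies (c j))) k in
     P (start lc.1 lc.2 (x j) @^-1` (z j).2 lc))) /=.
by apply: eq_bigr => j _; rewrite [RHS]big_tnth.
Qed.

Hypothesis start_law : forall l c x, x \in lsupp l -> uniform_visit P l x (start l c x).
Hypothesis sigma_law : forall i s k, uniform_perm P (sigma i s k).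
Hypothesis omegaM : forall i w, measurable (omega i @^-1` [set w]).

Lemma rectangle_prob L p x z : [set` z.1.1] `<=` L ->
  P (rectangle L p x z) = (config_pmf Q D L z.1.1)%:E *
    P (sigma p.1 p.2 (tag z.1.2) @^-1` [set tagged z.1.2]) *
    \prod_(lc <- copies z.1.1) P (start lc.1 lc.2 x @^-1` z.2 lc).
Proof.
move=> zL; have := @rectangle_joint unit (fun=> L) (fun=> p) (fun=> x) (fun=> z) (fun=> setT).
rewrite big1 => [|i _]; last by rewrite preimage_setT probability_setT.
rewrite mul1e (big_pred1 tt) => [|[]//]; move=> <- //.
- congr (P _); apply/seteqP; split=> t; first by move=> H; split=> [i _|j _].
  by move=> [_ H]; exact: (H tt).
- by move=> [] [].
- by move=> [] [].
Qed.

Lemma rectangle_measurable L p x z : [set` z.1.1] `<=` L ->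
  (forall l, L l -> x \in lsupp l) -> measurable (rectangle L p x z).
Proof.
move=> zL Lx; have -> : rectangle L p x z = config soup L z.1.1 `&`
    (sigma p.1 p.2 (tag z.1.2) @^-1` [set tagged z.1.2] `&`
     \bigcap_(k in [set: 'I_(size (copies z.1.1))])
       (start (tnth (in_tuple (copies z.1.1)) k).1 (tnth (in_tuple (copies z.1.1)) k).2 x
          @^-1` z.2 (tnth (in_tuple (copies z.1.1)) k))).
  apply/seteqP; split=> t /=.
    by move=> [H1 H2 H3]; do 2 split=> //; move=> k _; apply: H3; exact: mem_tnth.
  move=> [H1 [H2 H3]]; split=> // lc lcc.
  have lci : (index lc (copies z.1.1) < size (copies z.1.1))%N by rewrite index_mem.
  by have := H3 (Ordinal lci) Logic.I; rewrite (tnth_nth lc) /= nth_index.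
apply: measurableI; first exact: (config_measurable soup_law).
apply: measurableI; first by have [sM _] := sigma_law p.1 p.2 (tag z.1.2); exact: sM.
apply: fin_bigcap_measurable => // k _.
set lc := tnth _ k; have lcx : x \in lsupp lc.1 by apply/Lx/zL/copies_mem/mem_tnth.
by have [stM _] := start_law lc.2 lcx; exact: preimage_countType_measurable.
Qed.

Section Rule.
Variables (J : finType) (L : J -> set (uloop V)) (p : J -> nat * nat) (x : J -> V).
Hypotheses (tL : trivIset setT L) (p_inj : injective p).
Hypothesis Lx : forall j l, L j l -> x j \in lsupp l.

(** [None] stands for the walks and [Some j] for the site [j], so that one product rule covers
    both. *)
Definition generators (o : option J) : set (set T) :=
  if o is Some j then
    [set rectangle (L j) (p j) (x j) z | z in [set z : site_data | [set` z.1.1] `<=` L j]]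
  else [set \bigcap_(i in [set: 'I_r]) omega i @^-1` B i | B in setT].

Lemma generators_measurable o : generators o `<=` measurable.
Proof.
case: o => [j|] A /=.
  by move=> [z zL <-]; apply: rectangle_measurable => //; exact: Lx.
move=> [B _ <-]; apply: fin_bigcap_measurable => // i _.
exact: preimage_countType_measurable.
Qed.

Lemma generators_rule : product_rule P generators.
Proof.
move=> E GE; have [B _ EB] := GE None.
have /choice[z zP] : forall j, exists z : site_data, [set` z.1.1] `<=` L j /\
    rectangle (L j) (p j) (x j) z = E (Some j).
  by move=> j; have [z zL zE] := GE (Some j); exists z.
have -> : \bigcap_(o in [set: option J]) E o =
    (\bigcap_(i in [set: 'I_r]) omega i @^-1` B i) `&`
    \bigcap_(j in [set: J]) rectangle (L j) (p j) (x j) (z j).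
  rewrite EB; apply/seteqP; split=> t.
    by move=> H; split=> [|j _]; [exact: H|rewrite (zP j).2; exact: H].
  by move=> [H H'] [j|] _ //; have := H' j Logic.I; rewrite (zP j).2.
rewrite rectangle_joint //; last by move=> j; exact: (zP j).1.
have -> : \prod_i P (omega i @^-1` B i) = P (E None).
  have := @rectangle_joint void (fun=> set0) (fun=> (0, 0)%N) (fun v => match v with end)
    (fun v => match v with end) B.
  rewrite -EB [X in _ = _ * X]big_pred0 ?mule1 => [<-|[]//]; try by case.
  by congr (P _); apply/seteqP; split=> t; [move=> []|move=> H; split=> // -[]].
rewrite (bigD1 None) //=; congr (_ * _).
rewrite (reindex_omap Some id) => [|[]//] /=; apply: eq_big => [j|j _].
  by rewrite eqxx.
by rewrite -rectangle_prob ?(zP j).2 //; exact: (zP j).1.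
Qed.

End Rule.

End Rectangles.

(** * The word inserted at a site *)

Section SiteLaw.
Context {R : realType} {V : finType} {d : measure_display} {T : measurableType d}.
Variables (P : probability T R) (Q : V -> V -> R) (D : {set V}).
Hypothesis Q_sub : substochastic Q.
Hypothesis Q_radius : (spectral_radius (submatrix Q [set: V]%SET) < 1)%R.
Variable soup : uloop V -> T -> nat.
Hypothesis soup_law : loop_soup P Q D soup.
Variables (r : nat) (omega : 'I_r -> T -> seq V).
Variable start : uloop V -> nat -> V -> T -> nat.
Variable sigma : nat -> nat -> forall k : nat, T -> 'S_k.
Hypothesis indep : mutually_independent P (source_events omega soup start sigma).
Hypothesis start_law : forall l c x, x \in lsupp l -> uniform_visit P l x (start l c x).
Hypothesis sigma_law : forall i s k, uniform_perm P (sigma i s k).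

Variables (L : set (uloop V)) (p : nat * nat) (x : V) (A : pred V).
Hypothesis Lx : forall l, L l -> x \in lsupp l.
Hypothesis LA : forall v, ohead v = Some x -> all (predC A) v <-> L (loop_at x v).

Definition soup_copies t : seq (uloop V * nat) :=
  enum_fset (fset_set [set lc | (lc.2 < soup lc.1 t)%N /\ L lc.1]).

Definition rooted_copies t : seq (seq V) :=
  [seq rot (start lc.1 lc.2 x t) (useq lc.1) | lc <- soup_copies t].

Definition inserted_loops t : seq (seq V) :=
  permute (sigma p.1 p.2 (size (rooted_copies t)) t).

Lemma soup_copies_config c t : [set` c] `<=` L -> config soup L c t ->
  soup_copies t = copies c.
Proof.
move=> cL cfg; rewrite /soup_copies /copies; congr enum_fset.
have E : [set lc | (lc.2 < soup lc.1 t)%N /\ L lc.1] = [set` config_fset c].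
  apply/seteqP; split=> lc /=; rewrite mem_config_fset.
    by move=> [+ Ll]; rewrite cfg.
  move=> lcc; have Ll : L lc.1 by apply/cL/copies_mem; rewrite mem_copies.
  by rewrite cfg.
by rewrite E set_fsetK.
Qed.

(* [fset_set] of an infinite set is the junk value [fset0]. *)
Lemma soup_copies_infinite t : ~ finite_soup soup L t -> soup_copies t = [::].
Proof.
move=> inf; rewrite /soup_copies /fset_set; case: pselect => // fin; case: inf.
apply: finite_soup_support.
apply: sub_finite_set (finite_image fst fin) => l [Ll l0].
by exists (l, 0%N).
Qed.

Lemma inserted_loopsE c t : soup_copies t = copies c ->
  inserted_loops t =
  [seq (let lc := tnth (in_tuple (copies c)) (sigma p.1 p.2 (size (copies c)) t j) in
        rot (start lc.1 lc.2 x t) (useq lc.1)) | j : 'I_(size (copies c))].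
Proof.
move=> cE; rewrite /inserted_loops.
(* The type of the permutation depends on the size of the list, so a whole family over all degrees
   is taken before the size is rewritten. *)
have permE (s : seq (seq V)) (f : forall k, 'S_k) :
    permute (f (size s)) = [seq nth [::] s (f (size s) j) | j : 'I_(size s)].
  by rewrite /permute; apply: eq_map => j; rewrite (tnth_nth [::]).
rewrite (permE _ (fun k => sigma p.1 p.2 k t)).
rewrite /rooted_copies size_map cE; apply: eq_map => j /=.
set i := sigma _ _ _ _ _; set lc := tnth _ _.
by rewrite (nth_map lc) // -[nth lc _ i](tnth_nth lc (in_tuple (copies c))).
Qed.

Lemma inserted_loops_neq0 t : [::] \notin inserted_loops t.
Proof.
apply/mapP => -[j _ /esym/(congr1 size)].
rewrite (tnth_nth [::]) /=; set i := sigma _ _ _ _ _.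
have : nth [::] (rooted_copies t) i \in rooted_copies t by exact: mem_nth.
by move=> /mapP[lc _ ->]; rewrite size_rot.
Qed.

Definition insertion_event (s : seq (seq V)) : set T :=
  finite_soup soup L `&` [set t | inserted_loops t = s].

Definition loops_of (s : seq (seq V)) := [seq loop_at x v | v <- s].

(** Slot [j] of [s] is filled by the copy of index [tau j]; quantifying over [j] states the
    constraint on the starting position of each copy without inverting [tau]. *)
Definition arrangement (s : seq (seq V)) (tau : 'S_(size (copies (loops_of s)))) : site_data :=
  (loops_of s, existT (fun k => 'S_k) _ tau,
   fun lc => [set n | forall j, tnth (in_tuple (copies (loops_of s))) (tau j) = lc ->
     rot n (useq lc.1) = nth [::] s j]).

(** Forgetting the roots undoes the random rooting, so [s] determines the configuration up to the
    order of the loops. *)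
Lemma insertion_event_loops (s : seq (seq V)) t : [::] \notin s -> insertion_event s t ->
  [set` loops_of s] `<=` L /\ config soup L (loops_of s) t.
Proof.
move=> sN [[c [cL cfg]] sE]; have cE := soup_copies_config cL cfg.
have cs : perm_eq c (loops_of s).
  rewrite perm_sym; apply: perm_trans (perm_copies c).
  rewrite -sE (inserted_loopsE cE) /loops_of -map_comp.
  set m := size (copies c); set tau := sigma _ _ _ _.
  rewrite (eq_map (g := fun j => (tnth (in_tuple (copies c)) (tau j)).1)); last first.
    by move=> j /=; rewrite loop_at_rot.
  have -> : [seq lc.1 | lc <- copies c] =
      [seq (tnth (in_tuple (copies c)) j).1 | j <- enum 'I_m].
    have E : [seq tnth (in_tuple (copies c)) j | j <- enum 'I_m] = copies c.
      exact: map_tnth_enum (in_tuple (copies c)).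
    by rewrite -{1}E -map_comp.
  rewrite (map_comp (fun j => (tnth (in_tuple (copies c)) j).1) tau).
  apply: perm_map; apply: uniq_perm; rewrite ?enum_uniq ?(map_inj_uniq perm_inj) ?enum_uniq // => j.
  by rewrite mem_enum; apply/mapP; exists (tau^-1 j)%g; rewrite ?mem_enum ?permKV.
split=> [l /= ls|l Ll]; first by apply: cL; rewrite /= (perm_mem cs).
by rewrite cfg // (seq.permP cs).
Qed.

Lemma insertion_event_empty (s : seq (seq V)) : [::] \notin s -> ~ [set` loops_of s] `<=` L ->
  insertion_event s = set0.
Proof. by move=> sN sL; rewrite -subset0 => t /(insertion_event_loops sN)[/sL]. Qed.

Lemma insertion_eventE (s : seq (seq V)) : [::] \notin s -> [set` loops_of s] `<=` L ->
  insertion_event s = \bigcup_tau rectangle soup start sigma L p x (arrangement (s := s) tau).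
Proof.
move=> sN sL; have size_s : size (copies (loops_of s)) = size s by rewrite size_copies size_map.
apply/seteqP; split=> t.
  move=> ts; have [_ cfg] := insertion_event_loops sN ts; case: ts => _ /= sE.
  exists (sigma p.1 p.2 (size (copies (loops_of s))) t) => //; split=> //= lc lcc j lcE.
  have E := inserted_loopsE (soup_copies_config sL cfg); rewrite sE in E.
  by apply/esym; apply: etrans (congr1 (fun s' => nth [::] s' j) E) _; rewrite nth_map_ord -lcE.
move=> [tau _ [/= cfg tauE H]]; split; first by exists (loops_of s).
rewrite /= (inserted_loopsE (soup_copies_config sL cfg)).
apply: (@eq_from_nth _ [::]) => [|j]; rewrite size_map size_enum_ord //.
move=> js; rewrite -[j]/(val (Ordinal js)) nth_map_ord /= tauE.
exact: (H (tnth (in_tuple (copies (loops_of s))) (tau (Ordinal js))) (mem_tnth _ _) (Ordinal js)).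
Qed.

Lemma trivIset_arrangement s :
  trivIset setT (fun tau => rectangle soup start sigma L p x (arrangement (s := s) tau)).
Proof. by move=> tau tau' _ _ [t [[_ /= <- _] [_ /= <- _]]]. Qed.

Definition visit_prob l v : R :=
  ((count (fun n => rot n (useq l) == v) (visits l x))%:R / (size (visits l x))%:R)%R.

Lemma start_prob l c v : L l ->
  P (start l c x @^-1` [set n | rot n (useq l) = v]) = (visit_prob l v)%:E.
Proof.
move=> Ll; rewrite (@discrete_law_finite _ _ _ _ _ _ _ (visits l x) _ (start_law c (Lx Ll))); last first.
- by move=> n /negPf->.
- by rewrite filter_uniq // iota_uniq.
congr EFin; rewrite big_seq_cond (eq_bigr (fun=> ((size (visits l x))%:R^-1)%R)) => [|n /andP[-> _]//].
rewrite -big_seq_cond -big_filter big_const_seq count_predT iter_addr_0 -[LHS]mulr_natl size_filter.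
congr (_%:R * _)%R; apply: eq_count => n.
by apply/idP/eqP => [/set_mem//|E]; exact/mem_set.
Qed.

Definition site_density : seq V -> R :=
  loop_density x (fun y => (y \in D) && ~~ A y) (fun v => path_weight Q (rcons v x)).

(** The mean number of copies that come out rooted as [v]. If [v] does not start at [x], both sides
    vanish, since a rotation at a visit to [x] starts at [x]. *)
Lemma mass_visit_prob v : v != [::] -> L (loop_at x v) ->
  (mass Q D [set loop_at x v] * visit_prob (loop_at x v) v = site_density v)%R.
Proof.
move=> vN Lv; rewrite /site_density /loop_density vN /= /based (negPf vN) /=.
have [vx|vx] := eqVneq (ohead v) (Some x).
  rewrite loop_measure_visit //.
  have /(_ Lv) vA := (LA vx).2.
  have -> : all (fun y => (y \in D) && ~~ A y) v = all (mem D) v.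
    by rewrite (all_predI (mem D) (predC A)) vA andbT.
  by [].
rewrite /visit_prob (eq_in_count (a2 := pred0)) ?count_pred0 ?mul0r ?mulr0 // => n.
rewrite mem_filter mem_iota => /andP[/eqP nx /= nl]; apply/eqP => nv.
by case/eqP: vx; rewrite -nv /rot (drop_nth x) //= nx.
Qed.

(** The Poisson weights carry [1 / n_l!] for a loop with [n_l] copies, and the number of
    permutations that put a copy of the right loop in every slot is the product of the [n_l!]. These
    cancel, leaving the [1 / m!] of the uniform permutation. *)
Lemma insertion_prob (s : seq (seq V)) : [::] \notin s ->
  P (insertion_event s) =
  (expR (- mass Q D L) * (\prod_(v <- s) site_density v) / (size s)`!%:R)%:E.
Proof.
move=> sN; have [sL|sL] := pselect ([set` loops_of s] `<=` L); last first.
  rewrite insertion_event_empty // measure0.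
  have [v vs vL] : exists2 v, v \in s & ~ L (loop_at x v).
    apply: contrapT => H; apply: sL => _ /mapP[v vs ->].
    by apply: contrapT => vL; apply: H; exists v.
  rewrite (big_rem v) //= /site_density /loop_density /based; case: ifP; last by rewrite mul0r mulr0 mul0r.
  move=> /andP[/negPf-> /= /andP[/eqP vx]]; rewrite (all_predI (mem D) (predC A)) => /andP[_ vA].
  by case: vL; apply/LA.
rewrite insertion_eventE //.
pose k := size (copies (loops_of s)); have kE : k = size s by rewrite /k size_copies size_map.
pose e (j : 'I_k) := (tnth (in_tuple (copies (loops_of s))) j).1.
pose f (j : 'I_k) := loop_at x (nth [::] s j).
have fs : [seq f j | j <- enum 'I_k] = loops_of s.
  rewrite /loops_of -[in RHS](mkseq_nth [::] s) /mkseq -map_comp -kE -val_enum_ord -map_comp.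
  exact: eq_map.
have es : [seq e j | j <- enum 'I_k] = [seq lc.1 | lc <- copies (loops_of s)].
  have E : [seq tnth (in_tuple (copies (loops_of s))) j | j <- enum 'I_k] = copies (loops_of s).
    exact: map_tnth_enum (in_tuple (copies (loops_of s))).
  by rewrite -[in RHS]E -map_comp.
have eL j : L (e j) by apply/sL/copies_mem/mem_tnth.
have rectP tau : P (rectangle soup start sigma L p x (arrangement (s := s) tau)) =
    (config_pmf Q D L (loops_of s) * ((k`!)%:R^-1 *
      \prod_j visit_prob (e (tau j)) (nth [::] s j)))%:E.
  rewrite (rectangle_prob Q_sub Q_radius soup_law indep) //= -muleA [RHS]EFinM; congr (_ * _).
  have [_ ->] := sigma_law p.1 p.2 k; rewrite [RHS]EFinM; congr (_ * _).
  rewrite big_tnth (reindex_inj (@perm_inj _ tau)) /= -prodEFin; apply: eq_bigr => j _.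
  rewrite -(start_prob (tnth (in_tuple (copies (loops_of s))) (tau j)).2) //.
  congr (P (_ @^-1` _)); apply/seteqP; split=> n /=; last first.
    by move=> E j' /(elimT (tuple_uniqP (in_tuple _)) (copies_uniq _))/perm_inj->.
  exact.
rewrite measure_fin_bigcup //; first last.
- by move=> tau _; apply: (rectangle_measurable soup_law).
- exact: trivIset_arrangement.
- exact: finite_finset.
rewrite (_ : [set: 'S_k] = [set` enum 'S_k]); last first.
  by apply/seteqP; split=> tau //= _; rewrite mem_enum.
rewrite -fsbig_seq ?enum_uniq // big_enum /= (eq_bigr _ (fun tau _ => rectP tau)) sumEFin; congr EFin.
rewrite -mulr_sumr -mulr_sumr.
have -> : (\sum_(tau : 'S_k) \prod_j visit_prob (e (tau j)) (nth [::] s j) =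
    (multiplicities (loops_of s))%:R * \prod_j visit_prob (f j) (nth [::] s j))%R.
  (* A permutation that puts a copy of the wrong loop in some slot contributes 0, because no
     rotation of that loop is the required word. *)
  have := card_matchings e f; rewrite es fs perm_copies => <-.
  rewrite -sum1_card natr_sum mulr_suml [LHS](bigID [pred tau : 'S_k | [forall j, e (tau j) == f j]]) /=.
  rewrite [X in (_ + X)%R]big1 ?addr0 => [|tau].
    apply: eq_big => [tau|tau /forallP etau]; first by rewrite inE.
    by rewrite mul1r; apply: eq_bigr => j _; rewrite (eqP (etau j)).
  rewrite negb_forall => /existsP[j ej]; rewrite (bigD1 j) //= /visit_prob.
  rewrite (eq_count (a2 := pred0)) ?count_pred0 ?mul0r // => n /=; apply/eqP => nE.
  by case/eqP: ej; rewrite /f -nE loop_at_rot.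
rewrite /config_pmf prodf_div multiplicities_undup natr_prod -/(loops_of s).
rewrite (prodr_undup_exp_count _ xpredT (fun l => mass Q D [set l])) /loops_of big_map.
set M := (\prod_(v <- s) _)%R; set N := (\prod_(l <- _) _)%R.
have -> : (\prod_j visit_prob (f j) (nth [::] s j) =
    \prod_(v <- s) visit_prob (loop_at x v) v)%R.
  by rewrite (big_nth [::]) big_mkord -kE.
have -> : (\prod_(v <- s) site_density v = M * \prod_(v <- s) visit_prob (loop_at x v) v)%R.
  rewrite -big_split /=; apply: eq_big_seq => v vs; rewrite mass_visit_prob //.
    by apply: contraNneq sN => <-.
  by apply: sL; exact: map_f.
have N0 : N != 0%R.
  rewrite /N prodf_seq_neq0; apply/allP => l _; by rewrite /= pnatr_eq0 -lt0n fact_gt0.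
rewrite kE -!mulrA; congr (_ * (_ * _))%R.
by rewrite mulrCA mulKf // mulrC.
Qed.

Definition word_event u : set T :=
  finite_soup soup L `&` [set t | flatten (inserted_loops t) = u].

(** There are at most [size u] nonempty factors, so this finite list is complete
    ([mem_all_factorizations]). *)
Definition all_factorizations (u : seq V) : seq (seq (seq V)) :=
  flatten [seq factorizations m u | m <- iota 0 (size u).+1].

Lemma mem_all_factorizations (u : seq V) s :
  (s \in all_factorizations u) = ([::] \notin s) && (flatten s == u).
Proof.
apply/flatten_mapP/idP => [[m _]|/andP[sN sE]]; first by rewrite mem_factorizations => /and3P[_ -> ->].
exists (size s); last by rewrite mem_factorizations eqxx sN.
rewrite mem_iota /= add0n ltnS -(eqP sE) size_flatten /shape.
elim: s sN {sE} => //= v s IH; rewrite inE negb_or => /andP[vN /IH].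
by rewrite -[(size s).+1]add1n => H; apply: leq_add H; rewrite lt0n size_eq0 eq_sym.
Qed.

Lemma word_eventE u : word_event u = \bigcup_(s in [set` all_factorizations u]) insertion_event s.
Proof.
apply/seteqP; split=> t.
  move=> [fin uE]; exists (inserted_loops t); last by [].
  by rewrite /= mem_all_factorizations inserted_loops_neq0 /= uE eqxx.
by move=> [s /=]; rewrite mem_all_factorizations => /andP[_ /eqP <-] [fin sE]; split=> //=; rewrite sE.
Qed.

Lemma insertion_event_measurable (s : seq (seq V)) : [::] \notin s ->
  measurable (insertion_event s).
Proof.
move=> sN; have [sL|sL] := pselect ([set` loops_of s] `<=` L); last first.
  by rewrite insertion_event_empty.
rewrite insertion_eventE //; apply: bigcup_countType_measurable => tau _.
exact: (rectangle_measurable soup_law).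
Qed.

Lemma word_event_measurable u : measurable (word_event u).
Proof.
rewrite word_eventE; apply: bigcup_countType_measurable => s /=.
by rewrite mem_all_factorizations => /andP[/insertion_event_measurable].
Qed.

Lemma trivIset_insertion_event (S : set (seq (seq V))) : trivIset S insertion_event.
Proof. by move=> s s' _ _ [t [[_ /= <-] [_ /= <-]]]. Qed.

(** The outer union runs over the factorisations of the word, the inner one over the arrangements of
    each factorisation. *)
Lemma word_event_disjoint_unions u :
  disjoint_unions (disjoint_unions
    [set rectangle soup start sigma L p x z | z in [set z : @site_data V | [set` z.1.1] `<=` L]])
  (word_event u).
Proof.
rewrite word_eventE; apply: disjoint_unions_bigcup; first exact: trivIset_insertion_event.
move=> s /=; rewrite mem_all_factorizations => /andP[sN _].
have [sL|sL] := pselect ([set` loops_of s] `<=` L); last first.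
  exists (fun=> set0); rewrite insertion_event_empty // bigcup0 //; split=> //; last by right.
  exact: trivIset_set0.
rewrite insertion_eventE //; apply: disjoint_unions_bigcup; first exact: trivIset_arrangement.
by move=> tau _; exists (arrangement tau).
Qed.

Lemma word_prob u : P (word_event u) =
  (expR (- mass Q D L) *
   (if based x (fun y => (y \in D) && ~~ A y) u then path_weight Q (rcons u x) else 0))%:E.
Proof.
rewrite word_eventE measure_fin_bigcup; first last.
- by move=> s /=; rewrite mem_all_factorizations => /andP[/insertion_event_measurable].
- exact: trivIset_insertion_event.
- exact: finite_seq.
have factors_uniq : uniq (all_factorizations u).
  rewrite /all_factorizations; move: (iota _ _) (iota_uniq 0 (size u).+1) => ms.
  elim: ms => //= m ms IH /andP[mms /IH]; rewrite cat_uniq factorizations_uniq /= => ->.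
  rewrite andbT; apply/hasPn => s /flatten_mapP[m' m'ms]; rewrite !mem_factorizations.
  move=> /and3P[/eqP sm' _ _]; apply/negP => /and3P[/eqP sm _ _].
  by move: mms; rewrite -sm sm' m'ms.
rewrite -fsbig_seq // (eq_big_seq (fun s =>
  (expR (- mass Q D L) * (\prod_(v <- s) site_density v) / (size s)`!%:R)%:E)); last first.
  by move=> s; rewrite mem_all_factorizations => /andP[/insertion_prob].
rewrite sumEFin; congr EFin.
(* The weight that includes the return to [x] is multiplicative on words based at [x]. *)
rewrite -(@sum_factorizations R V x _ (fun v => path_weight Q (rcons v x))) //; last first.
  move=> v v' _; rewrite /based => /orP[/eqP->|/andP[/eqP v'x _]]; first by rewrite cats0 mulr1.
  by case: v' v'x => // y v' [->]; rewrite rcons_cat /= path_weight_cat.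
rewrite /all_factorizations big_flatten big_map -[iota 0 (size u).+1]/(index_iota 0 (size u).+1) big_mkord mulr_sumr.
apply: eq_bigr => m _; rewrite factor_sum_factorizations mulr_suml mulr_sumr.
apply: eq_big_seq => s; rewrite mem_factorizations => /and3P[/eqP-> _ _].
by rewrite -mulrA.
Qed.

End SiteLaw.

(** * Comparison of the two laws *)

Section Proportionality.
Context {R : realType} {V : finType} {d : measure_display} {T : measurableType d}.
Variables (P : probability T R) (Q : V -> V -> R) (D : {set V}).
Hypothesis Q_sub : substochastic Q.
Hypothesis Q_radius : (spectral_radius (submatrix Q [set: V]%SET) < 1)%R.
Variables (r : nat) (a b : 'I_r -> V).
Variables (aD : forall i, a i \in D) (bD : forall i, b i \in D).
Hypothesis green_gt0 : forall i, (0 < green Q (aD i) (bD i))%R.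
Variable omega : 'I_r -> T -> seq V.
Hypothesis omega_law : forall i, normalized_walk P Q (aD i) (bD i) (omega i).
Variable soup : uloop V -> T -> nat.
Hypothesis soup_law : loop_soup P Q D soup.
Variable start : uloop V -> nat -> V -> T -> nat.
Hypothesis start_law : forall l c x, x \in lsupp l -> uniform_visit P l x (start l c x).
Variable sigma : nat -> nat -> forall k : nat, T -> 'S_k.
Hypothesis sigma_law : forall i s k, uniform_perm P (sigma i s k).
Hypothesis indep : mutually_independent P (source_events omega soup start sigma).

Definition walk_tuple t := [seq omega i t | i : 'I_r].

Lemma omega_measurable i w : measurable (omega i @^-1` [set w]).
Proof. by have [oM _] := omega_law i. Qed.

Lemma walk_tupleE (f : {ffun 'I_r -> seq V}) :
  [set t | walk_tuple t = [seq f i | i : 'I_r]] =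
  \bigcap_(i in [set: 'I_r]) omega i @^-1` [set f i].
Proof.
apply/seteqP; split=> t.
  move=> /= E i _ /=; have := congr1 (fun s => nth [::] s i) E.
  by rewrite /walk_tuple /= !nth_map_ord.
by move=> H; apply: eq_map => i; exact: H.
Qed.

(** Finite functions into [seq V] form a countable type, which makes this a countable union. *)
Lemma walk_tuple_event (S : set (seq (seq V))) :
  walk_tuple @^-1` S =
  \bigcup_(f in [set f : {ffun 'I_r -> seq V} | S [seq f i | i : 'I_r]])
    \bigcap_(i in [set: 'I_r]) omega i @^-1` [set f i].
Proof.
apply/seteqP; split=> t; last by move=> [f Sf]; rewrite -walk_tupleE /= => ->.
move=> St; have E : walk_tuple t = [seq [ffun i => omega i t] i | i : 'I_r].
  by apply: eq_map => i; rewrite ffunE.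
by exists [ffun i => omega i t]; rewrite /= -?E // -walk_tupleE /= -E.
Qed.

Lemma walk_rectangle_measurable (f : {ffun 'I_r -> seq V}) :
  measurable (\bigcap_(i in [set: 'I_r]) omega i @^-1` [set f i]).
Proof. by apply: fin_bigcap_measurable => // i _; exact: omega_measurable. Qed.

Lemma walk_event_measurable S : measurable (walk_tuple @^-1` S).
Proof.
rewrite walk_tuple_event; apply: bigcup_countType_measurable => f _.
exact: walk_rectangle_measurable.
Qed.

Lemma trivIset_walks (S : set {ffun 'I_r -> seq V}) :
  trivIset S (fun f => \bigcap_(i in [set: 'I_r]) omega i @^-1` [set f i]).
Proof.
move=> f f' _ _ [t [H H']]; apply/ffunP => i.
by rewrite -(H i Logic.I) -(H' i Logic.I).
Qed.

Variable ps : seq (record V).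
Let E := [set t | out_records (walk_tuple t) = ps].
Hypothesis E_gt0 : 0 < P E.

Lemma E_measurable : measurable E.
Proof. exact: (walk_event_measurable [set ws | out_records ws = ps]). Qed.

Lemma walk_prob (f : {ffun 'I_r -> seq V}) :
  P (\bigcap_(i in [set: 'I_r]) omega i @^-1` [set f i]) =
  (\prod_i (if path_in D (a i) (b i) (f i) then path_weight Q (f i) / green Q (aD i) (bD i)
     else 0))%:E.
Proof.
rewrite (mutually_independent_finType (j := @Walk V r) indep) => [|i i' []//|i]; last by eexists.
by rewrite -prodEFin; apply: eq_bigr => i _; have [_ ->] := omega_law i.
Qed.

(** Otherwise [E] would be a countable union of null events. The witness shows that [ps] is an
    actual output, so that [entangle_weave] applies. *)
Lemma possible_walks : exists f : {ffun 'I_r -> seq V},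
  [/\ out_records [seq f i | i : 'I_r] = ps,
      forall i, path_in D (a i) (b i) (f i) & forall i, path_weight Q (f i) != 0%R].
Proof.
apply: contrapT => H.
suff P0 : P E = 0 by move: E_gt0; rewrite P0 ltxx.
have -> : E = walk_tuple @^-1` [set ws | out_records ws = ps] by [].
rewrite walk_tuple_event (@measure_bigcup_proportional _ _ _ P _ 0 _ _
  (fun f : {ffun 'I_r -> seq V} => \bigcap_(i in [set: 'I_r]) omega i @^-1` [set f i])) ?mul0e //;
  try exact: trivIset_walks; try by move=> f _; exact: walk_rectangle_measurable.
move=> f fE; rewrite mul0e walk_prob; congr EFin; apply/eqP/prodf_eq0.
apply: contrapT => nz; apply: H; exists f; split=> // i.
  by apply: contrapT => /negP/negPf pi; apply: nz; exists i => //; rewrite pi.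
apply/eqP => w0; apply: nz; exists i => //; rewrite w0 mul0r.
by case: ifP.
Qed.

Definition lerw_paths := [seq path_of q | q <- ps].

Lemma out_records_weaves ws : out_records ws = ps <->
  exists2 uss, insertabless finset.set0 lerw_paths uss & weaves lerw_paths uss = ws.
Proof. by have [f [psE _ _]] := possible_walks; rewrite /lerw_paths -psE; exact: entangle_weave. Qed.

Lemma size_lerw_paths : size lerw_paths = r.
Proof.
have [f [psE _ _]] := possible_walks; rewrite /lerw_paths -psE size_map /out_records.
have H C (hs : seq (record V)) : size (entangle C hs) = size hs.
  by elim: hs C => //= h hs IH C; rewrite IH.
by rewrite H size_map size_image card_ord.
Qed.

Lemma nth_weaves uss i : size uss = r -> (i < r)%N ->
  nth [::] (weaves lerw_paths uss) i = weave (nth [::] lerw_paths i) (nth [::] uss i).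
Proof.
move=> sz ir; rewrite (nth_map ([::], [::])) ?nth_zip ?size_lerw_paths ?sz //.
by rewrite size_zip size_lerw_paths sz minnn.
Qed.

(** A possible walk is woven from this path and has its weight as a factor. *)
Lemma path_in_lerw_paths (i : 'I_r) : path_in D (a i) (b i) (nth [::] lerw_paths i) /\
  path_weight Q (nth [::] lerw_paths i) != 0%R.
Proof.
have [f [fE pathf weightf]] := possible_walks.
have [uss Huss E'] := (out_records_weaves _).1 fE.
have [sz insP] := (insertablessP _ _ _).1 Huss; rewrite size_lerw_paths in sz insP.
have wE : weave (nth [::] lerw_paths i) (nth [::] uss i) = f i.
  by rewrite -nth_weaves // E' nth_map_ord.
have ins := insP i (ltn_ord i); split.
  by have := pathf i; rewrite -wE (path_in_weave _ _ _ ins) => /andP[].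
by have := weightf i; rewrite -wE (path_weight_weave _ ins); apply: contraNneq => ->; rewrite mul0r.
Qed.

Definition site : finType := {i : 'I_r & 'I_(size (nth [::] lerw_paths i))}.
Implicit Types (j : site) (u : {ffun site -> seq V}).

Definition site_pos j : nat * nat := (val (tag j), val (tagged j)).
Definition site_vertex j : V := tnth (in_tuple (nth [::] lerw_paths (tag j))) (tagged j).
Definition site_past j : seq V :=
  flatten (take (tag j) lerw_paths) ++ take (tagged j) (nth [::] lerw_paths (tag j)).
Definition site_loops j : set (uloop V) :=
  [set l | assigned lerw_paths l (site_pos j).1 (site_pos j).2].

Lemma site_pos_inj : injective site_pos.
Proof.
move=> [i s] [i' s'] [/val_inj ii' ss']; subst i'.
by congr existT; apply: val_inj.
Qed.

Lemma site_loopsE j l : site_loops j l <->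
  (site_vertex j \in lsupp l) && ~~ has (mem (lsupp l)) (site_past j).
Proof.
rewrite /site_loops /= (assignedE (site_vertex j)) ?size_lerw_paths //.
by have -> : nth (site_vertex j) (nth [::] lerw_paths (tag j)) (tagged j) = site_vertex j
  by rewrite [RHS](tnth_nth (site_vertex j)).
Qed.

Lemma site_loops_vertex j l : site_loops j l -> site_vertex j \in lsupp l.
Proof. by move/site_loopsE/andP => []. Qed.

Lemma trivIset_site_loops : trivIset setT site_loops.
Proof.
move=> j j' _ _ [l [/= /and3P[_ /eqP i1 /eqP s1] /and3P[_ /eqP i2 /eqP s2]]].
have ii : (site_pos j).1 = (site_pos j').1 by rewrite -i1 -i2.
apply: site_pos_inj; rewrite [site_pos j]surjective_pairing [site_pos j']surjective_pairing.
by rewrite -s1 -s2 ii.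
Qed.

Lemma site_loops_at j v : ohead v = Some (site_vertex j) ->
  all (predC (mem (site_past j))) v <-> site_loops j (loop_at (site_vertex j) v).
Proof.
move=> vx; have vN : v != [::] by case: v vx.
rewrite site_loopsE mem_lsupp_loop_at //.
have -> : site_vertex j \in v by case: (v) vx => // y v' [->]; exact: mem_head.
rewrite all_predC (has_sym (site_past j)) /=.
by rewrite (@eq_has _ (mem (lsupp (loop_at (site_vertex j) v))) (mem v)) // => y; exact: mem_lsupp_loop_at.
Qed.

Definition inserted_word j t : seq V :=
  flatten (inserted_loops soup start sigma (site_loops j) (site_pos j) (site_vertex j) t).

Definition words_of u : seq (seq (seq V)) :=
  [seq [seq u (existT _ i s) | s : 'I_(size (nth [::] lerw_paths i))] | i : 'I_r].

(** The paths are those of the fixed value [ps], not those of the walks at [t]; the two agree on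
    [E]. *)
Definition result t := insert_loops lerw_paths (soup^~ t)
  (fun l c x => start l c x t) (fun i s k => sigma i s k t).

Lemma result_weaves t : result t = weaves lerw_paths (words_of [ffun j => inserted_word j t]).
Proof.
rewrite /result /insert_loops size_lerw_paths -val_enum_ord -map_comp.
have E' : [seq nth [::] lerw_paths i | i : 'I_r] = lerw_paths.
  by rewrite -[RHS](mkseq_nth [::]) /mkseq size_lerw_paths -val_enum_ord -map_comp.
rewrite /weaves /words_of -[X in zip X _]E' zip_map -map_comp; apply: eq_map => i /=.
by rewrite -weave_flatten; congr flatten; apply: eq_map => s; rewrite ffunE.
Qed.

Lemma nth_words_of u j :
  nth [::] (nth [::] (words_of u) (tag j)) (tagged j) = u j.
Proof. by rewrite !nth_map_ord; case: j. Qed.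

Lemma words_of_inj : injective words_of.
Proof. by move=> u u' uu'; apply/ffunP => j; rewrite -!nth_words_of uu'. Qed.

Lemma words_of_onto uss : insertabless finset.set0 lerw_paths uss ->
  exists u, uss = words_of u.
Proof.
move=> /insertablessP[]; rewrite size_lerw_paths => sz insP.
exists [ffun j : site => nth [::] (nth [::] uss (tag j)) (tagged j)].
apply: (@eq_from_nth _ [::]); rewrite sz; first by rewrite size_map size_enum_ord.
move=> i ir; pose i' := Ordinal ir.
have -> : nth [::] (words_of [ffun j : site => nth [::] (nth [::] uss (tag j)) (tagged j)]) i =
    [seq nth [::] (nth [::] uss i) s | s : 'I_(size (nth [::] lerw_paths i))].
  rewrite (nth_map_ord _ _ i'); apply: eq_map => s; by rewrite ffunE.
have [sz' _] := (insertablesP (a i') _ _ _).1 (insP i ir).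
by rewrite -[LHS](mkseq_nth [::]) /mkseq sz' -val_enum_ord -map_comp.
Qed.

Definition insertion_family u : set T :=
  E `&` \bigcap_(j in [set: site])
    word_event soup start sigma (site_loops j) (site_pos j) (site_vertex j) (u j).

Definition walk_family u : set T :=
  [set t | insertabless finset.set0 lerw_paths (words_of u) /\ walk_tuple t = weaves lerw_paths (words_of u)].

Definition all_finite : set T := \bigcap_(j in [set: site]) finite_soup soup (site_loops j).

Lemma bigcup_walk_family B : \bigcup_(u in [set u | B (weaves lerw_paths (words_of u))]) walk_family u =
  E `&` walk_tuple @^-1` B.
Proof.
apply/seteqP; split=> t.
  move=> [u Bu [ins tE]]; split; last by rewrite /= tE.
  by apply/out_records_weaves; exists (words_of u).
move=> [/out_records_weaves[uss ins ussE] Bt]; have [u uE] := words_of_onto ins.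
by exists u; rewrite /= -?uE ?ussE //; split; rewrite -uE.
Qed.

Lemma bigcup_insertion_family B : \bigcup_(u in [set u | B (weaves lerw_paths (words_of u))]) insertion_family u =
  (E `&` result @^-1` B) `&` all_finite.
Proof.
apply/seteqP; split=> t.
  move=> [u Bu [Et wu]]; split; last by move=> j _; case: (wu j Logic.I).
  split=> //; rewrite /= result_weaves (_ : [ffun j => inserted_word j t] = u) //.
  by apply/ffunP => j; rewrite ffunE; case: (wu j Logic.I).
move=> [[Et Bt] fin]; exists [ffun j => inserted_word j t]; first by rewrite /= -result_weaves.
by split=> // j _; split; [exact: fin|rewrite ffunE].
Qed.

Lemma trivIset_walk_family S : trivIset S walk_family.
Proof.
move=> u u' _ _ [t [[ins E1] [ins' E2]]]; apply: words_of_inj.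
by apply: weaves_inj ins ins' _; rewrite -E1 -E2.
Qed.

Lemma trivIset_insertion_family S : trivIset S insertion_family.
Proof.
move=> u u' _ _ [t [[_ wu] [_ wu']]]; apply/ffunP => j.
by have [_ <-] := wu j Logic.I; have [_ <-] := wu' j Logic.I.
Qed.

Lemma site_word_measurable j w : measurable
  (word_event soup start sigma (site_loops j) (site_pos j) (site_vertex j) w).
Proof.
exact: (word_event_measurable soup_law start_law sigma_law (site_pos j) (@site_loops_vertex j) w).
Qed.

Lemma insertion_family_measurable u : measurable (insertion_family u).
Proof.
apply: measurableI; first exact: E_measurable.
by apply: fin_bigcap_measurable => // j _; exact: site_word_measurable.
Qed.

Lemma walk_family_measurable u : measurable (walk_family u).
Proof.
have [ins|nins] := pselect (insertabless finset.set0 lerw_paths (words_of u)).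
  have -> : walk_family u = walk_tuple @^-1` [set weaves lerw_paths (words_of u)].
    by apply/seteqP; split=> t; [case|].
  exact: walk_event_measurable.
by have -> : walk_family u = set0 by rewrite -subset0 => t [].
Qed.

Lemma all_finite_measurable : measurable all_finite.
Proof.
by apply: fin_bigcap_measurable => // j _; exact: (finite_soup_measurable soup_law).
Qed.

Lemma all_finite_as (A : set T) : measurable A -> P (A `&` all_finite) = P A.
Proof.
move=> mA; have P0 : P (~` all_finite) = 0.
  apply/eqP; rewrite eq_le measure_ge0 andbT.
  have -> : 0 = \sum_(j \in [set: site]) P (~` finite_soup soup (site_loops j)).
    rewrite fsbig1 // => j _.
    by rewrite probability_setC ?(finite_soup_as Q_sub Q_radius soup_law) ?subee //;
      exact: (finite_soup_measurable soup_law).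
  apply: content_sub_fsum.
  - exact: finite_finset.
  - by move=> j _; apply: measurableC; exact: (finite_soup_measurable soup_law).
  - by apply: measurableC; exact: all_finite_measurable.
  - by rewrite /all_finite setC_bigcap.
rewrite [RHS](measureDI P mA all_finite_measurable) -[LHS]add0e; congr (_ + _).
apply/esym/eqP; rewrite eq_le measure_ge0 andbT -P0; apply: le_measure; rewrite ?inE.
- by apply: measurableD => //; exact: all_finite_measurable.
- by apply: measurableC; exact: all_finite_measurable.
- by move=> t [].
Qed.

(** Needed before [all_finite_as] can restrict this event to finite soups. *)
Lemma result_event_measurable B : measurable (E `&` result @^-1` B).
Proof.
have -> : E `&` result @^-1` B = \bigcup_(u in [set u | B (weaves lerw_paths (words_of u))])
    (E `&` \bigcap_(j in [set: site]) [set t | inserted_word j t = u j]).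
  apply/seteqP; split=> t.
    move=> [Et Bt]; exists [ffun j => inserted_word j t]; first by rewrite /= -result_weaves.
    by split=> // j _ /=; rewrite ffunE.
  move=> [u Bu [Et wu]]; split=> //; rewrite /= result_weaves (_ : [ffun j => inserted_word j t] = u) //.
  by apply/ffunP => j; rewrite ffunE; exact: (wu j).
apply: bigcup_countType_measurable => u _; apply: measurableI; first exact: E_measurable.
apply: fin_bigcap_measurable => // j _.
have finM : measurable (finite_soup soup (site_loops j)).
  exact: (finite_soup_measurable soup_law).
(* On an infinite soup the enumeration of copies is empty by default, and so is the inserted
   word. *)
have -> : [set t | inserted_word j t = u j] =
    word_event soup start sigma (site_loops j) (site_pos j) (site_vertex j) (u j) `|`
    (if u j == [::] then ~` finite_soup soup (site_loops j) else set0).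
  have infE t : ~ finite_soup soup (site_loops j) t -> inserted_word j t = [::].
    move=> inf; rewrite /inserted_word /inserted_loops /rooted_copies (soup_copies_infinite inf) /=.
    by rewrite [permute _](size0nil _) // /permute size_image card_ord.
  apply/seteqP; split=> t /=.
    have [fin wt|inf wt] := pselect (finite_soup soup (site_loops j) t); [left|right] => //.
    by rewrite -wt infE //; case: ifP.
  by move=> [[_]|] //; case: eqP => // -> /infE.
apply: measurableU; first exact: site_word_measurable.
by case: ifP => // _; exact: measurableC.
Qed.

Lemma E_disjoint_unions (C : set (set T)) :
  (forall B, C (\bigcap_(i in [set: 'I_r]) omega i @^-1` B i)) ->
  disjoint_unions (disjoint_unions C) E.
Proof.
(* A trivial union over [unit] brings [E] to the same double level of unions as the words at the
   sites. *)
move=> CB; have -> : E = \bigcup_(y in [set: unit]) E by rewrite bigcup_const //; exists tt.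
apply: disjoint_unions_bigcup; first by move=> [] [].
move=> _ _; rewrite -[E]/(walk_tuple @^-1` [set ws | out_records ws = ps]) walk_tuple_event.
apply: disjoint_unions_bigcup; first exact: trivIset_walks.
by move=> f _; exact: (CB (fun i => [set f i])).
Qed.

Definition site_mass : R := (\prod_j expR (- mass Q D (site_loops j)))%R.

Definition site_weight j w : R :=
  if based (site_vertex j) (fun y => (y \in D) && (y \notin site_past j)) w
  then path_weight Q (rcons w (site_vertex j)) else 0%R.

(** [E] depends on the walks alone and the words on the other sources; the product rule, extended
    twice to disjoint unions, separates them and the sites. *)
Lemma insertion_family_prob u :
  P (insertion_family u) = P E * (site_mass * \prod_j site_weight j (u j))%:E.
Proof.
pose C := generators soup omega start sigma site_loops site_pos site_vertex.
have rule : product_rule P (fun o => disjoint_unions (disjoint_unions (C o))).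
  apply: product_rule_disjoint_unions.
    move=> o; apply: disjoint_unions_measurable.
    exact: (generators_measurable soup_law start_law sigma_law omega_measurable site_loops_vertex).
  apply: product_rule_disjoint_unions.
    exact: (generators_measurable soup_law start_law sigma_law omega_measurable site_loops_vertex).
  exact: (generators_rule Q_sub Q_radius soup_law indep trivIset_site_loops site_pos_inj).
pose F (o : option site) := if o is Some j then
  word_event soup start sigma (site_loops j) (site_pos j) (site_vertex j) (u j) else E.
have -> : insertion_family u = \bigcap_(o in [set: option site]) F o.
  apply/seteqP; split=> t; first by move=> [Et wu] [j|] _ //; exact: wu.
  by move=> H; split=> [|j _]; [exact: (H None)|exact: (H (Some j))].
rewrite rule => [|[j|]]; last first.
- by apply: E_disjoint_unions => B; exists B.
- exact: word_event_disjoint_unions.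
rewrite (bigD1 None) //=; congr (_ * _).
rewrite (reindex_omap Some id) => [|[]//] /=; rewrite (eq_bigl predT); last by move=> j; rewrite eqxx.
rewrite /site_mass -big_split -prodEFin; apply: eq_bigr => j _.
by rewrite (word_prob Q_sub Q_radius soup_law indep start_law sigma_law _ (@site_loops_vertex j) (@site_loops_at j)).
Qed.

Lemma site_weightE j w : site_weight j w =
  if insertable [set y in site_past j]%SET (site_vertex j) w && all (mem D) w
  then path_weight Q (rcons w (site_vertex j)) else 0%R.
Proof.
rewrite /site_weight /based (all_predI (mem D) (predC (mem (site_past j)))).
case: w => [|y w]; first by [].
have dE : [disjoint [set z in y :: w]%SET & [set z in site_past j]%SET]%B =
    all (predC (mem (site_past j))) (y :: w).
  rewrite all_predC; apply/pred0P/hasPn => H z.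
    by move=> zw; apply/negP => /= zp; have := H z; rewrite /= !finset.inE -in_cons zw /= (zp : z \in site_past j).
  by rewrite /= !finset.inE -in_cons; apply/negP => /andP[zw zp]; move/negP: (H z zw); apply.
rewrite /insertable dE; move: (all (mem D) _) (all (predC _) _) => b1 b2.
rewrite -[ohead _ == _]/(y == site_vertex j) orFb.
by case: (y == _); case: b1; case: b2.
Qed.

Lemma insertabless_words u : insertabless finset.set0 lerw_paths (words_of u) <->
  forall j, insertable [set y in site_past j]%SET (site_vertex j) (u j).
Proof.
have setE j : (finset.set0 :|: [set y in flatten (take (tag j) lerw_paths)] :|:
    [set y in take (tagged j) (nth [::] lerw_paths (tag j))] = [set y in site_past j])%SET.
  by apply/setP => y; rewrite !finset.inE mem_cat.
split=> [/insertablessP[_]|H].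
  rewrite size_lerw_paths => insP j.
  have /(insertablesP (site_vertex j))[_] := insP _ (ltn_ord (tag j)).
  move=> /(_ _ (ltn_ord (tagged j))); rewrite setE nth_words_of.
  by rewrite -[nth _ (nth _ lerw_paths _) _](tnth_nth _ (in_tuple _)).
apply/insertablessP; rewrite size_image card_ord size_lerw_paths; split=> // i ir.
pose i' := Ordinal ir; rewrite (nth_map_ord _ _ i').
apply/(insertablesP (a i')); rewrite size_image card_ord; split=> // s sg.
pose s' := Ordinal sg; pose j : site := existT _ i' s'.
have := H j; rewrite -setE (nth_map_ord _ _ s') /site_vertex (tnth_nth (a i')).
exact.
Qed.

Definition walk_const : R :=
  (\prod_(i < r) (path_weight Q (nth [::] lerw_paths i) / green Q (aD i) (bD i)))%R.

Lemma walk_const_neq0 : walk_const != 0%R.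
Proof.
apply/prodf_neq0 => i _; rewrite mulf_neq0 ?invr_neq0 ?(gt_eqF (green_gt0 _)) //.
by have [] := path_in_lerw_paths i.
Qed.

Lemma walk_family_prob u :
  P (walk_family u) = (walk_const * \prod_j site_weight j (u j))%:E.
Proof.
have [ins|nins] := pselect (insertabless finset.set0 lerw_paths (words_of u)); last first.
  have -> : walk_family u = set0 by rewrite -subset0 => t [].
  have [j nj] : exists j, ~~ insertable [set y in site_past j]%SET (site_vertex j) (u j).
    apply: contrapT => H; apply: nins; apply/insertabless_words => j.
    by apply: contrapT => /negP nj; apply: H; exists j.
  by rewrite measure0 (bigD1 j) //= site_weightE (negPf nj) /= mul0r mulr0.
pose f := [ffun i : 'I_r => weave (nth [::] lerw_paths i) (nth [::] (words_of u) i)].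
have wE : weaves lerw_paths (words_of u) = [seq f i | i : 'I_r].
  have szW : size (weaves lerw_paths (words_of u)) = r.
    by rewrite size_map size_zip size_lerw_paths size_image card_ord minnn.
  apply: (@eq_from_nth _ [::]); rewrite szW ?size_image ?card_ord // => i ir.
  rewrite nth_weaves ?size_image ?card_ord //.
  by rewrite [RHS](nth_map_ord _ _ (Ordinal ir)) ffunE.
have -> : walk_family u = \bigcap_(i in [set: 'I_r]) omega i @^-1` [set f i].
  by rewrite -walk_tupleE -wE; apply/seteqP; split=> t; [case|].
rewrite walk_prob; congr EFin.
have -> : (\prod_j site_weight j (u j) = \prod_(i < r) \prod_(s < size (nth [::] lerw_paths i))
    site_weight (existT _ i s : site) (u (existT _ i s)))%R.
  by rewrite sig_big_dep /=; apply: eq_bigr => -[i s] _.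
rewrite /walk_const -big_split /=.
apply: eq_bigr => i _; rewrite ffunE.
have /insertablessP[_] := ins; rewrite size_lerw_paths => /(_ i (ltn_ord i)) insi.
have [gi _] := path_in_lerw_paths i; rewrite (path_in_weave _ _ _ insi) gi /=.
have insj := (insertabless_words u).1 ins.
have allE : all (all (mem D)) (nth [::] (words_of u) i) =
    [forall s : 'I_(size (nth [::] lerw_paths i)), all (mem D) (u (existT _ i s))].
  rewrite nth_map_ord; apply/allP/forallP => [H s|H _ /mapP[s _ ->]]; last exact: H.
  by apply: H; apply: map_f; rewrite mem_enum.
rewrite allE; case: ifPn => [/forallP allD|]; last first.
  by rewrite negb_forall => /existsP[s ns]; rewrite (bigD1 s) //= site_weightE (negPf ns) andbF mul0r mulr0.
rewrite (path_weight_weave _ insi) [in RHS]mulrAC; congr (_ * _ / _)%R.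
apply: eq_bigr => s _; rewrite site_weightE insj allD /=.
by rewrite nth_map_ord nth_map_ord.
Qed.

Lemma result_walks_law B : P (E `&` result @^-1` B) = P (E `&` walk_tuple @^-1` B).
Proof.
have PE : P E \is a fin_num by rewrite fin_num_measure //; exact: E_measurable.
pose c := (fine (P E) * site_mass / walk_const)%R.
have H B' : P (E `&` result @^-1` B') = c%:E * P (E `&` walk_tuple @^-1` B').
  rewrite -(all_finite_as (result_event_measurable B')) -bigcup_insertion_family -bigcup_walk_family.
  apply: measure_bigcup_proportional.
  - exact: trivIset_insertion_family.
  - exact: trivIset_walk_family.
  - by move=> u _; exact: insertion_family_measurable.
  - by move=> u _; exact: walk_family_measurable.
  - move=> u _; rewrite insertion_family_prob walk_family_prob -{1}(fineK PE) -!EFinM; congr EFin.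
    by rewrite /c -!mulrA mulKf ?walk_const_neq0.
(* With the whole space as event, [H] reads [P E = c * P E], and [P E] is positive. *)
have c1 : c = 1%R.
  have P0 : (0 < fine (P E))%R by rewrite -lte_fin fineK.
  apply: (mulIf (lt0r_neq0 P0)); rewrite mul1r.
  by have := H setT; rewrite !preimage_setT setIT -(fineK PE) -EFinM => -[].
by rewrite H c1 mul1e.
Qed.

End Proportionality.

Local Close Scope ereal_scope.

Theorem proposition2p2
  (R : realType) (V : finType) (Q : V -> V -> R)
  (Q_sub : substochastic Q)
  (Q_radius : spectral_radius (submatrix Q [set: V]%SET) < 1)
  (D : {set V}) (r : nat) (r_gt0 : (0 < r)%N)
  (a b : 'I_r -> V) (aD : forall i, a i \in D) (bD : forall i, b i \in D)
  (green_gt0 : forall i, 0 < green Q (aD i) (bD i))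
  (d : measure_display) (T : measurableType d) (P : probability T R)
  (omega : 'I_r -> T -> seq V)
  (omega_law : forall i, normalized_walk P Q (aD i) (bD i) (omega i))
  (soup : uloop V -> T -> nat)
  (soup_law : loop_soup P Q D soup)
  (start : uloop V -> nat -> V -> T -> nat)
  (start_law : forall l c x, x \in lsupp l -> uniform_visit P l x (start l c x))
  (sigma : nat -> nat -> forall k : nat, T -> 'S_k)
  (sigma_law : forall i s k, uniform_perm P (sigma i s k))
  (indep : mutually_independent P (source_events omega soup start sigma)) :
  let walks t := [seq omega i t | i : 'I_r] in
  let records t := out_records (walks t) in
  let result t := insert_loops (multipath_lerw (walks t)) (soup^~ t)
    (fun l c x => start l c x t) (fun i s k => sigma i s k t) in
  forall p : seq (record V),
    let E := [set t | records t = p] in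
    (0 < P E)%E ->
    forall B : set (seq (seq V)),
      cond_law P E result B = cond_law P E walks B.
Proof.
move=> walks records result0 ps E0 E0_gt0 B.
rewrite /cond_law; congr (fine _ / _).
(* On [E0] the random paths of the statement are the fixed paths of [ps]. *)
have -> : result0 @^-1` B `&` E0 = E0 `&` result soup start sigma ps @^-1` B.
  rewrite setIC; apply/seteqP; split=> t [Et]; rewrite /= /result0 /result /multipath_lerw.
    by have -> : out_records (walks t) = ps by [].
  by have -> : out_records (walks t) = ps by [].
apply: etrans (result_walks_law Q_sub Q_radius green_gt0 omega_law soup_law start_law
  sigma_law indep E0_gt0 B) _.
by rewrite setIC.
Qed.
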